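(* Let $1<q<\infty$ and let $\Omega\subset\mathbb{R}^3$ be a nonempty open bounded set. Then there exist a measurable mapping $P:\Omega\to\mathbb{R}^{3\times 3}$ with $P(x)\in SO(3)$ for a.e. $x\in\Omega$ and a sequence $(u_n)_{n\ge 1}$ in $W_0^{1,q}(\Omega;\mathbb{R}^3)\cap L^\infty(\Omega;\mathbb{R}^3)$ such that: (a) for every $n$, $Du_n(x)P(x)+(Du_n(x)P(x))^T=0$ for a.e. $x\in\Omega$; (b) for every $n$, $\|Du_n\|_q=2^{1/q}$; (c) $\|u_n\|_\infty\to 0$ as $n\to\infty$.
   Context: $SO(3)$ is the group of real orthogonal $3\times 3$ matrices with determinant $1$. For $u=(u^1,u^2,u^3)\in W_0^{1,q}(\Omega;\mathbb{R}^3)$, $Du$ denotes the $3\times 3$ matrix-valued weak derivative whose $i$-th row is the gradient of the component $u^i$; $DuP$ denotes the pointwise matrix product. For a measurable matrix field $M:\Omega\to\mathbb{R}^{3\times 3}$ with rows $m_1,m_2,m_3$, the $L^q$-norm is defined by $$\|M\|_q^q=\int_\Omega\left(|m_1(x)|^q+|m_2(x)|^q+|m_3(x)|^q\right)dx,$$ where $|\cdot|$ is the Euclidean norm on $\mathbb{R}^3$. $\|u\|_\infty$ is the essential supremum over $\Omega$ of the Euclidean norm $|u(x)|$. *)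

(* Defs.v *)
From HB Require Import structures.
From mathcomp Require Import all_boot all_order all_algebra.
From mathcomp Require Import all_classical all_reals all_analysis.

Set Implicit Arguments.
Unset Strict Implicit.
Unset Printing Implicit Defensive.

Import Order.TTheory GRing.Theory Num.Theory.
Import numFieldNormedType.Exports.

Local Open Scope classical_set_scope.
Local Open Scope ring_scope.

(* Points of R^3 are triples, so that the product topology, the product Borel
   sigma-algebra and product measures are available.  The norm of this type is
   the max norm, used only through the topology and through boundedness;
   values are row vectors, with the Euclidean norm [enorm] below. *)
Notation R3 R := (Real.sort R * Real.sort R * Real.sort R)%type.

(* The same carrier and sigma-algebra as [R3 R], with the display that
   [lebesgue_measure] carries. *)
Notation mR3 R :=
  (measurableTypeR R * measurableTypeR R * measurableTypeR R)%type.

Section Definitions.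
Context {R : realType}.

Definition leb3 : {measure set (mR3 R) -> \bar R} :=
  ((@lebesgue_measure R \x @lebesgue_measure R) \x @lebesgue_measure R)%E.

Definition enorm n (v : 'rV[R]_n) : R := Num.sqrt (\sum_j v 0 j ^+ 2).

Definition SO3 : set 'M[R]_3 := [set M | M *m M^T = 1%:M /\ \det M = 1].

(* All functions below matter only on the open set Omega.  Measurability is
   Borel measurability; as every Lebesgue measurable function agrees a.e. with
   a Borel one, the classes of functions modulo a.e. equality are the same. *)
Definition measurable_on (Omega : set (R3 R)) (f : R3 R -> R) : Prop :=
  @measurable_fun _ _ (mR3 R) R Omega f.

Definition Lnorm_on (p : \bar R) (Omega : set (R3 R)) (f : R3 R -> R) : \bar R :=
  'N[leb3]_p [(EFin \o f) \_ Omega]%E.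

Definition in_Lp (p : \bar R) (Omega : set (R3 R)) (f : R3 R -> R) : Prop :=
  measurable_on Omega f /\ (Lnorm_on p Omega f < +oo)%E.

Definition e3 (i : 'I_3) : R3 R :=
  ((i == 0%N :> nat)%:R, (i == 1%N :> nat)%:R, (i == 2%N :> nat)%:R).

Definition iter_partial (s : seq 'I_3) (f : R3 R -> R) : R3 R -> R :=
  foldr (fun i g => 'D_(e3 i) g) f s.

Definition smooth (f : R3 R -> R) : Prop :=
  forall s : seq 'I_3, continuous (iter_partial s f) /\
    forall i x, derivable (iter_partial s f) x (e3 i).

Definition test_function (Omega : set (R3 R)) (phi : R3 R -> R) : Prop :=
  let supp := closure [set x | phi x != 0] in
  [/\ smooth phi, compact supp & supp `<=` Omega].

Definition locally_integrable3 (Omega : set (R3 R)) (f : R3 R -> R) : Prop :=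
  measurable_on Omega f /\
  forall K : set (R3 R), compact K -> K `<=` Omega ->
    (\int[leb3]_(x in K) `|f x|%:E < +oo)%E.

Definition weak_partial (Omega : set (R3 R)) (i : 'I_3) (f g : R3 R -> R) :
    Prop :=
  [/\ locally_integrable3 Omega f, locally_integrable3 Omega g &
      forall phi, test_function Omega phi ->
        Rintegral leb3 Omega (fun x => f x * 'D_(e3 i) phi x) =
        - Rintegral leb3 Omega (fun x => g x * phi x)].

Definition W1 (q : R) (Omega : set (R3 R)) (f : R3 R -> R) : Prop :=
  in_Lp q%:E Omega f /\
  forall i, exists2 g, weak_partial Omega i f g & in_Lp q%:E Omega g.

(* Closure of the test functions in W^{1,q}; the weak partial derivatives [g]
   are unique up to a.e. equality. *)
Definition W10 (q : R) (Omega : set (R3 R)) (f : R3 R -> R) : Prop :=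
  W1 q Omega f /\
  exists g : 'I_3 -> R3 R -> R, exists phi : nat -> R3 R -> R,
    [/\ forall i, weak_partial Omega i f (g i),
        forall k, test_function Omega (phi k),
        Lnorm_on q%:E Omega (phi k \- f) @[k --> \oo] --> 0%E &
        forall i, Lnorm_on q%:E Omega ('D_(e3 i) (phi k) \- g i)
          @[k --> \oo] --> 0%E].

Definition W10_vec (q : R) (Omega : set (R3 R)) (u : R3 R -> 'rV[R]_3) : Prop :=
  forall i, W10 q Omega (fun x => u x 0 i).

Definition weak_jacobian (Omega : set (R3 R)) (u : R3 R -> 'rV[R]_3)
    (Du : R3 R -> 'M[R]_3) : Prop :=
  forall i j, weak_partial Omega j (fun x => u x 0 i) (fun x => Du x i j).

(* The essential supremum is taken over the whole space after extension by 0;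
   this is the one over Omega, as the function is nonnegative and Omega is
   nonempty open. *)
Definition Linfty_norm (Omega : set (R3 R)) (u : R3 R -> 'rV[R]_3) : \bar R :=
  Lnorm_on +oo%E Omega (fun x => enorm (u x)).

Definition in_Linfty (Omega : set (R3 R)) (u : R3 R -> 'rV[R]_3) : Prop :=
  (forall i, measurable_on Omega (fun x => u x 0 i)) /\
  (Linfty_norm Omega u < +oo)%E.

Definition Lq_mxnorm (q : R) (Omega : set (R3 R)) (M : R3 R -> 'M[R]_3) :
    \bar R :=
  ((\int[leb3]_(x in Omega) (\sum_i enorm (row i (M x)) `^ q)%:E) `^ q^-1)%E.

Definition ae_on (Omega : set (R3 R)) (P : R3 R -> Prop) : Prop :=
  {ae leb3, forall x, Omega x -> P x}.

End Definitions.

(* Main.v *)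
Require Import Defs.
From HB Require Import structures.
From mathcomp Require Import all_boot all_order all_algebra.
From mathcomp Require Import all_classical all_reals all_analysis.
From mathcomp Require Import measurable_realfun.
From mathcomp Require Import ring lra.

Set Implicit Arguments.
Unset Strict Implicit.
Unset Printing Implicit Defensive.

Import Order.TTheory GRing.Theory Num.Theory.
Import numFieldNormedType.Exports.

Local Open Scope classical_set_scope.
Local Open Scope ring_scope.

(* Take the third component to be 0 and write f = u1 + i u2.  If grad u1 and grad u2 are orthogonal
   of equal norm r, i.e. (grad f)^2 = 0, then the rotation P with columns grad u2 / r,
   - grad u1 / r and their cross product makes Du P skew-symmetric.  Such f is obtained by convex
   integration: on the cells of a fine grid, where (grad f)^2 is almost constant, one adds to f
   small waves of high frequency in a direction orthogonal to both gradients, with complex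
   amplitude g satisfying g^2 = - (grad f)^2.  This multiplies (grad f)^2 by 1 - t^2 for a local
   amplitude t, and several shifts of grid and phase ensure a definite gain in L^1.  The
   iteration converges uniformly, and its gradients converge boundedly almost everywhere, to a
   function with (grad f)^2 = 0 a.e.  Starting from a bump times exp(i l x1) / l keeps the function
   small but its gradient large.  Finally, place such functions u_n with u_n = O(1/n) on disjoint
   cubes of Omega, so that one field P serves all n. *)

(** * Smooth functions *)

(** The waves must run in a direction orthogonal to two gradients, and this is where the third
    dimension enters. Take amplitudes [t g] and [t h] along such a unit vector [v]. The mixed terms
    vanish, [(grad f)^2] changes by [t^2 (g + i h)^2 = - t^2 (grad f)^2], and the energy
    [|grad u1|^2 + |grad u2|^2] grows by [t^2 |g + i h|^2], which is at most what the defect loses.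
    Up to errors, energy plus defect therefore never increases, which bounds all gradients
    uniformly. The energy never decreases, which keeps the limit away from zero. The squared
    increment of the gradients is at most the defect, so geometric decay of the defect in L^1 forces
    the gradients to converge.

    The obstacle is that [v], [g] and [h] cannot be chosen continuously in the point. They are
    frozen at one point of each cell and cut off at its walls, and near the walls nothing is gained;
    hence several shifted grids compete and an averaging argument selects one. *)

Section SmoothClass.
Context {R : realType}.

Definition dot (v x : R3 R) : R := v.1.1 * x.1.1 + v.1.2 * x.1.2 + v.2 * x.2.

(** Gives access to the one-variable chain rule for ridge functions. *)
Lemma is_derive_along_line (f : R3 R -> R) (x v : R3 R) (d : R) :
  is_derive (0 : R) 1 (fun h => f (h *: v + x)) d <-> is_derive x v f d.
Proof.
have E : (fun h : R => h^-1 *: (f ((h *: (1:R) + 0) *: v + x) - f (0 *: v + x)))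
   = (fun h => h^-1 *: ((f \o shift x) (h *: v) - f x)).
  apply/funext => h /=; rewrite addr0 scale0r add0r.
  by rewrite /GRing.scale /= mulr1.
split=> -[H1 H2]; split.
- exact/(derivable1P (V:=(R*R*R)%type)).
- by rewrite -H2 /derive /= E.
- exact/(derivable1P (V:=(R*R*R)%type)).
- by rewrite -H2 /derive /= E.
Qed.

(** The whole tower of derivatives is the witness, so it suffices to exhibit a family of functions
    that differentiation maps to itself. *)
Definition smooth1 (g : R -> R) : Prop :=
  exists G : nat -> R -> R, G 0%N = g /\ forall n x, is_derive (x : R) (1 : R) (G n) (G n.+1 x).

(* Closed under differentiation, hence contained in [smooth]; the ridge functions provide both
   the bumps and the waves. *)
Inductive sm : (R3 R -> R) -> Prop :=
| sm_cst c : sm (fun=> c)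
| sm_ridge g v c : smooth1 g -> sm (fun x => g (dot v x + c))
| sm_add f g : sm f -> sm g -> sm (fun x => f x + g x)
| sm_mul f g : sm f -> sm g -> sm (fun x => f x * g x).

Lemma dotZD (v x w : R3 R) h : dot v (h *: w + x) = h * dot v w + dot v x.
Proof. by rewrite /dot /= /GRing.scale /=; ring. Qed.

Lemma smooth1_der g : smooth1 g ->
  exists2 g', smooth1 g' & forall x, is_derive (x : R) (1:R) g (g' x).
Proof.
move=> [G [<- HG]]; exists (G 1%N) => //.
by exists (fun n => G n.+1).
Qed.

Lemma smooth1_continuous g : smooth1 g -> continuous g.
Proof.
move=> /smooth1_der[g' _ H] x; apply: differentiable_continuous.
by apply/derivable1_diffP; have [] := H x.
Qed.

Lemma is_derive_affine (k y h : R) : is_derive h (1 : R) (fun t : R => t * k + y) k.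
Proof.
have H : is_derive h (1 : R) ((@id R) * cst k + cst y) (h *: (0 : R) + k *: 1 + 0).
  exact: is_deriveD.
apply: (is_derive_eq H).
by rewrite scaler0 add0r addr0 /GRing.scale /= mulr1.
Qed.

Lemma continuous_fst3 : continuous (fun x : R3 R => x.1.1).
Proof. by move=> x; apply: cvg_comp; [exact: cvg_fst|exact: cvg_fst]. Qed.

Lemma continuous_snd3 : continuous (fun x : R3 R => x.1.2).
Proof. by move=> x; apply: cvg_comp; [exact: cvg_fst|exact: cvg_snd]. Qed.

Lemma continuous_thd3 : continuous (fun x : R3 R => x.2).
Proof. by move=> x; exact: cvg_snd. Qed.

Lemma continuous_dot (v : R3 R) : continuous (dot v).
Proof.
move=> x; apply: cvgD; first apply: cvgD; apply: cvgMr.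
- exact: continuous_fst3.
- exact: continuous_snd3.
- exact: continuous_thd3.
Qed.

Lemma sm_continuous f : sm f -> continuous f.
Proof.
elim=> [c|g v c gs|{}f g _ fc _ gc|{}f g _ fc _ gc] x.
- exact: cvg_cst.
- apply: (@cvg_comp _ _ _ (fun x => dot v x + c) g).
    by apply: cvgD; [exact: continuous_dot|exact: cvg_cst].
  exact: smooth1_continuous.
- by apply: cvgD; [exact: fc|exact: gc].
- by apply: cvgM; [exact: fc|exact: gc].
Qed.

Lemma sm_is_derive f : sm f -> forall v,
  exists2 df, sm df & forall x, is_derive x v f (df x).
Proof.
elim=> [c|g w c gs|{}f g sf fd sg gd|{}f g sf fd sg gd] v.
- by exists (fun=> 0); [exact: sm_cst|move=> x; exact: is_derive_cst].
- have [g' sg' gg'] := smooth1_der gs.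
  exists (fun x => g' (dot w x + c) * dot w v).
    by apply: sm_mul; [exact: sm_ridge|exact: sm_cst].
  move=> x; apply/is_derive_along_line.
  rewrite (_ : (fun h : R => _) = g \o (fun h => h * dot w v + (dot w x + c))); last first.
    by apply/funext => h; rewrite /comp dotZD -addrA.
  have H : is_derive (0 : R) (1 : R) (g \o (fun h => h * dot w v + (dot w x + c)))
      (g' (0 * dot w v + (dot w x + c)) * dot w v).
    have Ha := is_derive_affine (dot w v) (dot w x + c) 0.
    exact: (is_derive1_comp (gg' _)).
  by rewrite mul0r add0r in H.
- have [df sdf fdf] := fd v; have [dg sdg gdg] := gd v.
  exists (fun x => df x + dg x); first exact: sm_add.
  by move=> x; exact: is_deriveD.
- have [df sdf fdf] := fd v; have [dg sdg gdg] := gd v.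
  exists (fun x => f x * dg x + g x * df x).
    by apply: sm_add; apply: sm_mul.
  by move=> x; exact: is_deriveM.
Qed.

Lemma sm_derivable f x v : sm f -> derivable f x v.
Proof. by move=> /sm_is_derive/(_ v)[df _ /(_ x)[]]. Qed.

Lemma sm_derive f v : sm f -> sm ('D_v f).
Proof.
move=> /sm_is_derive/(_ v)[df sdf H].
rewrite (_ : 'D_v f = df) //; apply/funext => x.
by have [_ ->] := H x.
Qed.

Lemma sm_smooth f : sm f -> smooth f.
Proof.
move=> sf s; have sfs : sm (iter_partial s f).
  by elim: s => //= i s; exact: sm_derive.
by split=> [|i x]; [exact: sm_continuous|exact: sm_derivable].
Qed.

Lemma smooth_continuous (f : R3 R -> R) : smooth f -> continuous f.
Proof. by move=> /(_ [::])[]. Qed.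

Lemma smooth_derivable (f : R3 R -> R) i x : smooth f -> derivable f x (e3 i).
Proof. by move=> /(_ [::])[_]; exact. Qed.

Lemma smooth_derive (f : R3 R -> R) i : smooth f -> smooth ('D_(e3 i) f).
Proof.
move=> sf s; have := sf (rcons s i).
by rewrite /iter_partial foldr_rcons.
Qed.

Lemma sm_scale c f : sm f -> sm (fun x => c * f x).
Proof. by move=> sf; apply: sm_mul => //; exact: sm_cst. Qed.

Lemma sm_sum (I : Type) (s : seq I) (F : I -> R3 R -> R) :
  (forall i, sm (F i)) -> sm (fun x => \sum_(i <- s) F i x).
Proof.
move=> sF; elim: s => [|i s IH].
  by rewrite (_ : (fun _ => _) = fun=> 0) ; [exact: sm_cst|apply/funext => x; rewrite big_nil].
rewrite (_ : (fun _ => _) = fun x => F i x + \sum_(i <- s) F i x).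
  exact: sm_add.
by apply/funext => x; rewrite big_cons.
Qed.
End SmoothClass.

(** * Flat functions and sines of one variable *)

Section OneDim.
Context {R : realType}.
Implicit Types (P : {poly R}) (t s : R).

(** A single term of the exponential series is at most its sum. *)
Lemma expn_expRN_le n s : 0 <= s -> s ^+ n * expR (- s) <= n`!%:R.
Proof.
move=> s0; rewrite expRN ler_pdivrMr ?expR_gt0//.
case: n => [|n]; first by rewrite expr0 fact0 mul1r; apply: le_trans (expR_ge1Dx s); rewrite lerDl.
rewrite mulrC -ler_pdivrMr ?ltr0n ?fact_gt0//.
by apply: le_trans (expR_ge1Dxn n s0); rewrite lerDr.
Qed.

Lemma poly_expRN_bounded P : exists C, forall s, 0 <= s -> `|P.[s]| * expR (- s) <= C.
Proof.
exists (\sum_(i < size P) `|P`_i| * i`!%:R) => s s0.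
rewrite horner_coef; apply: (@le_trans _ _ ((\sum_(i < size P) `|P`_i * s ^+ i|) * expR (- s))).
  by rewrite ler_wpM2r ?expR_ge0// ler_norm_sum.
rewrite mulr_suml; apply: ler_sum => i _.
rewrite normrM -mulrA ler_wpM2l// normrX ger0_norm//.
exact: expn_expRN_le.
Qed.

(* Derivatives of [flat P] are again of this form, up to changing [P]. *)
Definition flat P t : R := if 0 < t then P.[t^-1] * expR (- t^-1) else 0.

(** In the variable [s = 1 / t] this says that [P(s) s^2 exp(- s)] is bounded. The quadratic bound
    is what makes the derivative at 0 vanish. *)
Lemma flat_bound2 P : exists C, forall t, `|flat P t| <= C * t ^+ 2.
Proof.
have [C HC] := poly_expRN_bounded (P * 'X^2).
have C0 : 0 <= C by apply: le_trans (HC 0 (lexx _)); rewrite mulr_ge0 ?expR_ge0.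
exists C => t; rewrite /flat; case: ifPn => [t0|_]; last first.
  by rewrite normr0 mulr_ge0 ?sqr_ge0.
have s0 : 0 < t^-1 by rewrite invr_gt0.
have := HC t^-1 (ltW s0).
rewrite hornerM hornerXn normrM (gtr0_norm (exprn_gt0 2 s0)).
rewrite normrM (gtr0_norm (expR_gt0 _)) exprVn.
by rewrite mulrAC ler_pdivrMr ?exprn_gt0.
Qed.

Lemma is_derive_0_quadratic (F : R -> R) C :
  (forall t, `|F t| <= C * t ^+ 2) -> is_derive (0 : R) (1 : R) F 0.
Proof.
move=> FC.
have F0 : F 0 = 0.
  by apply/eqP; rewrite -normr_le0; apply: le_trans (FC 0) _; rewrite expr0n mulr0.
have C0 : 0 <= C by have := le_trans (normr_ge0 _) (FC 1); rewrite expr1n mulr1.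
have H : (fun h : R => h^-1 *: ((F \o shift 0) (h *: (1 : R)) - F 0)) @ 0^' --> (0 : R).
  apply/cvgr0Pnorm_le => e e0.
  near=> h.
  rewrite /= addr0 F0 subr0 /GRing.scale /= mulr1 normrM normfV.
  have h0 : 0 < `|h| by rewrite normr_gt0; near: h; exact: nbhs_dnbhs_neq.
  rewrite ler_pdivrMl//; apply: le_trans (FC h) _.
  rewrite -real_normK ?num_real// expr2 mulrA mulrC ler_wpM2l ?normr_ge0//.
  have : `|h| <= e / (C + 1).
    by near: h; apply: dnbhs0_le; rewrite divr_gt0// ltr_wpDl.
  rewrite ler_pdivlMr ?ltr_wpDl// => hC; apply: le_trans hC.
  by rewrite mulrC ler_wpM2l// lerDl.
by apply: DeriveDef; [apply/cvg_ex; exists 0|apply/cvg_lim].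
Unshelve. all: by end_near. Qed.

(** For [s = 1 / t] one has [d/dt = - s^2 d/ds], and [P(s) exp(- s)] has [s]-derivative
    [(P' - P)(s) exp(- s)]; this is where the new polynomial comes from. *)
Lemma is_derive_flat P t :
  is_derive t (1 : R) (flat P) (flat ('X^2 * (P - P^`())) t).
Proof.
have [t0|t0|->] := ltgtP t 0.
- rewrite {2}/flat ltNge ltW//=.
  apply: (@near_eq_is_derive _ _ _ (cst 0)).
  near=> z; rewrite /flat ltNge ltW//.
  by near: z; exact: lt_nbhsl.
- have H : is_derive t (1 : R) ((horner P \o (fun z => z^-1)) * (expR \o (fun z => - z^-1)))
    (P.[t^-1] * (expR (- t^-1) * (t ^- 2)) + expR (- t^-1) * (P^`().[t^-1] * (- t ^- 2))).
    have Hi : is_derive t (1 : R) (fun z : R => z^-1) (- t ^- 2).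
      apply: is_derive_eq; first by apply: is_deriveV; rewrite gt_eqF.
      by rewrite /GRing.scale /= mulr1.
    have He : is_derive t (1 : R) (expR \o (fun z => - z^-1)) (expR (- t^-1) * t ^- 2).
      apply: is_derive1_comp.
      by apply: (is_derive_eq (is_deriveN Hi)); rewrite opprK.
    have Hp : is_derive t (1 : R) (horner P \o (fun z => z^-1)) (P^`().[t^-1] * - t ^- 2).
      exact: is_derive1_comp.
    exact: is_deriveM.
  rewrite {2}/flat t0; apply: (@near_eq_is_derive _ _ _ _ (flat P)); last first.
    apply: (is_derive_eq H).
    rewrite -!exprVn hornerM hornerXn hornerD hornerN; set a := P.[_]; set b := P^`().[_]; set e := expR _; set s := t^-1; ring.
  near=> z; rewrite /flat ifT//.
  by near: z; exact: lt_nbhsr.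
- rewrite {2}/flat ltxx.
  have [C HC] := flat_bound2 P; exact: is_derive_0_quadratic HC.
Unshelve. all: by end_near. Qed.

Lemma smooth1_flat P : smooth1 (flat P).
Proof.
exists (fun n => flat (iter n (fun Q => 'X^2 * (Q - Q^`())) P)); split=> // n x.
exact: is_derive_flat.
Qed.

Definition rho : R -> R := flat 1.

Lemma rhoE t : rho t = if 0 < t then expR (- t^-1) else 0.
Proof. by rewrite /rho /flat hornerC mul1r. Qed.

Lemma smooth1_rho : smooth1 rho. Proof. exact: smooth1_flat. Qed.

Lemma rho_le0 t : t <= 0 -> rho t = 0.
Proof. by rewrite rhoE leNgt => /negbTE ->. Qed.

Lemma rho_ge0 t : 0 <= rho t.
Proof. by rewrite rhoE; case: ifP => // _; exact: expR_ge0. Qed.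

Lemma rho_gt0 t : 0 < t -> 0 < rho t.
Proof. by rewrite rhoE => ->; exact: expR_gt0. Qed.

Lemma rho_le1 t : rho t <= 1.
Proof.
by rewrite rhoE; case: ifP => // t0; rewrite expR_le1 oppr_le0 invr_ge0 ltW.
Qed.

Lemma rho_le s t : s <= t -> rho s <= rho t.
Proof.
move=> st; have [s0|s0] := leP s 0; first by rewrite rho_le0// rho_ge0.
rewrite !rhoE s0 (lt_le_trans s0 st) ler_expR lerN2 lef_pV2// posrE//.
exact: lt_le_trans st.
Qed.

Lemma smooth1_sin (l c : R) : smooth1 (fun t => sin (l * t + c)).
Proof.
(* Each derivative brings out a factor [l] and advances the phase by a quarter period. *)
exists (fun n t => l ^+ n * (sin (l * t + (c + n%:R * (pi / 2))))); split.
  by apply/funext => t; rewrite expr0 mul1r mul0r addr0.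
move=> n x.
have Ha : is_derive x (1 : R) (fun z => z * l + (c + n%:R * (pi / 2))) l.
  exact: is_derive_affine.
have Hs : is_derive x (1 : R) (sin \o (fun z => z * l + (c + n%:R * (pi / 2))))
    (cos (x * l + (c + n%:R * (pi / 2))) * l) by exact: is_derive1_comp.
have := is_deriveZ (l ^+ n) Hs.
rewrite (_ : _ \*: _ = (fun t : R => l ^+ n * sin (l * t + (c + n%:R * (pi / 2))))); last first.
  by apply/funext => t /=; rewrite /GRing.scale /= (mulrC t).
move=> H; apply: (is_derive_eq H).
have -> : l * x + (c + n.+1%:R * (pi / 2)) = (x * l + (c + n%:R * (pi / 2))) + pi / 2 :> R.
  by rewrite -[n.+1%:R]natr1; ring.
rewrite /GRing.scale /= exprS sinDpihalf.
by ring.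
Qed.
End OneDim.

(** * Functions supported in a box *)

Section Box.
Context {R : realType}.
Implicit Types (f g : R3 R -> R) (x y a b : R3 R).

Definition box a b : set (R3 R) := (`[a.1.1, b.1.1] `*` `[a.1.2, b.1.2]) `*` `[a.2, b.2].

Lemma compact_box a b : compact (box a b).
Proof. by apply: compact_setX; [apply: compact_setX|]; exact: segment_compact. Qed.

Lemma hausdorff_R3 : hausdorff_space (R3 R).
Proof. exact: norm_hausdorff. Qed.

Lemma closed_box a b : closed (box a b).
Proof. by apply: compact_closed; [exact: hausdorff_R3|exact: compact_box]. Qed.

Definition supported_in (K : set (R3 R)) f := forall x, ~ K x -> f x = 0.

Lemma supported_derive (K : set (R3 R)) f v : closed K -> supported_in K f ->
  supported_in K ('D_v f).
Proof.
move=> cK fK x Kx.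
transitivity ('D_v (cst (0 : R)) x); last by rewrite derive_cst.
apply: near_eq_derive.
have : open (~` K) by exact: closed_openC.
rewrite openE => /(_ x Kx); apply: filterS => y Ky; exact: fK.
Qed.

(** The box is a parameter because it stays fixed along the whole iteration; limits are then
    supported in it too. *)
Definition testfun a b f := sm f /\ supported_in (box a b) f.

Lemma testfun_derive a b f v : testfun a b f -> testfun a b ('D_v f).
Proof.
by move=> [sf bf]; split; [exact: sm_derive|exact: supported_derive (@closed_box _ _) _].
Qed.

Lemma continuous_supported_bounded (K : set (R3 R)) f :
  compact K -> continuous f -> supported_in K f ->
  exists2 M, 0 <= M & forall x, `|f x| <= M.
Proof.
move=> cK cf fK.
have : compact (f @` K).
  by apply: continuous_compact => //; exact: continuous_subspaceT.
move=> /compact_bounded[M [_ HM]].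
exists (`|M| + 1) => [|x]; first by rewrite addr_ge0.
have [Kx|Kx] := pselect (K x); last by rewrite fK// normr0 addr_ge0.
have /= := HM (`|M| + 1).
rewrite (le_lt_trans (ler_norm _)) ?ltrDl// => /(_ isT); apply.
by exists x.
Qed.

Lemma testfun_bounded a b f : testfun a b f ->
  exists2 M, 0 <= M & forall x, `|f x| <= M.
Proof.
move=> [sf bf]; apply: continuous_supported_bounded bf; first exact: compact_box.
exact: sm_continuous.
Qed.

Lemma is_derive_line f (x v : R3 R) (h : R) : derivable f (h *: v + x) v ->
  is_derive h (1 : R) (fun t : R => f (t *: v + x)) ('D_v f (h *: v + x)).
Proof.
move=> fd.
have E : (fun k : R => k^-1 *: (((fun t : R => f (t *: v + x)) \o shift h) (k *: (1:R)) - f (h *: v + x)))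
   = (fun k => k^-1 *: ((f \o shift (h *: v + x)) (k *: v) - f (h *: v + x))).
  apply/funext => k /=; rewrite /shift /= addrA -scalerDl.
  by rewrite /GRing.scale /= mulr1.
by split; [rewrite /derivable E|rewrite /derive E].
Qed.

Lemma sm_lipschitz_line f (x v : R3 R) (h M : R) : sm f -> 
  (forall y, `|'D_v f y| <= M) -> `|f (h *: v + x) - f x| <= M * `|h|.
Proof.
move=> sf fM.
pose g := fun t : R => f (t *: v + x).
have gd t : is_derive t (1 : R) g ('D_v f (t *: v + x)).
  by apply: is_derive_line; exact: sm_derivable.
have gc : continuous g.
  move=> t; apply: differentiable_continuous.
  by apply/derivable1_diffP; have [] := gd t.
have -> : f x = g 0 by rewrite /g scale0r add0r.
rewrite -[f _]/(g h).
have [h0|h0] := leP 0 h.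
  have [c _ ->] := MVT_segment h0 (fun t _ => gd t) (continuous_subspaceT gc).
  by rewrite subr0 normrM ler_wpM2r.
have [c _ H] := MVT_segment (ltW h0) (fun t _ => gd t) (continuous_subspaceT gc).
by rewrite distrC H normrM sub0r normrN ler_wpM2r.
Qed.

Lemma testfun_unif_continuous a b f (e : R) : testfun a b f -> 0 < e ->
  exists2 d, 0 < d & forall x y, `|x.1.1 - y.1.1| <= d -> `|x.1.2 - y.1.2| <= d ->
    `|x.2 - y.2| <= d -> `|f x - f y| <= e.
Proof.
move=> tf e0.
have /choice[M HM] : forall i, exists M : R, 0 <= M /\ forall x, `|'D_(e3 i) f x| <= M.
  by move=> i; have [M M0 HM] := testfun_bounded (testfun_derive (e3 i) tf); exists M.
pose C := \sum_i M i + 1.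
have C0 : 0 < C by rewrite ltr_wpDl// sumr_ge0// => i _; have [] := HM i.
have MC i x : `|'D_(e3 i) f x| <= C.
  have [_ H] := HM i; apply: le_trans (H x) _.
  by rewrite /C (bigD1 i)//= -addrA lerDl addr_ge0// sumr_ge0// => j _; have [] := HM j.
exists (e / (3 * C)) => [|x y H1 H2 H3]; first by rewrite divr_gt0 ?mulr_gt0.
have sf : sm f by case: tf.
(* The point [x] is reached from [y] by three moves parallel to the axes, each controlled by the
   mean value theorem. *)
pose x1 : R3 R := (x.1.1 - y.1.1) *: e3 0 + y.
pose x2 : R3 R := (x.1.2 - y.1.2) *: e3 1 + x1.
have E : x = (x.2 - y.2) *: e3 (inord 2) + x2.
  rewrite /x2 /x1; case: x {H1 H2 H3 x1 x2} => [[p q] r]; case: y => [[p' q'] r'].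
  rewrite /e3 /= !inordK//= /GRing.scale /= /scale_pair /=.
  by congr (_, _, _); rewrite /= /GRing.scale /=; ring.
have -> : f x - f y = (f x - f x2) + (f x2 - f x1) + (f x1 - f y) by ring.
have K (h : R) : `|h| <= e / (3 * C) -> C * `|h| <= e / 3.
  move=> hh; apply: le_trans (ler_wpM2l (ltW C0) hh) _.
  suff -> : C * (e / (3 * C)) = e / 3 by [].
  by field; rewrite gt_eqF.
have L1 := sm_lipschitz_line x2 (x.2 - y.2) sf (MC (inord 2)).
rewrite -E in L1.
have L2 := sm_lipschitz_line x1 (x.1.2 - y.1.2) sf (MC 1).
have L3 := sm_lipschitz_line y (x.1.1 - y.1.1) sf (MC 0).
rewrite -/x1 -/x2 in L2 L3.
apply: le_trans (ler_normD _ _) _.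
have -> : e = e / 3 + e / 3 + e / 3 by field.
apply: lerD; last exact: le_trans L3 (K _ _).
apply: le_trans (ler_normD _ _) _; apply: lerD.
  exact: le_trans L1 (K _ _).
exact: le_trans L2 (K _ _).
Qed.

Lemma test_function_testfun (Omega : set (R3 R)) a b f :
  box a b `<=` Omega -> testfun a b f -> test_function Omega f.
Proof.
move=> BO [sf bf]; have sub : closure [set x | f x != 0] `<=` box a b.
  rewrite [X in _ `<=` X]((closure_id (box a b)).1 (@closed_box a b)).
  apply: closure_subset => x /= fx; apply: contrapT => Kx.
  by move: fx; rewrite bf// eqxx.
split; first exact: sm_smooth.
- apply: subclosed_compact sub; [exact: closed_closure|exact: compact_box].
- exact: subset_trans BO.
Qed.

End Box.

(** * Borel sets of the product space *)

Section Measurability.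
Context {R : realType}.

(** Links the topology to the product sigma-algebra: an open set is a countable union of boxes with
    rational corners. Boxes not inside [A] are replaced by the empty set, so that the union runs
    over a countable type. *)
Lemma open_measurable3 (A : set (R3 R)) : open A -> measurable (A : set (mR3 R)).
Proof.
move=> oA.
pose F (p : rat * rat * rat * (rat * rat * rat)) : set (R3 R) :=
  (`]ratr p.1.1.1, ratr p.2.1.1[ `*` `]ratr p.1.1.2, ratr p.2.1.2[) `*`
  `]ratr p.1.2, ratr p.2.2[.
pose G p := if `[< F p `<=` A >] then F p else set0.
have -> : A = \bigcup_p G p.
  apply/seteqP; split=> [x Ax|x [p _]]; last first.
    by rewrite /G; case: ifPn => // /asboolP FA /FA.
  have := oA; rewrite openE => /(_ x Ax) /nbhs_ballP[e /= e0 eA].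
  have inb (r : R) : exists q : rat * rat, [/\ r - e < ratr q.1, ratr q.1 < r,
     r < ratr q.2 & ratr q.2 < r + e].
    have /rat_in_itvoo[q1] : r - e < r by rewrite ltrBlDr ltrDl.
    rewrite in_itv /= => /andP[H1 H2].
    have /rat_in_itvoo[q2] : r < r + e by rewrite ltrDl.
    rewrite in_itv /= => /andP[H3 H4].
    by exists (q1, q2).
  have [p1 [A1 B1 C1 D1]] := inb x.1.1.
  have [p2 [A2 B2 C2 D2]] := inb x.1.2.
  have [p3 [A3 B3 C3 D3]] := inb x.2.
  exists (p1.1, p2.1, p3.1, (p1.2, p2.2, p3.2)) => //.
  rewrite /G ifT; first by rewrite /F /=; split; [split|] => /=; rewrite in_itv /= ?B1 ?B2 ?B3.
  apply/asboolP => y [[/= + +] +]; rewrite !in_itv /=.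
  move=> /andP[E1 F1] /andP[E2 F2] /andP[E3 F3].
  by apply: eA; split; [split|]; rewrite /= /ball /= ltr_norml; apply/andP; split; lra.
apply: countable_bigcupT_measurable => // p; rewrite /G; case: ifP => // _.
by apply: measurableX; [apply: measurableX|]; exact: measurable_itv.
Qed.

Lemma closed_measurable3 (A : set (R3 R)) : closed A -> measurable (A : set (mR3 R)).
Proof.
move=> cA; rewrite -(setCK A); apply: measurableC; apply: open_measurable3.
exact: closed_openC.
Qed.

Lemma measurable_box (a b : R3 R) : measurable (box a b : set (mR3 R)).
Proof. exact: closed_measurable3 (@closed_box _ a b). Qed.

Lemma continuous_measurable_fun3 (f : R3 R -> R) : continuous f ->
  measurable_fun setT (f : mR3 R -> R).
Proof.
move=> /continuousP cf.
apply: (measurability _ (RGenOpens.measurableE R)).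
move=> _ [_ [a [b ->] <-]]; rewrite setTI; apply: open_measurable3.
exact/cf/interval_open.
Qed.

Lemma leb3_boxE (a b : R3 R) : leb3 (box a b) = (lebesgue_measure `[a.1.1, b.1.1] *
  lebesgue_measure `[a.1.2, b.1.2] * lebesgue_measure `[a.2, b.2])%E.
Proof.
have m12 : measurable ((`[a.1.1, b.1.1] `*` `[a.1.2, b.1.2]) :
    set (measurableTypeR R * measurableTypeR R)).
  by apply: measurableX; exact: measurable_itv.
have m3 : measurable (`[a.2, b.2] : set (measurableTypeR R)) by exact: measurable_itv.
have := product_measure1E (lebesgue_measure \x lebesgue_measure)%E
  (@lebesgue_measure R) m12 m3.
have E2 := product_measure1E (@lebesgue_measure R) (@lebesgue_measure R)
  (measurable_itv `[a.1.1, b.1.1]) (measurable_itv `[a.1.2, b.1.2]).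
move=> E; etransitivity; [exact: E|congr (_ * _)%E; exact: E2].
Qed.

Lemma leb3_box_lty (a b : R3 R) : (leb3 (box a b) < +oo)%E.
Proof.
rewrite leb3_boxE; have H (r s : R) : exists2 l : R, 0 <= l & lebesgue_measure `[r, s] = l%:E.
  rewrite lebesgue_measure_itv/=; case: ifP => [rs|_]; last by exists 0.
  by exists (s - r); rewrite ?EFinB// subr_ge0; move: rs; rewrite lte_fin => /ltW.
have [l1 _ ->] := H a.1.1 b.1.1; have [l2 _ ->] := H a.1.2 b.1.2.
by have [l3 _ ->] := H a.2 b.2; rewrite -!EFinM ltry.
Qed.

End Measurability.

(** * Algebra of the conformality defect *)

Section VectorAlgebra.
Context {R : realType}.
Implicit Types (a b c d v : R3 R) (t g h M e : R).

Definition bnd M a := [/\ `|a.1.1| <= M, `|a.1.2| <= M & `|a.2| <= M].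

Lemma dotC a b : dot a b = dot b a.
Proof. by rewrite /dot; ring. Qed.

Lemma dot_ge0 a : 0 <= dot a a.
Proof. by rewrite /dot -!expr2 !addr_ge0// sqr_ge0. Qed.

Lemma normrM_le (x y A B : R) : `|x| <= A -> `|y| <= B -> `|x * y| <= A * B.
Proof. by move=> xA yB; rewrite normrM ler_pM. Qed.

Lemma dot_bnd A B a b : bnd A a -> bnd B b -> `|dot a b| <= 3 * (A * B).
Proof.
move=> [a1 a2 a3] [b1 b2 b3].
have := normrM_le a1 b1; have := normrM_le a2 b2; have := normrM_le a3 b3.
rewrite /dot; move: (a.1.1 * _) (a.1.2 * _) (a.2 * _) (A * B) => x y z C.
rewrite !ler_norml => /andP[? ?] /andP[? ?] /andP[? ?]; apply/andP; split; lra.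
Qed.

(* The quadratic form of the increment only sees [t g h], up to O(e): [v] is
   almost orthogonal to both gradients. *)
Lemma dot_perturb a b a' b' v t g h M e : 1 <= M -> 0 <= e <= 1 -> `|t| <= 1 ->
  bnd M a -> bnd M b -> bnd 1 v -> `|g| <= M -> `|h| <= M -> dot v v = 1 ->
  bnd e (a' - a - (t * g) *: v) -> bnd e (b' - b - (t * h) *: v) ->
  `|dot a v| <= e -> `|dot b v| <= e ->
  `|dot a' b' - dot a b - t ^+ 2 * (g * h)| <= 17 * M * e.
Proof.
move=> M1 /andP[e0 e1] t1 aM bM vM gM hM vv da db av bv.
pose d : R3 R := a' - a - (t * g) *: v; pose c : R3 R := b' - b - (t * h) *: v.
rewrite -/d in da; rewrite -/c in db.
have E : dot a' b' - dot a b - t ^+ 2 * (g * h) =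
   t * h * dot a v + dot a c + t * g * dot b v + t * g * dot v c +
   dot d b + t * h * dot d v + dot d c + t ^+ 2 * (g * h) * (dot v v - 1).
  by rewrite /d /c /dot /= /GRing.scale /=; ring.
rewrite {}E vv subrr mulr0 addr0.
have th : `|t * h| <= M by rewrite -[M]mul1r; exact: normrM_le.
have tg : `|t * g| <= M by rewrite -[M]mul1r; exact: normrM_le.
have H1 := normrM_le th av.
have H2 := dot_bnd aM db.
have H3 := normrM_le tg bv.
have H4 : `|t * g * dot v c| <= 3 * (M * e).
  have -> : 3 * (M * e) = M * (3 * (1 * e)) by ring.
  exact: normrM_le tg (dot_bnd vM db).
have H5 : `|dot d b| <= 3 * (M * e).
  by rewrite (mulrC M); exact: dot_bnd da bM.
have H6 : `|t * h * dot d v| <= 3 * (M * e).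
  have -> : 3 * (M * e) = M * (3 * (e * 1)) by ring.
  exact: normrM_le th (dot_bnd da vM).
have H7 := dot_bnd da db.
have ee : e * e <= M * e by rewrite ler_wpM2r//; apply: le_trans M1.
have H8 : 0 <= M * e by apply: mulr_ge0 => //; apply: le_trans M1.
rewrite -[17 * M * e]mulrA.
move: H1 H2 H3 H4 H5 H6 H7; rewrite !ler_norml.
move=> /andP[? ?] /andP[? ?] /andP[? ?] /andP[? ?] /andP[? ?] /andP[? ?] /andP[? ?].
apply/andP; split; lra.
Qed.

(* With [f = u1 + i u2], [a = grad u1] and [b = grad u2], the complex number
   [(grad f)^2] is [confX a b + i confY a b]; it vanishes iff [a] and [b] are orthogonal of
   equal norm. *)
Definition confX a b := dot a a - dot b b.
Definition confY a b := 2 * dot a b.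
Definition defect a b := `|confX a b| + `|confY a b|.
Definition energy a b := dot a a + dot b b.

Lemma defect_ge0 a b : 0 <= defect a b.
Proof. by rewrite addr_ge0. Qed.

Lemma perturb_estimates a b a' b' v t g h M e : 1 <= M -> 0 <= e <= 1 -> `|t| <= 1 ->
  bnd M a -> bnd M b -> bnd 1 v -> `|g| <= M -> `|h| <= M -> dot v v = 1 ->
  bnd e (a' - a - (t * g) *: v) -> bnd e (b' - b - (t * h) *: v) ->
  `|dot a v| <= e -> `|dot b v| <= e ->
  `|confX a b + (g ^+ 2 - h ^+ 2)| <= e -> `|confY a b + 2 * g * h| <= e ->
  g ^+ 2 + h ^+ 2 <= defect a b + e ->
  [/\ defect a' b' <= (1 - t ^+ 2) * defect a b + 100 * M * e,
      energy a' b' + defect a' b' <= energy a b + defect a b + 200 * M * e,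
      energy a b - 100 * M * e <= energy a' b' &
      energy (a' - a) (b' - b) <= defect a b + 100 * M * e].
Proof.
move=> M1 /andP[e0 e1] t1 aM bM vM gM hM vv da db av bv HX HY HW.
have e01 : 0 <= e <= 1 by rewrite e0 e1.
have H1 := dot_perturb M1 e01 t1 aM aM vM gM gM vv da da av av.
have H2 := dot_perturb M1 e01 t1 bM bM vM hM hM vv db db bv bv.
have H3 := dot_perturb M1 e01 t1 aM bM vM gM hM vv da db av bv.
(* The increments are perturbations of zero gradients by the same wave, so [dot_perturb] at zero
   also measures their energy. *)
have z0 : bnd M (0 : R3 R) by split; rewrite normr0; lra.
have z1 : `|dot 0 v| <= e by rewrite /dot !mul0r !addr0 normr0.
have da' : bnd e ((a' - a) - 0 - (t * g) *: v) by rewrite subr0.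
have db' : bnd e ((b' - b) - 0 - (t * h) *: v) by rewrite subr0.
have H4 := dot_perturb M1 e01 t1 z0 z0 vM gM gM vv da' da' z1 z1.
have H5 := dot_perturb M1 e01 t1 z0 z0 vM hM hM vv db' db' z1 z1.
have t2 : 0 <= t ^+ 2 <= 1.
  by rewrite sqr_ge0 -real_normK ?num_real// exprn_ile1.
have d00 : dot 0 0 = 0 :> R by rewrite /dot !mul0r !addr0.
rewrite d00 subr0 in H4 H5.
have Me0 : 0 <= M * e by rewrite mulr_ge0//; lra.
have eMe : e <= M * e by rewrite -{1}[e]mul1r ler_wpM2r.
have Hg : 0 <= g ^+ 2 + h ^+ 2 by rewrite addr_ge0 ?sqr_ge0.
have tW : t ^+ 2 * (g ^+ 2 + h ^+ 2) <= t ^+ 2 * defect a b + e.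
  case/andP: t2 => t20 t21.
  have : t ^+ 2 * (g ^+ 2 + h ^+ 2) <= t ^+ 2 * (defect a b + e) by rewrite ler_wpM2l.
  have : t ^+ 2 * e <= 1 * e by rewrite ler_wpM2r.
  by rewrite mulrDr; lra.
have tW' : t ^+ 2 * defect a b <= defect a b.
  by rewrite -[leRHS]mul1r ler_wpM2r ?defect_ge0//; case/andP: t2.
have HX' : `|t ^+ 2 * (confX a b + (g ^+ 2 - h ^+ 2))| <= 1 * e.
  by apply: normrM_le => //; rewrite ger0_norm ?sqr_ge0//; case/andP: t2.
have HY' : `|t ^+ 2 * (confY a b + 2 * g * h)| <= 1 * e.
  by apply: normrM_le => //; rewrite ger0_norm ?sqr_ge0//; case/andP: t2.
have D : defect a' b' <= (1 - t ^+ 2) * defect a b + 70 * (M * e).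
  have EX : confX a' b' = (1 - t ^+ 2) * confX a b + t ^+ 2 * (confX a b + (g ^+ 2 - h ^+ 2))
     + ((dot a' a' - dot a a - t ^+ 2 * (g * g)) - (dot b' b' - dot b b - t ^+ 2 * (h * h))).
    by rewrite /confX; ring.
  have EY : confY a' b' = (1 - t ^+ 2) * confY a b + t ^+ 2 * (confY a b + 2 * g * h)
     + 2 * (dot a' b' - dot a b - t ^+ 2 * (g * h)).
    by rewrite /confY; ring.
  rewrite /defect EX EY.
  have -> : (1 - t ^+ 2) * (`|confX a b| + `|confY a b|) =
    (1 - t ^+ 2) * `|confX a b| + (1 - t ^+ 2) * `|confY a b| by exact: mulrDr.
  have t1' : 0 <= 1 - t ^+ 2 by rewrite subr_ge0; case/andP: t2.
  have nM (s x : R) : 0 <= s -> s * `|x| = `|s * x|.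
    by move=> s0; rewrite normrM (ger0_norm s0).
  rewrite (nM _ (confX a b) t1') (nM _ (confY a b) t1').
  move: H1 H2 H3 HX' HY'; rewrite !mul1r -![17 * M * e]mulrA.
  set y1 := (1 - _) * confX a b; set y2 := (1 - _) * confY a b.
  set x1 := t ^+ 2 * (_ + (_ - _)); set x2 := t ^+ 2 * (_ + _).
  set u1 := (dot a' a' - _ - _); set u2 := (dot b' b' - _ - _).
  set u3 := (dot a' b' - _ - _).
  move: u1 u2 u3 y1 y2 x1 x2 => u1 u2 u3 y1 y2 x1 x2 K1 K2 K3 K4 K5.
  have L1 : `|y1 + x1 + (u1 - u2)| <= `|y1| + `|x1| + (`|u1| + `|u2|).
    apply: le_trans (ler_normD _ _) _; apply: lerD; first exact: ler_normD.
    exact: ler_normB.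
  have L2 : `|y2 + x2 + 2 * u3| <= `|y2| + `|x2| + 2 * `|u3|.
    apply: le_trans (ler_normD _ _) _; apply: lerD; first exact: ler_normD.
    by rewrite normrM ger0_norm.
  move: (M * e) K1 K2 K3 eMe Me0 => X K1 K2 K3 eMe Me0; lra.
move: H1 H2 H4 H5; rewrite !ler_norml -!mulrA /energy.
move=> /andP[? ?] /andP[? ?] /andP[? ?] /andP[? ?].
move: tW; rewrite mulrDr !expr2 => tW.
have ? : 0 <= t * t * (g * g) + t * t * (h * h).
  by rewrite -mulrDr mulr_ge0// -?expr2 ?sqr_ge0// addr_ge0// sqr_ge0.
move: D; rewrite expr2 mulrBl mul1r => D.
rewrite expr2 in tW'.
split; lra.
Qed.

Lemma orthogonal_unit a b : exists v, [/\ dot v v = 1, dot a v = 0 & dot b v = 0].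
Proof.
suff [v v0 [av bv]] : exists2 v, 0 < dot v v & dot a v = 0 /\ dot b v = 0.
  exists ((Num.sqrt (dot v v))^-1 *: v).
  have H c : dot c ((Num.sqrt (dot v v))^-1 *: v) = (Num.sqrt (dot v v))^-1 * dot c v.
    by rewrite /dot /= /GRing.scale /=; ring.
  split; rewrite ?H ?av ?bv ?mulr0// dotC H mulrA -expr2 exprVn sqr_sqrtr ?ltW//.
  by rewrite mulVf ?gt_eqF.
pose c : R3 R := (a.1.2 * b.2 - a.2 * b.1.2, a.2 * b.1.1 - a.1.1 * b.2,
  a.1.1 * b.1.2 - a.1.2 * b.1.1).
have [c0|c0] := ltP 0 (dot c c).
  by exists c => //; split; rewrite /dot /c /=; ring.
have sq (z : R) : 0 <= z * z by rewrite -expr2 sqr_ge0.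
have [c1 c2 c3] : [/\ c.1.1 = 0, c.1.2 = 0 & c.2 = 0].
  move: c0; rewrite /dot => c0.
  by split; apply/eqP; rewrite -sqrf_eq0 expr2 eq_le sq andbT;
     have := sq c.1.1; have := sq c.1.2; have := sq c.2; lra.
rewrite /c /= in c1 c2 c3.
(* Now the cross product is zero and the vectors are parallel, so anything orthogonal to a nonzero
   one of them will do. The candidates are the cross products of the first and second basis vectors
   with [a] and with [b]; if all four vanish, then [a = b = 0]. *)
have [a0|a0] := ltP 0 (dot ((0, - a.2, a.1.2) : R3 R) (0, - a.2, a.1.2)).
  exists (0, - a.2, a.1.2) => //; split; rewrite /dot /=; first by ring.
  by rewrite mulr0 add0r -[RHS]c1; ring.
have [a1|a1] := ltP 0 (dot ((a.2, 0, - a.1.1) : R3 R) (a.2, 0, - a.1.1)).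
  exists (a.2, 0, - a.1.1) => //; split; rewrite /dot /=; first by ring.
  by rewrite mulr0 addr0 -[RHS]c2; ring.
have [b0|b0] := ltP 0 (dot ((0, - b.2, b.1.2) : R3 R) (0, - b.2, b.1.2)).
  exists (0, - b.2, b.1.2) => //; split; rewrite /dot /=; last by ring.
  by rewrite mulr0 add0r -[RHS]oppr0 -[in RHS]c1; ring.
have [b1|b1] := ltP 0 (dot ((b.2, 0, - b.1.1) : R3 R) (b.2, 0, - b.1.1)).
  exists (b.2, 0, - b.1.1) => //; split; rewrite /dot /=; last by ring.
  by rewrite mulr0 addr0 -[RHS]oppr0 -[in RHS]c2; ring.
have sq0 (z : R) : z * z <= 0 -> z = 0.
  by move=> z0; apply/eqP; rewrite -sqrf_eq0 expr2 eq_le z0 sq.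
rewrite /dot /= in a0 a1 b0 b1.
have [[e1 e2 e3] [e4 e5 e6]] : [/\ a.1.1 = 0, a.1.2 = 0 & a.2 = 0] /\
    [/\ b.1.1 = 0, b.1.2 = 0 & b.2 = 0].
  have := sq a.1.1; have := sq a.1.2; have := sq a.2.
  have := sq b.1.1; have := sq b.1.2; have := sq b.2.
  by move=> *; split; split; apply: sq0; lra.
exists ((1, 0, 0) : R3 R); first by rewrite /dot /= !mulr0 !addr0 mulr1.
by split; rewrite /dot /= !mulr0 !addr0 mulr1.
Qed.

(** [g + i h] is a complex square root of [- (X + i Y)], given by the half-modulus formulas, with
    the sign of [h] adjusted to that of [Y]. Its squared modulus is [|X + i Y| <= |X| + |Y|]. *)
Lemma conformal_coefficients a b : exists gh : R * R,
  [/\ gh.1 ^+ 2 - gh.2 ^+ 2 = - confX a b, 2 * gh.1 * gh.2 = - confY a b &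
      gh.1 ^+ 2 + gh.2 ^+ 2 <= defect a b].
Proof.
rewrite /defect; move: (confX a b) (confY a b) => X Y.
set W := Num.sqrt (X ^+ 2 + Y ^+ 2).
have XW : `|X| <= W.
  by rewrite -sqrtr_sqr ler_sqrt ?addr_ge0 ?sqr_ge0// lerDl sqr_ge0.
have WXY : W <= `|X| + `|Y|.
  rewrite -[leRHS]ger0_norm ?addr_ge0// -sqrtr_sqr ler_sqrt ?sqr_ge0//.
  rewrite sqrrD !real_normK ?num_real// lerD2r lerDl mulrn_wge0// mulr_ge0//.
have W2 : W ^+ 2 = X ^+ 2 + Y ^+ 2 by rewrite sqr_sqrtr// addr_ge0 ?sqr_ge0.
have [A0 B0] : 0 <= (W - X) / 2 /\ 0 <= (W + X) / 2.
  by move: XW; rewrite ler_norml => /andP[? ?]; split; lra.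
pose g := Num.sqrt ((W - X) / 2); pose h := Num.sqrt ((W + X) / 2).
have gh : g * h = `|Y| / 2.
  rewrite -sqrtrM// -[RHS]ger0_norm ?divr_ge0// -sqrtr_sqr; congr Num.sqrt.
  rewrite exprMn real_normK ?num_real//.
  have -> : Y ^+ 2 = W ^+ 2 - X ^+ 2 by rewrite W2; ring.
  by field.
have [Y0|Y0] := leP 0 Y.
  exists (g, - h); rewrite /= sqrrN !sqr_sqrtr//; split; [by field| |by lra].
  by rewrite -mulrA mulrN gh ger0_norm//; field.
exists (g, h); rewrite /= !sqr_sqrtr//; split; [by field| |by lra].
by rewrite -mulrA gh ltr0_norm//; field.
Qed.

End VectorAlgebra.

(** * Perturbation by plane waves *)

Section Gradient.
Context {R : realType}.
Implicit Types (f g : R3 R -> R) (x y a b v p : R3 R).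

Definition grad f x : R3 R :=
  ('D_(e3 (inord 0)) f x, 'D_(e3 (inord 1)) f x, 'D_(e3 (inord 2)) f x).

Lemma dot_e3 v : [/\ dot v (e3 (inord 0)) = v.1.1, dot v (e3 (inord 1)) = v.1.2 &
  dot v (e3 (inord 2)) = v.2].
Proof. by split; rewrite /dot /e3 !inordK//= !mulr0 mulr1 ?addr0 ?add0r. Qed.

Lemma grad_supported K f x : closed K -> supported_in K f -> ~ K x -> grad f x = 0.
Proof. by move=> cK fK Kx; rewrite /grad !(supported_derive _ cK fK). Qed.

(** A zero of a nonnegative function is a minimum. For the cut-offs [eta] this shows that a wave
    dies together with its gradient, also on the walls of its cell. *)
Lemma nonneg_zero_derive f x v : (forall y, 0 <= f y) -> (forall y, derivable f y v) ->
  f x = 0 -> 'D_v f x = 0.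
Proof.
move=> f0 fd fx.
have H : is_derive (0 : R) (1 : R) (fun t => f (t *: v + x)) 0.
  apply: (@derive1_at_min R _ (- 1) 1).
  - by lra.
  - move=> t _; have [] // := @is_derive_line R f x v t (fd _).
  - by rewrite in_itv /=; apply/andP; split; lra.
  - by move=> t _; rewrite scale0r add0r fx.
by have [_ ->] := (is_derive_along_line f x v 0).1 H.
Qed.

Lemma is_derive_ridge (g : R -> R) w c v x dg : is_derive (dot w x + c) (1 : R) g dg ->
  is_derive x v (fun y => g (dot w y + c)) (dg * dot w v).
Proof.
move=> gd; apply/is_derive_along_line.
rewrite (_ : (fun h : R => _) = g \o (fun h => h * dot w v + (dot w x + c))); last first.
  by apply/funext => h; rewrite /comp dotZD -addrA.
have Ha := is_derive_affine (dot w v) (dot w x + c) 0.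
have gd' : is_derive (0 * dot w v + (dot w x + c)) (1 : R) g dg by rewrite mul0r add0r.
exact: is_derive1_comp.
Qed.

End Gradient.

(** * Cut-offs on shifted grids *)

Section Grid.
Context {R : realType}.
Implicit Types (x y p : R3 R).
Variables (o : R3 R) (N : R).
Hypothesis N_gt0 : 0 < N.

(* [rescale s m c] rescales the interval of length [1 / N] number [m] of the grid based at [c]
   to [0, 1]; the flag [s] shifts the grid by half a cell. *)
Definition rescale (s : bool) (m : nat) (c t : R) : R := N * (t - c) + s%:R / 2 - m%:R.

Definition bump s m c t : R := rho (rescale s m c t) * rho (1 - rescale s m c t).

Definition eta (s : bool * bool * bool) (m : nat * nat * nat) x : R :=
  bump s.1.1 m.1.1 o.1.1 x.1.1 * bump s.1.2 m.1.2 o.1.2 x.1.2 * bump s.2 m.2 o.2 x.2.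

Definition cell (s : bool * bool * bool) (m : nat * nat * nat) : set (R3 R) :=
  [set x | [/\ 0 <= rescale s.1.1 m.1.1 o.1.1 x.1.1 <= 1,
               0 <= rescale s.1.2 m.1.2 o.1.2 x.1.2 <= 1 &
               0 <= rescale s.2 m.2 o.2 x.2 <= 1]].

Lemma bump_ge0 s m c t : 0 <= bump s m c t.
Proof. by rewrite mulr_ge0// rho_ge0. Qed.

Lemma bump_le1 s m c t : bump s m c t <= 1.
Proof. by rewrite -[1]mul1r ler_pM ?rho_ge0// rho_le1. Qed.

Lemma bump_neq0 s m c t : bump s m c t != 0 -> 0 < rescale s m c t < 1.
Proof.
rewrite mulf_eq0 negb_or => /andP[H1 H2]; apply/andP; split.
  by rewrite ltNge; apply: contra_neqN H1 => ?; exact: rho_le0.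
by rewrite -subr_gt0 ltNge; apply: contra_neqN H2 => ?; exact: rho_le0.
Qed.

Lemma bump_neq0_inj s m n c t : bump s m c t != 0 -> bump s n c t != 0 -> m = n.
Proof.
move=> /bump_neq0 /andP[m1 m2] /bump_neq0 /andP[n1 n2]; rewrite /rescale in m1 m2 n1 n2.
apply/eqP; rewrite eqn_leq -ltnS -[X in _ && X]ltnS -!(ltr_nat R) -!natr1.
by apply/andP; split; lra.
Qed.

Lemma eta_ge0 s m x : 0 <= eta s m x.
Proof. by apply: mulr_ge0; [apply: mulr_ge0|]; exact: bump_ge0. Qed.

Lemma eta_le1 s m x : eta s m x <= 1.
Proof.
rewrite /eta -[1]mul1r; apply: ler_pM; [|exact: bump_ge0| |exact: bump_le1].
  by apply: mulr_ge0; exact: bump_ge0.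
rewrite -[1]mul1r; apply: ler_pM; [exact: bump_ge0|exact: bump_ge0|exact: bump_le1|exact: bump_le1].
Qed.

Lemma eta_cell s m x : eta s m x != 0 -> cell s m x.
Proof.
rewrite /eta mulf_eq0 negb_or => /andP[+ H3]; rewrite mulf_eq0 negb_or => /andP[H1 H2].
by split; [move: H1|move: H2|move: H3] => /bump_neq0/andP[h1 h2];
  apply/andP; split; exact: ltW.
Qed.

Lemma eta_neq0_inj s m n x : eta s m x != 0 -> eta s n x != 0 -> m = n.
Proof.
rewrite /eta mulf_eq0 negb_or => /andP[+ H3]; rewrite mulf_eq0 negb_or => /andP[H1 H2].
rewrite mulf_eq0 negb_or => /andP[+ K3]; rewrite mulf_eq0 negb_or => /andP[K1 K2].
case: m n H1 H2 H3 K1 K2 K3 => [[m1 m2] m3] [[n1 n2] n3] /=.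
by move=> /bump_neq0_inj H1 /bump_neq0_inj H2 /bump_neq0_inj H3 /H1 -> /H2 -> /H3 ->.
Qed.

Lemma sm_eta s m : sm (eta s m).
Proof.
have [E0 E1 E2] : [/\ forall x, x.1.1 = dot (1, 0, 0) x, forall x, x.1.2 = dot (0, 1, 0) x &
    forall x, x.2 = dot (0, 0, 1) x].
  by split=> x; rewrite /dot /= !mul0r mul1r ?addr0 ?add0r.
have H (s0 : bool) (m0 : nat) (c : R) (v : R3 R) (F : R3 R -> R) : (forall x, F x = dot v x) ->
    sm (fun x => bump s0 m0 c (F x)).
  move=> FE.
  rewrite (_ : (fun x => _) = fun x =>
      rho (dot (N *: v) x + (s0%:R / 2 - m0%:R - N * c)) *
      rho (dot (- N *: v) x + (1 - (s0%:R / 2 - m0%:R - N * c)))).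
    by apply: sm_mul; apply: sm_ridge; exact: smooth1_rho.
  apply/funext => x; rewrite /bump /rescale FE; congr (rho _ * rho _);
    by rewrite /dot /= /GRing.scale /=; ring.
by apply: sm_mul; [apply: sm_mul|]; apply: H.
Qed.

Lemma eta_testfun s m : exists lo hi, testfun lo hi (eta s m).
Proof.
pose l (s0 : bool) (m0 : nat) (c k : R) := c + (m0%:R - s0%:R / 2 + k) / N.
exists (l s.1.1 m.1.1 o.1.1 0, l s.1.2 m.1.2 o.1.2 0, l s.2 m.2 o.2 0).
exists (l s.1.1 m.1.1 o.1.1 1, l s.1.2 m.1.2 o.1.2 1, l s.2 m.2 o.2 1).
split; first exact: sm_eta.
move=> x; apply: contra_notP => /eqP /eta_cell[H1 H2 H3].
have K s0 m0 c t : 0 <= rescale s0 m0 c t <= 1 -> l s0 m0 c 0 <= t <= l s0 m0 c 1.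
  rewrite /rescale /l => /andP[h1 h2]; apply/andP; split.
    by rewrite -lerBrDl ler_pdivrMr//; lra.
  by rewrite -lerBlDl ler_pdivlMr//; lra.
by split; [split|]; rewrite /= in_itv /=; apply: K.
Qed.

Lemma cell_dist s m x p : cell s m x -> cell s m p ->
  [/\ `|x.1.1 - p.1.1| <= N^-1, `|x.1.2 - p.1.2| <= N^-1 & `|x.2 - p.2| <= N^-1].
Proof.
have K s0 m0 c t r : 0 <= rescale s0 m0 c t <= 1 -> 0 <= rescale s0 m0 c r <= 1 -> `|t - r| <= N^-1.
  rewrite /rescale => /andP[? ?] /andP[? ?].
  rewrite -(ler_pM2l N_gt0) mulfV ?gt_eqF// -{1}(gtr0_norm N_gt0) -normrM ler_norml.
  by apply/andP; split; lra.
move=> [x1 x2 x3] [p1 p2 p3]; split; [exact: K x1 p1|exact: K x2 p2|exact: K x3 p3].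
Qed.

(** A point in the middle half of its cell uses the unshifted grid; otherwise the half-cell shift
    moves it into the middle half of a shifted cell, numbered [k] or [k.+1]. There both factors of
    the bump are at least [rho 4^-1]. The bound on [m] later limits the number of cells. *)
Lemma bump_large (c t : R) : c <= t -> exists s m,
  [/\ m%:R <= N * (t - c) + 1 & rho 4^-1 ^+ 2 <= bump s m c t].
Proof.
move=> ct; have y0 : 0 <= N * (t - c) by apply: mulr_ge0; [exact: ltW|rewrite subr_ge0].
have H (s : bool) (m : nat) : 4^-1 <= rescale s m c t <= 3 / 4 -> rho 4^-1 ^+ 2 <= bump s m c t.
  move=> /andP[h1 h2]; rewrite expr2; apply: ler_pM; rewrite ?rho_ge0// rho_le//; lra.
have /andP[k1 k2] := truncn_itv y0.
set k := Num.truncn _ in k1 k2; rewrite -natr1 in k2.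
have [r1|r1] := ltP (N * (t - c) - k%:R) 4^-1.
  exists true, k; split; first lra.
  by apply: H; rewrite /rescale /=; apply/andP; split; lra.
have [r2|r2] := leP (N * (t - c) - k%:R) (3 / 4).
  exists false, k; split; first lra.
  by apply: H; rewrite /rescale /=; apply/andP; split; lra.
exists true, k.+1; rewrite -natr1; split; first lra.
by apply: H; rewrite /rescale -[k.+1%:R]natr1 /=; apply/andP; split; lra.
Qed.

Lemma eta_large x : o.1.1 <= x.1.1 -> o.1.2 <= x.1.2 -> o.2 <= x.2 -> exists s m,
  [/\ m.1.1%:R <= N * (x.1.1 - o.1.1) + 1, m.1.2%:R <= N * (x.1.2 - o.1.2) + 1,
      m.2%:R <= N * (x.2 - o.2) + 1 & rho 4^-1 ^+ 6 <= eta s m x].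
Proof.
move=> /bump_large[s1 [m1 [H1 K1]]] /bump_large[s2 [m2 [H2 K2]]] /bump_large[s3 [m3 [H3 K3]]].
exists (s1, s2, s3), (m1, m2, m3); split=> //.
have q0 : 0 <= (rho (4^-1 : R)) ^+ 2 by rewrite sqr_ge0.
rewrite (_ : _ ^+ 6 = rho 4^-1 ^+ 2 * rho 4^-1 ^+ 2 * rho 4^-1 ^+ 2); last by ring.
by apply: ler_pM => //; [rewrite mulr_ge0|exact: ler_pM].
Qed.

End Grid.

Section Perturbation.
Context {R : realType}.
Implicit Types (f : R3 R -> R) (x y p v : R3 R).

Lemma derive_sum_sm (I : Type) (r : seq I) (F : I -> R3 R -> R) v x :
  (forall i, sm (F i)) ->
  'D_v (fun y => \sum_(i <- r) F i y) x = \sum_(i <- r) 'D_v (F i) x.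
Proof.
move=> sF; elim: r => [|i r IH].
  rewrite big_nil (_ : (fun _ => _) = cst 0) ?derive_cst//.
  by apply/funext => y; rewrite big_nil.
rewrite big_cons -IH -deriveD; [|exact: sm_derivable|apply: sm_derivable; exact: sm_sum].
by congr ('D_v _ x); apply/funext => y; rewrite big_cons.
Qed.

Variables (o : R3 R) (N l : R) (K : nat).
Hypotheses (N_gt0 : 0 < N) (l_gt0 : 0 < l).
Let I := ('I_K * 'I_K * 'I_K)%type.
Variables (s : bool * bool * bool) (c : R) (g : I -> R) (w : I -> R3 R).

Definition pos (m : I) : nat * nat * nat := (m.1.1 : nat, m.1.2 : nat, m.2 : nat).

Lemma pos_inj : injective pos.
Proof.
by move=> [[m1 m2] m3] [[n1 n2] n3] [] /val_inj -> /val_inj -> /val_inj ->.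
Qed.

(** After division by the frequency the wave is of size O(1 / l), while the leading part of its
    gradient, [g m * eta * cos] times [w m], keeps its size. *)
Definition wave (m : I) x : R := g m / l * (eta o N s (pos m) x * sin (l * dot (w m) x + c)).

Definition waves x : R := \sum_m wave m x.

(** The local amplitude [t] of [perturb_estimates]. It does not involve [g], so the two components,
    which share cut-offs, directions and phase, have the same [t]. *)
Definition amplitude x : R := \sum_m eta o N s (pos m) x * cos (l * dot (w m) x + c).

Let smphase m : sm (fun x => sin (l * dot (w m) x + c)).
Proof.
rewrite (_ : (fun x => _) = fun x => sin (l * (dot (w m) x + 0) + c)).
  by apply: (@sm_ridge _ (fun t => sin (l * t + c))); exact: smooth1_sin.
by apply/funext => x; rewrite addr0.
Qed.

Lemma sm_wave m : sm (wave m).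
Proof.
apply: sm_mul; first exact: sm_cst.
by apply: sm_mul; [exact: sm_eta|exact: smphase].
Qed.

Lemma sm_waves : sm waves.
Proof. by apply: sm_sum => m; exact: sm_wave. Qed.

Lemma wave_derive m v x : 'D_v (wave m) x =
  g m * (eta o N s (pos m) x * cos (l * dot (w m) x + c)) * dot (w m) v +
  g m / l * ('D_v (eta o N s (pos m)) x * sin (l * dot (w m) x + c)).
Proof.
have He : is_derive x v (eta o N s (pos m)) ('D_v (eta o N s (pos m)) x).
  by apply: derivableP; apply: sm_derivable; exact: sm_eta.
have Hs : is_derive x v (fun y => sin (l * dot (w m) y + c))
    (cos (l * dot (w m) x + c) * l * dot (w m) v).
  rewrite (_ : (fun y => _) = fun y => (fun t => sin (l * t + c)) (dot (w m) y + 0)); last first.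
    by apply/funext => y; rewrite addr0.
  apply: (@is_derive_ridge _ (fun t => sin (l * t + c))); rewrite addr0.
  rewrite (_ : (fun t => _) = sin \o (fun t : R => t * l + c)); last first.
    by apply/funext => t; rewrite /= (mulrC t).
  have Ha := is_derive_affine l c (dot (w m) x).
  have Hc := is_derive_sin (dot (w m) x * l + c).
  rewrite (mulrC l).
  exact: is_derive1_comp.
have H := is_deriveZ (g m / l) (is_deriveM He Hs).
have [_ ->] : is_derive x v (wave m) _ := H.
rewrite /GRing.scale /= /GRing.scale /=.
set D := 'D_v _ x; move: (eta _ _ _ _ _) (cos _) (sin _) (dot _ v) => e C S d.
by field; rewrite gt_eqF.
Qed.

Lemma wave_eta0 m v x : eta o N s (pos m) x = 0 -> wave m x = 0 /\ 'D_v (wave m) x = 0.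
Proof.
move=> e0; rewrite wave_derive /wave e0 (nonneg_zero_derive _ _ e0).
- by rewrite !(mul0r, mulr0) addr0.
- exact: eta_ge0.
- by move=> y; apply: sm_derivable; exact: sm_eta.
Qed.

Let waves_derive v x : 'D_v waves x = \sum_m 'D_v (wave m) x.
Proof. by rewrite /waves derive_sum_sm//; exact: sm_wave. Qed.

(** Cut-offs of one shift are nonzero on disjoint sets, so where one is active all other waves
    vanish together with their derivatives. *)
Lemma waves_at m x : eta o N s (pos m) x != 0 ->
  [/\ amplitude x = eta o N s (pos m) x * cos (l * dot (w m) x + c),
     waves x = wave m x & forall v, 'D_v waves x = 'D_v (wave m) x].
Proof.
move=> em; have others n : n != m -> eta o N s (pos n) x = 0.
  move=> nm; apply/eqP; apply: contraNT nm => en.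
  by apply/eqP/pos_inj; exact: eta_neq0_inj en em.
split=> [||v].
- rewrite /amplitude (bigD1 m)//= big1 ?addr0// => n /others ->.
  by rewrite mul0r.
- by rewrite /waves (bigD1 m)//= big1 ?addr0// => n /others /(wave_eta0 0)[].
- by rewrite waves_derive (bigD1 m)//= big1 ?addr0// => n /others /(wave_eta0 v)[].
Qed.

Lemma waves_off x : (forall m, eta o N s (pos m) x = 0) ->
  [/\ amplitude x = 0, waves x = 0 & forall v, 'D_v waves x = 0].
Proof.
move=> all0; split=> [||v].
- by rewrite /amplitude big1// => m _; rewrite all0 mul0r.
- by rewrite /waves big1// => m _; have [] := wave_eta0 0 (all0 m).
- by rewrite waves_derive big1// => m _; have [] := wave_eta0 v (all0 m).
Qed.

Lemma eta_on_off x : (exists m : I, eta o N s (pos m) x != 0) \/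
  forall m : I, eta o N s (pos m) x = 0.
Proof.
have [?|no] := pselect (exists m : I, eta o N s (pos m) x != 0); [by left|right=> m].
by apply/eqP/negP => /negP em; apply: no; exists m.
Qed.

Lemma wave_le G m x : `|g m| <= G -> `|wave m x| <= G / l.
Proof.
move=> gG; have G0 : 0 <= G := le_trans (normr_ge0 _) gG.
have H1 : `|g m / l| <= G / l.
  by rewrite normrM normfV (gtr0_norm l_gt0) ler_wpM2r// invr_ge0 ltW.
rewrite -[G / l]mulr1; apply: normrM_le => //.
rewrite -[1]mulr1; apply: normrM_le.
  by rewrite ger0_norm ?eta_ge0// eta_le1.
by rewrite ler_norml sin_geN1 sin_le1.
Qed.

Lemma waves_le G x : 0 <= G -> (forall m, `|g m| <= G) -> `|waves x| <= G / l.
Proof.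
move=> G0 gG; have [[m /waves_at[_ -> _]]|/waves_off[_ -> _]] := eta_on_off x.
  exact: wave_le.
by rewrite normr0 divr_ge0// ltW.
Qed.

Lemma amplitude_le1 x : `|amplitude x| <= 1.
Proof.
have [[m /waves_at[-> _ _]]|/waves_off[-> _ _]] := eta_on_off x; last by rewrite normr0.
rewrite -[1]mulr1; apply: normrM_le.
  by rewrite ger0_norm ?eta_ge0// eta_le1.
by rewrite ler_norml cos_geN1 cos_le1.
Qed.

End Perturbation.

(** * One step of convex integration *)

Section Step.
Context {R : realType}.
Implicit Types (f u : R3 R -> R) (x y a b p v : R3 R).

Lemma grad_bnd lo hi f : testfun lo hi f ->
  exists2 M : R, 0 <= M & forall x, bnd M (grad f x).
Proof.
move=> tf.
have [M0 p0 H0] := testfun_bounded (testfun_derive (e3 (inord 0)) tf).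
have [M1 p1 H1] := testfun_bounded (testfun_derive (e3 (inord 1)) tf).
have [M2 p2 H2] := testfun_bounded (testfun_derive (e3 (inord 2)) tf).
exists (M0 + M1 + M2) => [|x]; first by rewrite !addr_ge0.
split; [apply: le_trans (H0 x) _|apply: le_trans (H1 x) _|apply: le_trans (H2 x) _]; lra.
Qed.

Lemma grad_unif_continuous lo hi f (e : R) : testfun lo hi f -> 0 < e ->
  exists2 d : R, 0 < d & forall x y, `|x.1.1 - y.1.1| <= d -> `|x.1.2 - y.1.2| <= d ->
    `|x.2 - y.2| <= d -> bnd e (grad f x - grad f y).
Proof.
move=> tf e0.
have [d0 p0 H0] := testfun_unif_continuous (testfun_derive (e3 (inord 0)) tf) e0.
have [d1 p1 H1] := testfun_unif_continuous (testfun_derive (e3 (inord 1)) tf) e0.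
have [d2 p2 H2] := testfun_unif_continuous (testfun_derive (e3 (inord 2)) tf) e0.
exists (Num.min d0 (Num.min d1 d2)) => [|x y]; first by rewrite !lt_min p0 p1.
rewrite !le_min => /and3P[? ? ?] /and3P[? ? ?] /and3P[? ? ?].
by split; [exact: H0|exact: H1|exact: H2].
Qed.

Lemma bnd_le (m M : R) a : m <= M -> bnd m a -> bnd M a.
Proof. by move=> mM [? ? ?]; split; exact: le_trans mM. Qed.

Lemma defect_le m a b : bnd m a -> bnd m b -> defect a b <= (4 * m) ^+ 2.
Proof.
move=> am bm; have H1 := dot_bnd am am; have H2 := dot_bnd bm bm; have H3 := dot_bnd am bm.
rewrite /defect /confX /confY normrM (ger0_norm (ler0n R 2)).
have H4 := ler_normB (dot a a) (dot b b).
have m2 : 0 <= m * m by rewrite -expr2 sqr_ge0.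
by rewrite exprMn !expr2; lra.
Qed.

Lemma coef_le m a b (g h : R) : 0 <= m -> bnd m a -> bnd m b ->
  g ^+ 2 + h ^+ 2 <= defect a b -> `|g| <= 4 * m /\ `|h| <= 4 * m.
Proof.
move=> m0 am bm gh; have D := defect_le am bm.
have m4 : 0 <= 4 * m by rewrite mulr_ge0.
have := sqr_ge0 g; have := sqr_ge0 h => h0 g0.
split; rewrite -[leRHS]ger0_norm// -ler_sqr ?nnegrE//; rewrite !real_normK ?num_real//; lra.
Qed.

Lemma dot_lipschitz m d a b p v : bnd m b -> bnd m p -> bnd d (a - p) -> bnd d (b - v) ->
  `|dot a b - dot p v| <= 6 * (d * m).
Proof.
move=> bm pm ap bv.
have -> : dot a b - dot p v = dot (a - p) b + dot p (b - v) by rewrite /dot /=; ring.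
apply: le_trans (ler_normD _ _) _.
have H1 := dot_bnd ap bm; have H2 := dot_bnd pm bv.
by rewrite (mulrC m) in H2; lra.
Qed.

Lemma conf_lipschitz m d a b p v : bnd m a -> bnd m b -> bnd m p -> bnd m v ->
  bnd d (a - p) -> bnd d (b - v) ->
  [/\ `|confX a b - confX p v| <= 12 * (d * m), `|confY a b - confY p v| <= 12 * (d * m) &
      defect p v <= defect a b + 24 * (d * m)].
Proof.
move=> am bm pm vm ap bv.
have H1 := dot_lipschitz am pm ap ap; have H2 := dot_lipschitz bm vm bv bv.
have H3 := dot_lipschitz bm pm ap bv.
have X : `|confX a b - confX p v| <= 12 * (d * m).
  have -> : confX a b - confX p v = (dot a a - dot p p) - (dot b b - dot v v).
    by rewrite /confX; ring.
  by apply: le_trans (ler_normB _ _) _; lra.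
have Y : `|confY a b - confY p v| <= 12 * (d * m).
  have -> : confY a b - confY p v = 2 * (dot a b - dot p v) by rewrite /confY; ring.
  by rewrite normrM (ger0_norm (ler0n R 2)); lra.
split=> //; rewrite /defect.
have := lerB_dist (confX p v) (confX a b); have := lerB_dist (confY p v) (confY a b).
by rewrite (distrC (confX p v)) (distrC (confY p v)); lra.
Qed.

Lemma sqr_sum_le0 (g h : R) : g ^+ 2 + h ^+ 2 <= 0 -> g = 0 /\ h = 0.
Proof.
have := sqr_ge0 g; have := sqr_ge0 h => ? ? ?.
by split; apply/eqP; rewrite -sqrf_eq0 eq_le; apply/andP; split=> //; lra.
Qed.

Lemma unit_bnd v : dot v v = 1 -> bnd 1 v.
Proof.
rewrite /dot => vv; have := sqr_ge0 v.1.1; have := sqr_ge0 v.1.2; have := sqr_ge0 v.2.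
rewrite !expr2 => ? ? ?.
by split; rewrite -[leRHS]normr1 -ler_sqr ?nnegrE// !real_normK ?num_real// !expr2; lra.
Qed.

(** The data are chosen point by point and may jump; only their values at sample points will enter
    the waves, which are smooth nonetheless. *)
Lemma perturbation_data u1 u2 : exists V : R3 R -> R3 R, exists G H : R3 R -> R, forall p,
  [/\ dot (V p) (V p) = 1, dot (grad u1 p) (V p) = 0 /\ dot (grad u2 p) (V p) = 0,
      G p ^+ 2 - H p ^+ 2 = - confX (grad u1 p) (grad u2 p),
      2 * G p * H p = - confY (grad u1 p) (grad u2 p) &
      G p ^+ 2 + H p ^+ 2 <= defect (grad u1 p) (grad u2 p)].
Proof.
have [V HV] := choice (fun p => orthogonal_unit (grad u1 p) (grad u2 p)).
have [C HC] := choice (fun p => conformal_coefficients (grad u1 p) (grad u2 p)).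
exists V, (fun p => (C p).1), (fun p => (C p).2) => p.
by have [? ? ?] := HV p; have [? ? ?] := HC p.
Qed.

(* The sample point of a cell that sticks out of the box lies outside the box, where the
   gradients vanish; such a cell receives no perturbation. *)
Lemma sample_points (o lo hi : R3 R) (N : R) : 0 < N ->
  exists P : (bool * bool * bool) -> (nat * nat * nat) -> R3 R, forall s m,
  cell o N s m (P s m) /\ (box lo hi (P s m) -> cell o N s m `<=` box lo hi).
Proof.
move=> N0.
have H (q : (bool * bool * bool) * (nat * nat * nat)) : exists p, cell o N q.1 q.2 p /\
    (box lo hi p -> cell o N q.1 q.2 `<=` box lo hi).
  have [sub|] := pselect (cell o N q.1 q.2 `<=` box lo hi); last first.
    move=> /existsNP[p /not_implyP[cp bp]]; exists p; split=> // /bp [].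
  pose z (s : bool) (m : nat) (c : R) := c + (m%:R - s%:R / 2 + 2^-1) / N.
  have Hz s m c : rescale N s m c (z s m c) = 2^-1.
    by rewrite /rescale /z; field; rewrite gt_eqF.
  exists (z q.1.1.1 q.2.1.1 o.1.1, z q.1.1.2 q.2.1.2 o.1.2, z q.1.2 q.2.2 o.2); split=> //.
  by rewrite /cell /= !Hz; split; apply/andP; split; lra.
have [P HP] := choice H.
by exists (fun s m => P (s, m)) => s m; exact: HP (s, m).
Qed.

Lemma grad_add f u x : sm f -> sm u -> grad (fun y => f y + u y) x = grad f x + grad u x.
Proof.
move=> sf su; have E v : 'D_v (fun y => f y + u y) x = 'D_v f x + 'D_v u x.
  by rewrite -deriveD//; exact: sm_derivable.
by rewrite /grad !E.
Qed.

(** One constant for all cells of a fixed grid; the frequency is chosen after the grid and has to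
    beat it. *)
Lemma etas_grad_bnd (o : R3 R) (N : R) (K : nat) : 0 < N ->
  exists2 C : R, 0 <= C & forall s (m : 'I_K * 'I_K * 'I_K) x, bnd C (grad (eta o N s (pos m)) x).
Proof.
move=> N0.
have H (q : (bool * bool * bool) * ('I_K * 'I_K * 'I_K)) : exists C, 0 <= C /\
    forall x, bnd C (grad (eta o N q.1 (pos q.2)) x).
  have [l [h tf]] := eta_testfun o N0 q.1 (pos q.2).
  by have [C C0 HC] := grad_bnd tf; exists C.
have [C HC] := choice H.
exists (\sum_q C q) => [|s m x]; first by apply: sumr_ge0 => q _; have [] := HC q.
have [C0 HCx] := HC (s, m); apply: bnd_le (HCx x).
rewrite (bigD1 (s, m))//= lerDl; apply: sumr_ge0 => q _; by have [] := HC q.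
Qed.

(** The square of the lower bound for [eta] in [eta_large]. *)
Definition gain : R := rho 4^-1 ^+ 12.

(* The 16 candidates come from the 8 half-cell shifts of the grid and two phases of the wave:
   no point of the box is close to the boundary of its cell in all shifts, nor is the cosine
   small for both phases, so that the amplitudes [t j x] cannot all be small. *)
Lemma perturbation_step lo hi u1 u2 (e : R) : testfun lo hi u1 -> testfun lo hi u2 -> 0 < e ->
  exists w1 w2 t : bool * bool * bool * bool -> R3 R -> R,
  [/\ forall j, testfun lo hi (w1 j) /\ testfun lo hi (w2 j),
      forall j x, `|w1 j x - u1 x| <= e /\ `|w2 j x - u2 x| <= e,
      forall j x, let a := grad u1 x in let b := grad u2 x in
        let a' := grad (w1 j) x in let b' := grad (w2 j) x in
        [/\ defect a' b' <= (1 - t j x ^+ 2) * defect a b + e,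
          energy a' b' + defect a' b' <= energy a b + defect a b + e,
          energy a b - e <= energy a' b' &
          energy (a' - a) (b' - b) <= defect a b + e],
      forall j x, `|t j x| <= 1 &
      forall x, box lo hi x -> gain <= \sum_j t j x ^+ 2].
Proof.
move=> t1 t2 e_gt0.
have [sm1 sup1] := t1; have [sm2 sup2] := t2.
have [m1 m10 Hm1] := grad_bnd t1; have [m2 m20 Hm2] := grad_bnd t2.
pose m : R := m1 + m2; have m0 : 0 <= m by rewrite addr_ge0.
have am x : bnd m (grad u1 x) by apply: bnd_le (Hm1 x); rewrite lerDl.
have bm x : bnd m (grad u2 x) by apply: bnd_le (Hm2 x); rewrite lerDr.
(* [4 * m] bounds the coefficients, by [coef_le]; the 1 provides the [1 <= M] of
   [perturb_estimates]. *)
pose M : R := 4 * m + 1; have M1 : 1 <= M by rewrite lerDr mulr_ge0.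
have mM : m <= M by rewrite /M; lra.
have M0 : 0 < M by rewrite (lt_le_trans _ M1).
(* Tolerance for each single error; [perturb_estimates] magnifies it by at most [200 * M]. *)
pose k : R := Num.min 1 (e / (200 * M)).
have k0 : 0 < k by rewrite lt_min ltr01 divr_gt0// mulr_gt0.
have k1 : k <= 1 by rewrite ge_min lexx.
have ke : 200 * M * k <= e by rewrite mulrC -ler_pdivlMr ?mulr_gt0// ge_min lexx orbT.
have ke' : 100 * M * k <= e.
  by move: (mulr_ge0 (ltW M0) (ltW k0)) ke; clear; lra.
(* Allowed oscillation of the gradients within a cell, with the constant 24 of [conf_lipschitz]. *)
pose d : R := k / (24 * M); have d0 : 0 < d by rewrite divr_gt0// mulr_gt0.
have dk : 24 * (d * M) = k by rewrite /d; field; rewrite gt_eqF.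
have dM : d <= d * M by rewrite -{1}[d]mulr1 ler_wpM2l// ltW.
have d3 : 3 * d <= k by move: dM (ltW d0) dk; clear; lra.
have dm24 : 24 * (d * m) <= k by rewrite -dk ler_wpM2l// ler_wpM2l// ltW.
have dm12 : 12 * (d * m) <= k.
  by move: (mulr_ge0 (ltW d0) m0) dm24; clear; lra.
have [r1 r10 Hr1] := grad_unif_continuous t1 d0.
have [r2 r20 Hr2] := grad_unif_continuous t2 d0.
pose N : R := Num.max r1^-1 r2^-1.
have N0 : 0 < N by rewrite lt_max invr_gt0 r10.
have Nr1 : N^-1 <= r1 by rewrite -[leRHS]invrK lef_pV2 ?posrE ?invr_gt0// le_max lexx.
have Nr2 : N^-1 <= r2 by rewrite -[leRHS]invrK lef_pV2 ?posrE ?invr_gt0// le_max lexx orbT.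
pose D : R := `|hi.1.1 - lo.1.1| + `|hi.1.2 - lo.1.2| + `|hi.2 - lo.2|.
(* Enough cells along each axis to cover the box; the 1 under the truncation is that of
   [bump_large]. *)
pose K := (Num.truncn (N * D + 1)).+1.
have KP (n : nat) : n%:R <= N * D + 1 -> (n < K)%N.
  move=> nD; rewrite ltnNge; apply/negP => Kn.
  have := truncnS_gt (N * D + 1); rewrite -/K ltNge => /negP; apply.
  by apply: le_trans nD; rewrite ler_nat.
have [C C0 HC] := etas_grad_bnd lo K N0.
(* This frequency makes both the wave, at most [M / l], and the part of its gradient that falls on
   the cut-off, at most [M / l * C], smaller than [k]. *)
pose l : R := (M * C + M) / k + 1.
have MC0 : 0 <= M * C + M by rewrite addr_ge0 ?mulr_ge0// ltW.
have l0 : 0 < l by rewrite ltr_wpDl// divr_ge0// ltW.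
have kl : M * C + M <= k * l.
  have -> : k * l = M * C + M + k by rewrite /l; field; rewrite gt_eqF.
  by rewrite lerDl ltW.
have Ml : M / l <= k.
  by rewrite ler_pdivrMr//; apply: le_trans kl; rewrite lerDr mulr_ge0// ltW.
have MCl : M / l * C <= k.
  by rewrite mulrAC ler_pdivrMr//; apply: le_trans kl; rewrite lerDl ltW.
have [V [G [H HGH]]] := perturbation_data u1 u2.
have [P HP] := sample_points lo lo hi N0.
have GM p : `|G p| <= M /\ `|H p| <= M.
  have [_ _ _ _ gh] := HGH p; have [? ?] := coef_le m0 (am p) (bm p) gh.
  by split; apply: le_trans (_ : 4 * m <= M) => //; rewrite lerDl.
(* Phases a quarter period apart, so that the squared cosines add up to 1. *)
pose th (j : bool * bool * bool * bool) : R := j.2%:R * (pi / 2).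
pose g1 (j : bool * bool * bool * bool) (n : 'I_K * 'I_K * 'I_K) := G (P j.1 (pos n)).
pose g2 (j : bool * bool * bool * bool) (n : 'I_K * 'I_K * 'I_K) := H (P j.1 (pos n)).
pose vv (j : bool * bool * bool * bool) (n : 'I_K * 'I_K * 'I_K) := V (P j.1 (pos n)).
pose q1 j := waves lo N l j.1 (th j) (g1 j) (vv j).
pose q2 j := waves lo N l j.1 (th j) (g2 j) (vv j).
have sq1 j : sm (q1 j) by exact: sm_waves.
have sq2 j : sm (q2 j) by exact: sm_waves.
exists (fun j x => u1 x + q1 j x), (fun j x => u2 x + q2 j x),
  (fun j => amplitude lo N l j.1 (th j) (vv j)).
have zero_out j n x : ~ box lo hi x -> eta lo N j.1 (pos n) x != 0 -> g1 j n = 0 /\ g2 j n = 0.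
  move=> bx /eta_cell cx; have [cp sub] := HP j.1 (pos n).
  have bp : ~ box lo hi (P j.1 (pos n)) by move=> /sub /(_ _ cx).
  have [_ _ _ _] := HGH (P j.1 (pos n)).
  rewrite !(grad_supported (@closed_box _ _ _) _ bp)//.
  have -> : defect 0 0 = 0 :> R.
    by rewrite /defect /confX /confY /dot /= !mul0r !addr0 subr0 mulr0 normr0 addr0.
  exact: sqr_sum_le0.
split.
- move=> j; split; split.
  + by apply: sm_add.
  + move=> x bx; rewrite sup1// add0r /q1.
    have [[n en]|off] := eta_on_off lo N K j.1 x; last by have [] := waves_off l0 (th j) (g1 j) (vv j) off.
    have [_ -> _] := waves_at l0 (th j) (g1 j) (vv j) en.
    by rewrite /wave (zero_out _ _ _ bx en).1 !mul0r.
  + by apply: sm_add.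
  + move=> x bx; rewrite sup2// add0r /q2.
    have [[n en]|off] := eta_on_off lo N K j.1 x; last by have [] := waves_off l0 (th j) (g2 j) (vv j) off.
    have [_ -> _] := waves_at l0 (th j) (g2 j) (vv j) en.
    by rewrite /wave (zero_out _ _ _ bx en).2 !mul0r.
- have kk : k <= e.
    by apply: le_trans ke; rewrite -{1}[k]mul1r ler_wpM2r ?(ltW k0)//; move: M1; clear; lra.
  move=> j x; rewrite !(addrC _ (q1 j x)) !(addrC _ (q2 j x)) !addrK.
  split; apply: le_trans kk; apply: le_trans Ml; apply: waves_le => //; try exact: ltW;
    by move=> n; have [] := GM (P j.1 (pos n)).
- move=> j x a b a' b'.
  have Ea' : a' = a + grad (q1 j) x by exact: grad_add.
  have Eb' : b' = b + grad (q2 j) x by exact: grad_add.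
  set t := amplitude _ _ _ _ _ _ _.
  have k01 : 0 <= k <= 1 by rewrite ltW.
  suff [v [g [h [[vv1 gM hM] [da db] [av bv] [HX HY HW]]]]] : exists v g h,
    [/\ [/\ dot v v = 1, `|g| <= M & `|h| <= M],
     bnd k (a' - a - (t * g) *: v) /\ bnd k (b' - b - (t * h) *: v),
     `|dot a v| <= k /\ `|dot b v| <= k &
     [/\ `|confX a b + (g ^+ 2 - h ^+ 2)| <= k, `|confY a b + 2 * g * h| <= k &
      g ^+ 2 + h ^+ 2 <= defect a b + k]].
    have := perturb_estimates M1 k01 (amplitude_le1 lo N l0 j.1 (th j) (g1 j) (vv j) x)
      (bnd_le mM (am x)) (bnd_le mM (bm x)) (unit_bnd vv1) gM hM vv1 da db av bv HX HY HW.
    rewrite -/t => -[E1 E2 E3 E4]; split.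
    + by apply: le_trans E1 _; rewrite lerD2l.
    + by apply: le_trans E2 _; rewrite lerD2l.
    + by apply: le_trans E3; rewrite lerD2l lerN2.
    + by apply: le_trans E4 _; rewrite lerD2l.
  (* Where no wave is active nothing changes and [t = 0], so the exact data at [x] itself meet the
     requirements. *)
  have [[n en]|off] := eta_on_off lo N K j.1 x; last first.
    have [t0 _ D1] := waves_off l0 (th j) (g1 j) (vv j) off.
    have [_ _ D2] := waves_off l0 (th j) (g2 j) (vv j) off.
    have [vx1 [avx bvx] Xx Yx Wx] := HGH x; have [Gx Hx] := GM x.
    have z : bnd k (0 : R3 R) by split; rewrite normr0 ltW.
    exists (V x), (G x), (H x); rewrite /t t0 !mul0r !scale0r !subr0 Ea' Eb'.
    have -> : grad (q1 j) x = 0 by rewrite /grad !D1.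
    have -> : grad (q2 j) x = 0 by rewrite /grad !D2.
    rewrite !addr0 !subrr avx bvx normr0 Xx Yx subrr subrr normr0 (ltW k0).
    by split=> //; split=> //; apply: le_trans Wx _; rewrite lerDl ltW.
  (* The active wave uses the data of [p]. The gradients at [x] and [p] differ by at most [d], so
     what is exact at [p] holds at [x] up to [k]. *)
  pose p := P j.1 (pos n).
  have [tE _ D1] := waves_at l0 (th j) (g1 j) (vv j) en.
  have [_ _ D2] := waves_at l0 (th j) (g2 j) (vv j) en.
  have [vp1 [avp bvp] Xp Yp Wp] := HGH p; have [Gp Hp] := GM p.
  have [cp _] := HP j.1 (pos n).
  have [c1 c2 c3] := cell_dist N0 (eta_cell en) cp.
  have ap : bnd d (a - grad u1 p) by apply: Hr1; apply: le_trans Nr1.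
  have bp : bnd d (b - grad u2 p) by apply: Hr2; apply: le_trans Nr2.
  have [HX HY HW] := conf_lipschitz (am x) (bm x) (am p) (bm p) ap bp.
  rewrite -/a -/b in HX HY HW.
  have vpb := unit_bnd vp1.
  have orth (y z : R3 R) : dot z (V p) = 0 -> bnd d (y - z) -> `|dot y (V p)| <= k.
    move=> zV yz; have -> : dot y (V p) = dot (y - z) (V p).
      have -> : dot (y - z) (V p) = dot y (V p) - dot z (V p) by rewrite /dot /=; ring.
      by rewrite zV subr0.
    by apply: le_trans (dot_bnd yz vpb) _; rewrite mulr1.
  have wave_bnd (gg : R) (f : R3 R -> R) (y : R3 R) : `|gg| <= M ->
      (forall v, 'D_v f x = gg * t * dot (V p) v +
         gg / l * ('D_v (eta lo N j.1 (pos n)) x * sin (l * dot (V p) x + th j))) ->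
      bnd k (y + grad f x - y - (t * gg) *: V p).
    move=> ggM fD; have [e1 e2 e3'] := HC j.1 n x.
    have [f1 f2 f3] := dot_e3 (V p).
    have small (z : R) : `|z| <= C ->
        `|gg / l * (z * sin (l * dot (V p) x + th j))| <= k.
      move=> zC; apply: le_trans MCl; apply: normrM_le.
        by rewrite normrM normfV (gtr0_norm l0) ler_wpM2r// invr_ge0 ltW.
      rewrite -[C]mulr1; apply: normrM_le => //.
      by rewrite ler_norml sin_geN1 sin_le1.
    have S1 := small _ e1; have S2 := small _ e2; have S3 := small _ e3'.
    rewrite /grad !fD f1 f2 f3; split; rewrite /= /GRing.scale /=.
    - by apply: le_trans S1; rewrite le_eqVlt; apply/orP; left; apply/eqP; congr `|_|; rewrite /grad /=; ring.
    - by apply: le_trans S2; rewrite le_eqVlt; apply/orP; left; apply/eqP; congr `|_|; rewrite /grad /=; ring.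
    - by apply: le_trans S3; rewrite le_eqVlt; apply/orP; left; apply/eqP; congr `|_|; rewrite /grad /=; ring.
  exists (V p), (G p), (H p); split=> //.
  + split; rewrite ?Ea' ?Eb'; apply: wave_bnd => // v.
    * by rewrite D1 wave_derive// /t tE.
    * by rewrite D2 wave_derive// /t tE.
  + by split; [exact: orth ap|exact: orth bp].
  + split; [rewrite Xp|rewrite Yp|].
    * exact: le_trans HX _.
    * exact: le_trans HY _.
    * by apply: le_trans Wp _; apply: le_trans HW _; rewrite lerD2l.
- by move=> j x; exact: amplitude_le1 (g1 j) _ _.
- move=> x bx; have [[/= + +] +] := bx; rewrite !in_itv /=.
  move=> /andP[l1 h1] /andP[l2 h2] /andP[l3 h3].
  have [s [m' [M1' M2' M3' He]]] := eta_large N0 l1 l2 l3.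
  have ND (r r' r'' : R) : r <= r' -> r' <= r'' -> `|r'' - r| <= D -> N * (r' - r) + 1 <= N * D + 1.
    move=> rr rr' rD; rewrite lerD2r ler_wpM2l ?(ltW N0)//; apply: le_trans rD.
    by apply: le_trans (ler_norm _); rewrite lerD2r.
  have K1 : (m'.1.1 < K)%N.
    by apply: KP; apply: le_trans M1' (ND _ _ _ l1 h1 _); rewrite /D -addrA lerDl addr_ge0.
  have K2 : (m'.1.2 < K)%N.
    by apply: KP; apply: le_trans M2' (ND _ _ _ l2 h2 _); rewrite /D -addrA addrCA lerDl addr_ge0.
  have K3 : (m'.2 < K)%N.
    by apply: KP; apply: le_trans M3' (ND _ _ _ l3 h3 _); rewrite /D lerDr addr_ge0.
  pose n : 'I_K * 'I_K * 'I_K := (Ordinal K1, Ordinal K2, Ordinal K3).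
  have pn : pos n = m' by rewrite /pos /= -!surjective_pairing.
  have eg : 0 < eta lo N s m' x by apply: lt_le_trans He; rewrite exprn_gt0// rho_gt0.
  have en : eta lo N s (pos n) x != 0 by rewrite pn gt_eqF.
  have st : (s, true) != (s, false) by rewrite xpair_eqE andbF.
  (* The two phases of the shift that is good at [x] already contribute
     [eta^2 (cos^2 + sin^2) = eta^2], at least [gain]. *)
  rewrite (bigD1 (s, false))// (bigD1 (s, true) st)/= addrA.
  rewrite -[gain]addr0; apply: lerD; last first.
    by apply: sumr_ge0 => j _; rewrite sqr_ge0.
  have [-> _ _] := waves_at l0 (th (s, false)) (g1 (s, false)) (vv (s, false)) en.
  have [-> _ _] := waves_at l0 (th (s, true)) (g1 (s, true)) (vv (s, true)) en.
  rewrite /th /= mul0r addr0 mul1r cosDpihalf /vv /=.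
  rewrite -pn in He; move: (eta lo N s (pos n) x) He => E He.
  rewrite mulrN sqrrN !exprMn -mulrDr cos2Dsin2 mulr1.
  have -> : gain = (rho 4^-1 ^+ 6) ^+ 2 by rewrite -exprM.
  by apply: lerXn2r => //; rewrite nnegrE ?exprn_ge0 ?rho_ge0//; apply: le_trans He; rewrite exprn_ge0 ?rho_ge0.
Qed.
End Step.

(** * Iteration and limit *)

Section BoxIntegral.
Context {R : realType}.
Implicit Types (F G u : R3 R -> R) (lo hi : R3 R).

Definition bint lo hi F : R := Rintegral (@leb3 R) (box lo hi) F.
Definition vol lo hi : R := fine (@leb3 R (box lo hi)).

Lemma integrable_bounded lo hi F (M : R) : measurable_fun setT (F : mR3 R -> R) ->
  (forall x, `|F x| <= M) -> leb3.-integrable (box lo hi) (EFin \o F).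
Proof.
move=> mF FM; apply: measurable_bounded_integrable.
- exact: measurable_box.
- exact: leb3_box_lty.
- exact: measurable_funS mF.
- exists M; split; first exact: num_real.
  by move=> x Mx y _; apply: le_trans (FM y) (ltW Mx).
Qed.

Lemma integrable_continuous lo hi F : continuous F ->
  leb3.-integrable (box lo hi) (EFin \o F).
Proof.
move=> cF; apply: measurable_bounded_integrable.
- exact: measurable_box.
- exact: leb3_box_lty.
- by apply: measurable_funS (continuous_measurable_fun3 cF).
- have : compact (F @` box lo hi).
    by apply: continuous_compact; [exact: continuous_subspaceT|exact: compact_box].
  move=> /compact_bounded[M [Mr HM]]; exists M; split=> // x Mx y By.
  by apply: HM Mx _ _; exists y.
Qed.

Lemma bint_le lo hi F G : continuous F -> continuous G ->
  (forall x, box lo hi x -> F x <= G x) -> bint lo hi F <= bint lo hi G.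
Proof.
move=> cF cG FG; apply: le_Rintegral => //; first exact: measurable_box.
- exact: integrable_continuous.
- exact: integrable_continuous.
Qed.

Lemma bintD lo hi F G : continuous F -> continuous G ->
  bint lo hi (fun x => F x + G x) = bint lo hi F + bint lo hi G.
Proof.
by move=> cF cG; apply: RintegralD;
  [exact: measurable_box|exact: integrable_continuous|exact: integrable_continuous].
Qed.

Lemma bintZ lo hi (c : R) F : continuous F ->
  bint lo hi (fun x => c * F x) = c * bint lo hi F.
Proof.
by move=> cF; apply: RintegralZl; [exact: measurable_box|exact: integrable_continuous].
Qed.

Lemma bint_cst lo hi (c : R) : bint lo hi (fun=> c) = c * vol lo hi.
Proof. by apply: Rintegral_cst; exact: measurable_box. Qed.

Lemma bint_ge0 lo hi F : (forall x, 0 <= F x) -> 0 <= bint lo hi F.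
Proof. by move=> F0; apply: Rintegral_ge0 => x _; exact: F0. Qed.

Lemma vol_ge0 lo hi : 0 <= vol lo hi.
Proof. exact: fine_ge0. Qed.

Lemma continuous_sum3 (I : Type) (r : seq I) (F : I -> R3 R -> R) :
  (forall i, continuous (F i)) -> continuous (fun x => \sum_(i <- r) F i x).
Proof.
move=> cF; elim: r => [|i r IH] x.
  rewrite (_ : (fun _ => _) = cst 0); first exact: cvg_cst.
  by apply/funext => y; rewrite big_nil.
rewrite (_ : (fun _ => _) = fun y => F i y + \sum_(i <- r) F i y).
  by apply: cvgD; [exact: cF|exact: IH].
by apply/funext => y; rewrite big_cons.
Qed.

Lemma bint_sum lo hi (I : Type) (r : seq I) (F : I -> R3 R -> R) :
  (forall i, continuous (F i)) ->
  bint lo hi (fun x => \sum_(i <- r) F i x) = \sum_(i <- r) bint lo hi (F i).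
Proof.
move=> cF; elim: r => [|i r IH].
  rewrite big_nil -[RHS](mul0r (vol lo hi)) -bint_cst; congr bint.
  by apply/funext => x; rewrite big_nil.
rewrite big_cons -IH -bintD//; last first.
  exact: continuous_sum3.
by congr bint; apply/funext => x; rewrite big_cons.
Qed.

Lemma continuous_dot_grad u w : sm u -> sm w ->
  continuous (fun x => dot (grad u x) (grad w x)).
Proof.
move=> su sw x; have c (f : R3 R -> R) v : sm f -> {for x, continuous ('D_v f)}.
  by move=> sf; apply: sm_continuous; exact: sm_derive.
by rewrite /dot /=; apply: cvgD; [apply: cvgD|]; apply: cvgM; exact: c.
Qed.

Lemma continuous_defect u w : sm u -> sm w ->
  continuous (fun x => defect (grad u x) (grad w x)).
Proof.
move=> su sw x; rewrite /defect /confX /confY.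
apply: cvgD; apply: cvg_norm.
  by apply: cvgB; exact: continuous_dot_grad.
by apply: cvgM; [exact: cvg_cst|exact: continuous_dot_grad].
Qed.

Lemma gain_gt0 : 0 < gain :> R.
Proof. by rewrite exprn_gt0// rho_gt0. Qed.

Lemma gain_le1 : gain <= 1 :> R.
Proof. by rewrite exprn_ile1 ?rho_ge0 ?rho_le1. Qed.

(* The best of the 16 candidates. *)
Lemma perturbation_step_integrated lo hi u1 u2 (e : R) : testfun lo hi u1 -> testfun lo hi u2 -> 0 < e ->
  exists w1 w2,
  [/\ testfun lo hi w1 /\ testfun lo hi w2,
      forall x, `|w1 x - u1 x| <= e /\ `|w2 x - u2 x| <= e,
      forall x, let a := grad u1 x in let b := grad u2 x in
        let a' := grad w1 x in let b' := grad w2 x in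
        [/\ energy a' b' + defect a' b' <= energy a b + defect a b + e,
          energy a b - e <= energy a' b' &
          energy (a' - a) (b' - b) <= defect a b + e] &
      bint lo hi (fun x => defect (grad w1 x) (grad w2 x)) <=
        (1 - gain / 16) * bint lo hi (fun x => defect (grad u1 x) (grad u2 x)) + e].
Proof.
move=> t1 t2 e0.
have v0 := vol_ge0 lo hi.
(* The pointwise error then integrates to less than [e]; the 1 gives [k <= e] and covers boxes of
   volume zero. *)
pose k : R := e / (vol lo hi + 1).
have k0 : 0 < k by rewrite divr_gt0// ltr_wpDl.
have ke : k <= e by rewrite ler_pdivrMr ?ltr_wpDl// ler_peMr ?(ltW e0)// lerDr.
have kv : k * vol lo hi < e.
  by rewrite mulrAC ltr_pdivrMr ?ltr_wpDl// ltr_pM2l// ltrDl.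
have [w1 [w2 [t [Ht Hs He t_le Hg]]]] := perturbation_step t1 t2 k0.
pose W j := bint lo hi (fun x => defect (grad (w1 j) x) (grad (w2 j) x)).
pose W0 := bint lo hi (fun x => defect (grad u1 x) (grad u2 x)).
suff [j Hj] : exists j, W j <= (1 - gain / 16) * W0 + e.
  exists (w1 j), (w2 j); split=> // x.
    by have [? ?] := Hs j x; split; exact: le_trans ke.
  have [_ E2 E3 E4] := He j x; split.
  - by apply: le_trans E2 _; rewrite lerD2l.
  - by apply: le_trans E3; rewrite lerD2l lerN2.
  - by apply: le_trans E4 _; rewrite lerD2l.
(* If all 16 candidates failed, the sum of their defects would be at least 16 times the bound
   claimed for one. But summing the pointwise factors [1 - t^2] bounds it by [(16 - gain) W0] plus
   less than [16 e]. *)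
apply: contrapT => /forallNP Hn.
have Hlt j : (1 - gain / 16) * W0 + e <= W j.
  by have /negP := Hn j; rewrite -ltNge => /ltW.
have cW j : continuous (fun x => defect (grad (w1 j) x) (grad (w2 j) x)).
  by have [[? _] [? _]] := Ht j; exact: continuous_defect.
have cW0 : continuous (fun x => defect (grad u1 x) (grad u2 x)).
  by apply: continuous_defect; [case: t1|case: t2].
have S : \sum_j W j <= (16 - gain) * W0 + 16 * k * vol lo hi.
  rewrite /W -bint_sum// -bintZ// -bint_cst -bintD; last 2 first.
  - by move=> x; apply: cvgM; [exact: cvg_cst|exact: cW0].
  - by move=> x; exact: cvg_cst.
  apply: bint_le.
  - exact: (@continuous_sum3 _ _ (fun j x => defect (grad (w1 j) x) (grad (w2 j) x))).
  - move=> x; apply: cvgD; last exact: cvg_cst.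
    by apply: cvgM; [exact: cvg_cst|exact: cW0].
  move=> x bx; have D0 := defect_ge0 (grad u1 x) (grad u2 x).
  set D := defect _ _ in D0 *.
  have : \sum_j defect (grad (w1 j) x) (grad (w2 j) x) <=
      \sum_(j : bool * bool * bool * bool) (D + k - t j x ^+ 2 * D).
    apply: ler_sum => j _; have [E1 _ _ _] := He j x; rewrite -/D in E1.
    by apply: le_trans E1 _; rewrite mulrBl mul1r addrAC.
  move=> /le_trans; apply; rewrite sumrB -mulr_suml sumr_const.
  rewrite !card_prod card_bool -[(_ * _ * _ * _)%N]/16%N.
  have := ler_wpM2r D0 (Hg x bx); rewrite -(mulr_natl (D + k)).
  by move: (\sum_j _) (D) (k) => s y z; clear; lra.
have : \sum_(j : bool * bool * bool * bool) ((1 - gain / 16) * W0 + e) <= \sum_j W j.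
  by apply: ler_sum => j _.
rewrite sumr_const !card_prod card_bool -[(_ * _ * _ * _)%N]/16%N -(mulr_natl (_ + e)).
by move: S kv; clear; lra.
Qed.

End BoxIntegral.

(** * Almost everywhere convergence *)

Section Convergence.
Context {R : realType}.
Implicit Types (lo hi : R3 R) (h : nat -> R3 R -> R).

Lemma ae3_imp (P Q : R3 R -> Prop) : (forall x, P x -> Q x) ->
  {ae @leb3 R, forall x, P x} -> {ae @leb3 R, forall x, Q x}.
Proof. exact: (@filterS _ _ (ae_filter_ringOfSetsType (@leb3 R))). Qed.

Lemma ae3_and (P Q : R3 R -> Prop) : {ae @leb3 R, forall x, P x} ->
  {ae @leb3 R, forall x, Q x} -> {ae @leb3 R, forall x, P x /\ Q x}.
Proof. exact: (@filterI _ _ (ae_filter_ringOfSetsType (@leb3 R))). Qed.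

Lemma ae3_of_all (P : R3 R -> Prop) : (forall x, P x) -> {ae @leb3 R, forall x, P x}.
Proof. by move=> H; apply: ae3_imp (@filterT _ _ (ae_filter_ringOfSetsType (@leb3 R))). Qed.

Lemma geometric_series_bounded (K s : R) (n : nat) : 0 <= K -> 0 < s < 1 ->
  \sum_(0 <= k < n) K * s ^+ k <= K / (1 - s).
Proof.
move=> K0 /andP[s0 s1].
have s1' : 0 < 1 - s by rewrite subr_gt0.
have -> : \sum_(0 <= k < n) K * s ^+ k = K * (1 - s ^+ n) / (1 - s).
  by have /(congr1 (fun f => f n)) := geometric_seriesE K (negbT (lt_eqF s1)); rewrite seriesEnat.
apply: ler_wpM2r; first by rewrite invr_ge0 ltW.
by rewrite ler_piMr// gerBl exprn_ge0// ltW.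
Qed.

(* Beppo Levi: integrable sums converge almost everywhere. *)
Lemma ae_cvg_series lo hi (d : nat -> R3 R -> R) (K s : R) : 0 <= K -> 0 < s < 1 ->
  (forall k, continuous (d k)) -> (forall k, supported_in (box lo hi) (d k)) ->
  (forall k, bint lo hi (fun x => `|d k x|) <= K * s ^+ k) ->
  {ae @leb3 R, forall x, cvgn (series (d ^~ x))}.
Proof.
move=> K0 s01 cd dB dK.
have mB : measurable (box lo hi : set (mR3 R)) := measurable_box lo hi.
pose F : mR3 R -> \bar R := fun x => (\sum_(0 <= k <oo) (`|d k x|)%:E)%E.
have cnd k : continuous (fun x => `|d k x|) by move=> x; apply: cvg_norm; exact: cd.
have mnd k : @measurable_fun _ _ (mR3 R) (\bar R) (box lo hi) (fun x => (`|d k x|)%:E).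
  apply/measurable_EFinP; apply: measurable_funS (continuous_measurable_fun3 (cnd k)) => //.
have FK : (\int[leb3]_(x in box lo hi) F x < +oo)%E.
  rewrite /F integral_nneseries//.
  apply: (@le_lt_trans _ _ (K / (1 - s))%:E); last exact: ltry.
  apply: lime_le; first by apply: is_cvg_nneseries => n _ _; apply: integral_ge0 => x _; rewrite lee_fin.
  near=> n.
  have E k : (\int[leb3]_(x in box lo hi) (`|d k x|)%:E = (bint lo hi (fun x => `|d k x|))%:E)%E.
    rewrite /bint /Rintegral fineK//; apply: integrable_fin_num => //.
    exact: integrable_continuous.
  under eq_bigr do rewrite E.
  rewrite sumEFin lee_fin; apply: le_trans (geometric_series_bounded n K0 s01).
  by apply: ler_sum => k _; exact: dK.
have iF : leb3.-integrable (box lo hi) F.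
  apply/integrableP; split.
    by apply: ge0_emeasurable_sum => // k x _ _; rewrite lee_fin.
  under eq_integral => x _.
    rewrite gee0_abs; last by apply: nneseries_ge0 => k _ _; rewrite lee_fin.
    over.
  exact: FK.
apply: ae3_imp (integrable_ae mB iF) => x Fx.
have [bx|bx] := pselect (box lo hi x); last first.
  rewrite (_ : series _ = cst 0); first exact: is_cvg_cst.
  by apply/funext => n; rewrite /series /= big1// => k _; exact: dB.
apply: normed_cvg.
apply: nondecreasing_is_cvgn; first by apply: nondecreasing_series => k _ _ /=; exact: normr_ge0.
exists (fine (F x)) => _ [n _ <-].
rewrite -lee_fin fineK; last exact: Fx.
rewrite /= -sumEFin; apply: nneseries_lim_ge => k _ _.
by rewrite lee_fin.
Unshelve. all: by end_near. Qed.

Lemma ae_cvg_increments lo hi h (K s : R) : 0 <= K -> 0 < s < 1 ->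
  (forall k, continuous (h k)) -> (forall k, supported_in (box lo hi) (h k)) ->
  (forall k, bint lo hi (fun x => `|h k.+1 x - h k x|) <= K * s ^+ k) ->
  {ae @leb3 R, forall x, cvgn (h ^~ x)}.
Proof.
move=> K0 s01 ch hB hK.
have cd k : continuous (fun x => h k.+1 x - h k x).
  by move=> x; apply: cvgB; exact: ch.
have dB k : supported_in (box lo hi) (fun x => h k.+1 x - h k x).
  by move=> x bx; rewrite !hB ?subrr.
apply: (ae3_imp _ (ae_cvg_series K0 s01 cd dB hK)) => x xA.
suff -> : h ^~ x = cst (h 0%N x) \+ series (fun k => h k.+1 x - h k x).
  by apply: is_cvgD => //; exact: is_cvg_cst.
by apply/funext => n; rewrite /= -(eq_sum_telescope (h ^~ x)).
Qed.

(** For uniformly bounded sequences the limit superior is bounded and measurable without any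
    exceptional set. *)
Definition field_limit h x : R := limn_sup (h ^~ x).

Lemma cvg_field_limit h x : cvgn (h ^~ x) -> h ^~ x @ \oo --> field_limit h x.
Proof.
move=> hx; have /cvg_lim E := cvg_sups hx.
by rewrite /field_limit /limn_sup E.
Qed.

Lemma measurable_field_limit h (M : R) : (forall k, continuous (h k)) ->
  (forall k x, `|h k x| <= M) -> measurable_fun setT (field_limit h : mR3 R -> R).
Proof.
move=> ch hM; apply: measurable_fun_limn_sup => [x _|x _|k].
- by exists M => _ [k _ <-]; apply: le_trans (hM k x); exact: ler_norm.
- by exists (- M) => _ [k _ <-]; have := hM k x; rewrite ler_norml => /andP[].
- exact: continuous_measurable_fun3.
Qed.

Lemma field_limit_bounded h (M : R) x : (forall k, `|h k x| <= M) -> `|field_limit h x| <= M.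
Proof.
move=> hM; have hM' k : - M <= h k x <= M by rewrite -ler_norml.
have ub : has_ubound (range (h ^~ x)) by exists M => _ [k _ <-]; case/andP: (hM' k).
have lb : has_lbound (range (h ^~ x)) by exists (- M) => _ [k _ <-]; case/andP: (hM' k).
have cs := cvg_sups_inf ub lb.
have -> : field_limit h x = inf (range (sups (h ^~ x))) by exact/cvg_lim.
rewrite ler_norml; apply/andP; split.
  apply: (cvgr_to_ge cs); apply: nearW => n; have [+ _] := andP (hM' n) => /le_trans; apply.
  by apply: ub_le_sup; [exact: has_ubound_sdrop|exists n => /=].
apply: (cvgr_to_le cs); apply: nearW => n; apply: ge_sup; first by exists (h n x), n => /=.
by move=> _ [k _ <-]; case/andP: (hM' k).
Qed.

Lemma field_limit_supported lo hi h : (forall k, supported_in (box lo hi) (h k)) ->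
  supported_in (box lo hi) (field_limit h).
Proof.
move=> hB x bx; have E : h ^~ x = cst 0 by apply/funext => k; exact: hB.
have c : cvgn (h ^~ x) by rewrite E; exact: is_cvg_cst.
have /cvg_lim <-// := cvg_field_limit c.
by rewrite E lim_cst.
Qed.

End Convergence.

Section Iteration.
Context {R : realType}.
Implicit Types (lo hi : R3 R) (u w : R3 R -> R).

(* The integrated defect decays like [rate ^+ k]; AM-GM bounds the gradient increments
   in L^1 by its square root, which is still summable. *)
Definition sqrt_rate : R := 1 - gain / 64.
Definition rate : R := sqrt_rate ^+ 2.

Lemma sqrt_rate01 : 0 < sqrt_rate < 1.
Proof.
have := @gain_gt0 R; have := @gain_le1 R; rewrite /sqrt_rate => ? ?.
by apply/andP; split; lra.
Qed.

(** The second bound absorbs the contraction of a step and its error into one factor [rate]; the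
    third makes errors of size [e * (gain / 64) * rate ^+ k] sum to at most [e]. *)
Lemma rate_bounds : [/\ 0 < rate, 1 - gain / 16 + gain / 64 <= rate & gain / 64 <= 1 - rate].
Proof.
have g0 := @gain_gt0 R; have g1 := @gain_le1 R; rewrite /rate /sqrt_rate.
have H : 0 <= gain * (1 - gain) :> R by rewrite mulr_ge0 ?subr_ge0// ltW.
have H2 : 0 <= gain * gain :> R by rewrite mulr_ge0// ltW.
split; [rewrite exprn_gt0//; lra| |]; rewrite expr2; move: gain g0 g1 H H2 => g *; nra.
Qed.

Lemma ord3_cases (i : 'I_3) : i = inord 0 \/ i = inord 1 \/ i = inord 2.
Proof.
by case: i => -[|[|[|//]]] ilt; [left|right; left|right; right]; apply/val_inj; rewrite /= inordK.
Qed.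

Lemma partial_sq (i : 'I_3) u w x :
  ('D_(e3 i) u x - 'D_(e3 i) w x) ^+ 2 <= dot (grad u x - grad w x) (grad u x - grad w x).
Proof.
rewrite /dot /grad /= -!expr2.
by have [->|[->|->]] := ord3_cases i;
  [rewrite -addrA lerDl|rewrite -addrA addrCA lerDl|rewrite lerDr]; rewrite addr_ge0 ?sqr_ge0.
Qed.

(** The tolerances of the steps decay at the same rate as the defect and sum to at most [e], so the
    decay, the closeness to the start and both energy bounds hold along the entire sequence. *)
Lemma iteration lo hi u1 u2 (e : R) : testfun lo hi u1 -> testfun lo hi u2 -> 0 < e <= 1 ->
  exists (U V : nat -> R3 R -> R) (C : R), let A k := fun x => defect (grad (U k) x) (grad (V k) x) in
  [/\ [/\ 0 <= C, forall k, testfun lo hi (U k) & forall k, testfun lo hi (V k)],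
      forall k x, `|U k x - u1 x| <= e /\ `|V k x - u2 x| <= e,
      forall k x, `|U k.+1 x - U k x| <= rate ^+ k /\ `|V k.+1 x - V k x| <= rate ^+ k,
      forall k x, let E0 := energy (grad u1 x) (grad u2 x) in
        let Ek := energy (grad (U k) x) (grad (V k) x) in
        Ek + A k x <= E0 + defect (grad u1 x) (grad u2 x) + e /\ E0 - e <= Ek &
      (forall k, bint lo hi (A k) <= C * rate ^+ k) /\
      forall k x, energy (grad (U k.+1) x - grad (U k) x) (grad (V k.+1) x - grad (V k) x)
         <= A k x + rate ^+ k].
Proof.
move=> t1 t2 /andP[e0 e1].
(* With the hypotheses inside the existential, [choice] gives a step map on all states; a state
   violating them is returned unchanged. *)
have step3 (q : (R3 R -> R) * (R3 R -> R) * R) : exists w : (R3 R -> R) * (R3 R -> R),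
  testfun lo hi q.1.1 -> testfun lo hi q.1.2 -> 0 < q.2 ->
  [/\ testfun lo hi w.1 /\ testfun lo hi w.2,
      forall x, `|w.1 x - q.1.1 x| <= q.2 /\ `|w.2 x - q.1.2 x| <= q.2,
      forall x, let a := grad q.1.1 x in let b := grad q.1.2 x in
        let a' := grad w.1 x in let b' := grad w.2 x in
        [/\ energy a' b' + defect a' b' <= energy a b + defect a b + q.2,
          energy a b - q.2 <= energy a' b' &
          energy (a' - a) (b' - b) <= defect a b + q.2] &
      bint lo hi (fun x => defect (grad w.1 x) (grad w.2 x)) <=
        (1 - gain / 16) * bint lo hi (fun x => defect (grad q.1.1 x) (grad q.1.2 x)) + q.2].
  have [[[T1 T2] T3]|nT] := pselect ((testfun lo hi q.1.1 /\ testfun lo hi q.1.2) /\ 0 < q.2).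
    by have [w1 [w2 H]] := perturbation_step_integrated T1 T2 T3; exists (w1, w2).
  by exists (q.1.1, q.1.2) => T1 T2 T3; exfalso; apply: nT.
have [Phi HPhi] := choice step3.
have g0 := @gain_gt0 R; have g1 := @gain_le1 R.
have [r0 r1 r2] := rate_bounds.
pose ep k : R := e * (gain / 64) * rate ^+ k.
have ep0 k : 0 < ep k by apply: mulr_gt0; [apply: mulr_gt0 => //; exact: divr_gt0|exact: exprn_gt0].
have epr k : ep k <= rate ^+ k.
  have ek : e * (gain / 64) <= 1 * 1 by apply: ler_pM => //; [exact: ltW|rewrite divr_ge0 ?ltW|lra].
  by rewrite /ep -[leRHS]mul1r -[X in _ <= X * _]mulr1 ler_wpM2r// exprn_ge0// ltW.
pose fix Z k := if k is k'.+1 then Phi (Z k', ep k') else (u1, u2).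
have TZ k : testfun lo hi (Z k).1 /\ testfun lo hi (Z k).2.
  by elim: k => [//|k [T1 T2]]; have [] := HPhi (Z k, ep k) T1 T2 (ep0 k).
have SZ k := HPhi (Z k, ep k) (TZ k).1 (TZ k).2 (ep0 k).
(* A closed-form majorant of the sum of the first [k] tolerances. *)
pose S k : R := e * (1 - rate ^+ k).
have SS k : S k + ep k <= S k.+1.
  rewrite /S /ep exprS -mulrA -mulrDr ler_wpM2l ?(ltW e0)//.
  have : gain / 64 * rate ^+ k <= (1 - rate) * rate ^+ k by rewrite ler_wpM2r// exprn_ge0// ltW.
  rewrite mulrBl mul1r; move: (rate ^+ k) (rate * _) (gain / 64 * _) => x y z; clear; lra.
have Se k : S k <= e by rewrite ler_piMr ?(ltW e0)// gerBl exprn_ge0// ltW.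
have S0 : S 0%N = 0 by rewrite /S expr0 subrr mulr0.
pose A k := fun x => defect (grad (Z k).1 x) (grad (Z k).2 x).
(* The 1 gives [1 <= C], so that the induction can bound [ep k] by [C * (gain / 64) * rate ^+ k]. *)
pose C := bint lo hi (A 0%N) + 1.
have A0 : 0 <= bint lo hi (A 0%N) by apply: bint_ge0 => x; exact: defect_ge0.
exists (fun k => (Z k).1), (fun k => (Z k).2), C; split.
- by split; [rewrite addr_ge0|move=> k; have [] := TZ k|move=> k; have [] := TZ k].
- move=> k x; suff [H1 H2] : `|(Z k).1 x - u1 x| <= S k /\ `|(Z k).2 x - u2 x| <= S k.
    by split; exact: le_trans (Se k).
  elim: k => [|k [H1 H2]]; first by rewrite !subrr normr0 S0.
  have [_ /(_ x)[/= K1 K2] _ _] := SZ k.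
  split; apply: le_trans (SS k).
    by apply: le_trans (ler_distD ((Z k).1 x) _ _) _; rewrite addrC; exact: lerD.
  by apply: le_trans (ler_distD ((Z k).2 x) _ _) _; rewrite addrC; exact: lerD.
- move=> k x; have [_ /(_ x)[K1 K2] _ _] := SZ k.
  by split; [apply: le_trans K1 (epr k)|apply: le_trans K2 (epr k)].
- move=> k x; suff [H1 H2] : energy (grad (Z k).1 x) (grad (Z k).2 x) + A k x <=
      energy (grad u1 x) (grad u2 x) + defect (grad u1 x) (grad u2 x) + S k /\
      energy (grad u1 x) (grad u2 x) - S k <= energy (grad (Z k).1 x) (grad (Z k).2 x).
    split; first by apply: le_trans H1 _; rewrite lerD2l.
    by apply: le_trans H2; rewrite lerD2l lerN2.
  elim: k => [|k [H1 H2]]; first by rewrite S0 addr0 subr0.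
  have [_ _ /(_ x)[K1 K2 _] _] := SZ k; split.
    apply: le_trans K1 _; apply: (@le_trans _ _ (energy (grad u1 x) (grad u2 x) + defect (grad u1 x) (grad u2 x) + S k + ep k)).
      by rewrite lerD2r.
    by rewrite -addrA lerD2l.
  apply: le_trans K2; apply: (@le_trans _ _ (energy (grad u1 x) (grad u2 x) - S k - ep k)).
    by have := SS k; move: (energy _ _) (S k.+1) (S k) (ep k) => p q r s; clear; lra.
  by rewrite lerD2r.
- split; last first.
    move=> k x; have [_ _ /(_ x)[_ _ K] _] := SZ k.
    by apply: le_trans K _; rewrite lerD2l; exact: epr.
  elim=> [|k IH]; first by rewrite expr0 mulr1 lerDl.
  have [_ _ _ K] := SZ k; apply: le_trans K _; rewrite /=.
  have C1 : 1 <= C by rewrite lerDr.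
  apply: (@le_trans _ _ ((1 - gain / 16) * (C * rate ^+ k) + C * (gain / 64) * rate ^+ k)).
    apply: lerD.
      by rewrite ler_wpM2l// subr_ge0 ler_pdivrMr// mul1r (le_trans g1)// ler1n.
    apply: ler_wpM2r; first by rewrite exprn_ge0// ltW.
    apply: ler_wpM2r; first by rewrite divr_ge0// ltW.
    exact: le_trans C1.
  have -> : (1 - gain / 16) * (C * rate ^+ k) + C * (gain / 64) * rate ^+ k =
    (1 - gain / 16 + gain / 64) * (C * rate ^+ k) by ring.
  rewrite exprS [leRHS]mulrCA; apply: ler_wpM2r => //.
  by rewrite mulr_ge0// ?(le_trans ler01 C1)// exprn_ge0// ltW.
Qed.

End Iteration.

(** * Limits of the iteration *)

Section Limit.
Context {R : realType}.
Implicit Types (lo hi : R3 R) (f u w : R3 R -> R) (G H : 'I_3 -> R3 R -> R).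

(* The form in which convex integration delivers an element [f] of W_0^{1,q} with weak
   gradient [G]; bounds hold everywhere because [G] is taken to be a limit superior. *)
Definition approximable lo hi f G := exists u : nat -> R3 R -> R,
  [/\ forall k, testfun lo hi (u k),
      exists M : R, forall x i, `|G i x| <= M /\
        forall k, `|u k x| <= M /\ `|'D_(e3 i) (u k) x| <= M,
      forall x, u k x @[k --> \oo] --> f x,
      forall i, {ae @leb3 R, forall x, 'D_(e3 i) (u k) x @[k --> \oo] --> G i x} &
      forall i, measurable_fun setT (G i : mR3 R -> R) /\ supported_in (box lo hi) (G i)].

Definition vec G x : R3 R := (G (inord 0) x, G (inord 1) x, G (inord 2) x).

Lemma ae3_ord (P : 'I_3 -> R3 R -> Prop) : (forall i, {ae @leb3 R, forall x, P i x}) ->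
  {ae @leb3 R, forall x, forall i, P i x}.
Proof.
move=> H; have := ae3_and (H (inord 0)) (ae3_and (H (inord 1)) (H (inord 2))).
apply: ae3_imp => x [h0 [h1 h2]] i.
by have [->|[->|->]] := ord3_cases i.
Qed.

Lemma cvg_geometric_increments (v : nat -> R) (s : R) : 0 < s < 1 ->
  (forall k, `|v k.+1 - v k| <= s ^+ k) -> cvgn v.
Proof.
move=> s01 vs; suff -> : v = cst (v 0%N) \+ series (telescope v).
  apply: is_cvgD; first exact: is_cvg_cst.
  apply: normed_cvg; apply: nondecreasing_is_cvgn.
    by apply: nondecreasing_series => k _ _ /=; exact: normr_ge0.
  exists (1 / (1 - s)) => _ [n _ <-].
  apply: le_trans (geometric_series_bounded n ler01 s01).
  by apply: ler_sum => k _; rewrite mul1r; exact: vs.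
by apply/funext => n; rewrite /= -eq_sum_telescope.
Qed.

Lemma cvg_dot (a b : nat -> R3 R) (p q : R3 R) :
  (a n).1.1 @[n --> \oo] --> p.1.1 -> (a n).1.2 @[n --> \oo] --> p.1.2 ->
  (a n).2 @[n --> \oo] --> p.2 ->
  (b n).1.1 @[n --> \oo] --> q.1.1 -> (b n).1.2 @[n --> \oo] --> q.1.2 ->
  (b n).2 @[n --> \oo] --> q.2 ->
  dot (a n) (b n) @[n --> \oo] --> dot p q.
Proof.
by move=> a1 a2 a3 b1 b2 b3; apply: cvgD; [apply: cvgD|]; apply: cvgM.
Qed.

Lemma amgm_bound (c s : R) : 0 < s -> `|c| <= s + s^-1 * c ^+ 2.
Proof.
move=> s0; rewrite -(ler_pM2l s0) mulrDr mulrA mulfV ?gt_eqF// mul1r.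
have := sqr_ge0 (`|c| - s); rewrite sqrrB real_normK ?num_real//.
have := sqr_ge0 c; have := mulr_ge0 (ltW s0) (normr_ge0 c).
rewrite !expr2 mulr2n (mulrC `|c|); lra.
Qed.

Lemma grad_increment_bound lo hi (U V : nat -> R3 R -> R) (C : R) :
  0 <= C ->
  (forall k, testfun lo hi (U k)) -> (forall k, testfun lo hi (V k)) ->
  (forall k, bint lo hi (fun x => defect (grad (U k) x) (grad (V k) x)) <= C * rate ^+ k) ->
  (forall k x i, ('D_(e3 i) (U k.+1) x - 'D_(e3 i) (U k) x) ^+ 2 <=
     defect (grad (U k) x) (grad (V k) x) + rate ^+ k) ->
  forall k i, bint lo hi (fun x => `|'D_(e3 i) (U k.+1) x - 'D_(e3 i) (U k) x|) <=
    (2 * vol lo hi + C) * sqrt_rate ^+ k.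
Proof.
move=> C0 TU TV HA HD k i.
have [s0 s1] := andP (@sqrt_rate01 R).
have sk0 : 0 < (sqrt_rate : R) ^+ k by rewrite exprn_gt0.
have cA : continuous (fun x => defect (grad (U k) x) (grad (V k) x)).
  by apply: continuous_defect; [case: (TU k)|case: (TV k)].
have cD n : continuous ('D_(e3 i) (U n)).
  by apply: sm_continuous; apply: sm_derive; case: (TU n).
(* [amgm_bound] with [s = sqrt_rate ^+ k] is balanced: [s^-1 * rate ^+ k] equals [s] again. *)
apply: (@le_trans _ _ (bint lo hi (fun x => 2 * sqrt_rate ^+ k + (sqrt_rate ^+ k)^-1 * defect (grad (U k) x) (grad (V k) x)))).
  apply: bint_le.
  - by move=> x; apply: cvg_norm; apply: cvgB; exact: cD.
  - move=> x; apply: cvgD; first exact: cvg_cst.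
    by apply: cvgM; [exact: cvg_cst|exact: cA].
  move=> x _; apply: le_trans (amgm_bound _ sk0) _.
  have sk1 : 0 <= (sqrt_rate ^+ k : R)^-1 by rewrite invr_ge0 ltW.
  apply: (@le_trans _ _ (sqrt_rate ^+ k + (sqrt_rate ^+ k)^-1 * (defect (grad (U k) x) (grad (V k) x) + rate ^+ k))).
    by rewrite lerD2l ler_wpM2l.
  rewrite mulrDr addrA addrAC; rewrite lerD2r.
  have -> : (sqrt_rate ^+ k)^-1 * rate ^+ k = sqrt_rate ^+ k :> R.
    by rewrite /rate -exprM mulnC exprM expr2 mulrA mulVf ?mul1r ?gt_eqF.
  by rewrite mulr_natl mulr2n.
rewrite bintD; last 2 first.
- by move=> x; exact: cvg_cst.
- by move=> x; apply: cvgM; [exact: cvg_cst|exact: cA].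
rewrite bint_cst bintZ//.
have -> : (2 * vol lo hi + C) * sqrt_rate ^+ k = 2 * sqrt_rate ^+ k * vol lo hi + C * sqrt_rate ^+ k by ring.
rewrite lerD2l ler_pdivrMl//; apply: le_trans (HA k) _.
by rewrite /rate -exprM mulnC exprM expr2; rewrite mulrCA.
Qed.

Lemma defectC (a b : R3 R) : defect a b = defect b a.
Proof.
rewrite /defect /confX /confY (dotC b a) -normrN; congr (`|_| + _); exact: opprB.
Qed.

Lemma partial_sq_le (i : 'I_3) u x : ('D_(e3 i) u x) ^+ 2 <= dot (grad u x) (grad u x).
Proof.
have := partial_sq i u (cst 0) x; rewrite derive_cst subr0.
have -> : grad (cst 0) x = 0 by rewrite /grad !derive_cst.
by rewrite subr0.
Qed.

Lemma convex_integration lo hi u1 u2 (e : R) :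
  testfun lo hi u1 -> testfun lo hi u2 -> 0 < e <= 1 ->
  exists f1 f2 G1 G2,
  [/\ approximable lo hi f1 G1, approximable lo hi f2 G2,
      forall x, `|f1 x - u1 x| <= e /\ `|f2 x - u2 x| <= e &
      {ae @leb3 R, forall x, [/\ defect (vec G1 x) (vec G2 x) = 0,
         energy (grad u1 x) (grad u2 x) - e <= energy (vec G1 x) (vec G2 x) &
         energy (vec G1 x) (vec G2 x) <=
           energy (grad u1 x) (grad u2 x) + defect (grad u1 x) (grad u2 x) + e]}].
Proof.
move=> t1 t2 e01.
have [U [V [C [[C0 TU TV] Hclose Hinc Hen [HA HD]]]]] := iteration t1 t2 e01.
have s01 := @sqrt_rate01 R; have [r0 _ _] := @rate_bounds R.
have r01 : 0 < (rate : R) < 1.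
  by rewrite r0 /rate; case/andP: s01 => ? ?; rewrite exprn_ilt1// ltW.
have K0 : 0 <= 2 * vol lo hi + C by rewrite addr_ge0// mulr_ge0// vol_ge0.
pose A k := fun x => defect (grad (U k) x) (grad (V k) x).
have dU k x i : ('D_(e3 i) (U k.+1) x - 'D_(e3 i) (U k) x) ^+ 2 <= A k x + rate ^+ k.
  apply: le_trans (HD k x); apply: le_trans (partial_sq i _ _ _) _.
  by rewrite /energy lerDl dot_ge0.
have dV k x i : ('D_(e3 i) (V k.+1) x - 'D_(e3 i) (V k) x) ^+ 2 <= A k x + rate ^+ k.
  apply: le_trans (HD k x); apply: le_trans (partial_sq i _ _ _) _.
  by rewrite /energy lerDr dot_ge0.
have A' k : bint lo hi (fun x => defect (grad (V k) x) (grad (U k) x)) <= C * rate ^+ k.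
  apply: le_trans (HA k); rewrite le_eqVlt; apply/orP; left; apply/eqP.
  by congr bint; apply/funext => x; exact: defectC.
have dV' k x i : ('D_(e3 i) (V k.+1) x - 'D_(e3 i) (V k) x) ^+ 2 <=
    defect (grad (V k) x) (grad (U k) x) + rate ^+ k by rewrite defectC; exact: dV.
(* Energy plus defect exceeds its initial value by at most [e], which yields one bound for the
   derivatives of all iterates. *)
have [B HB] : exists B, forall k x i, `|'D_(e3 i) (U k) x| <= B /\ `|'D_(e3 i) (V k) x| <= B.
  have [m1 m10 Hm1] := grad_bnd t1; have [m2 m20 Hm2] := grad_bnd t2.
  pose m : R := m1 + m2.
  have am x : bnd m (grad u1 x) by apply: bnd_le (Hm1 x); rewrite lerDl.
  have bm x : bnd m (grad u2 x) by apply: bnd_le (Hm2 x); rewrite lerDr.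
  pose B : R := 6 * (m * m) + (4 * m) ^+ 2 + 1.
  have EB k x : energy (grad (U k) x) (grad (V k) x) <= B.
    have [H _] := Hen k x; have D0 := defect_ge0 (grad (U k) x) (grad (V k) x).
    have H1 := defect_le (am x) (bm x).
    have := dot_bnd (am x) (am x); have := dot_bnd (bm x) (bm x).
    rewrite !ler_norml => /andP[_ H2] /andP[_ H3].
    case/andP: e01 => _ e1; rewrite /energy in H *; rewrite /B.
    by move: H H1 H2 H3 e1 D0; clear; lra.
  have small (c : R) : c ^+ 2 <= B -> `|c| <= 1 + B.
    by move=> cB; apply: le_trans (amgm_bound c ltr01) _; rewrite invr1 mul1r lerD2l.
  exists (1 + B) => k x i; split; apply: small; apply: le_trans (EB k x);
    apply: le_trans (partial_sq_le i _ _) _; rewrite /energy.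
    by rewrite lerDl dot_ge0.
  by rewrite lerDr dot_ge0.
have conv (W : nat -> R3 R -> R) (u : R3 R -> R) : (forall k, testfun lo hi (W k)) ->
    (forall k x i, `|'D_(e3 i) (W k) x| <= B) ->
    (forall k x, `|W k x - u x| <= e) -> testfun lo hi u ->
    (forall k x, `|W k.+1 x - W k x| <= rate ^+ k) ->
    (forall k i, bint lo hi (fun x => `|'D_(e3 i) (W k.+1) x - 'D_(e3 i) (W k) x|) <=
      (2 * vol lo hi + C) * sqrt_rate ^+ k) ->
    exists f G, [/\ approximable lo hi f G, forall x, `|f x - u x| <= e &
      {ae @leb3 R, forall x, forall i, 'D_(e3 i) (W k) x @[k --> \oo] --> G i x}].
  move=> TW WB Wu tu Winc Wint.
  pose f x := limn (fun k => W k x).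
  pose G i := field_limit (fun k => 'D_(e3 i) (W k)).
  have Wf x : W k x @[k --> \oo] --> f x.
    exact: (cvg_geometric_increments r01 (Winc ^~ x)).
  have cD k i : continuous ('D_(e3 i) (W k)).
    by apply: sm_continuous; apply: sm_derive; case: (TW k).
  have sD k i : supported_in (box lo hi) ('D_(e3 i) (W k)).
    by case: (testfun_derive (e3 i) (TW k)).
  have DG i : {ae @leb3 R, forall x, 'D_(e3 i) (W k) x @[k --> \oo] --> G i x}.
    apply: ae3_imp (ae_cvg_increments K0 s01 (cD ^~ i) (sD ^~ i) (Wint ^~ i)) => x.
    exact: cvg_field_limit.
  exists f, G; split; last exact: ae3_ord.
  - exists W; split=> //.
    + have [m m0 Hm] := testfun_bounded tu.
      exists (B + (m + e)) => x i.
      have B0 : 0 <= B by apply: le_trans (WB 0%N (0 : R3 R) (inord 0)).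
      have e0 : 0 <= e by case/andP: e01 => /ltW.
      split.
        apply: le_trans (field_limit_bounded (WB ^~ x ^~ i)) _.
        by rewrite lerDl addr_ge0.
      move=> k; split.
        rewrite -(subrK (u x) (W k x)); apply: le_trans (ler_normD _ _) _.
        by have := Wu k x; have := Hm x; move: B0; clear; lra.
      by apply: le_trans (WB k x i) _; rewrite lerDl addr_ge0.
    + by move=> i; split; [exact: measurable_field_limit (cD ^~ i) _|exact: field_limit_supported].
  - move=> x; have H : `|W k x - u x| @[k --> \oo] --> `|f x - u x|.
      by apply: cvg_norm; apply: cvgB; [exact: Wf|exact: cvg_cst].
    by apply: (cvgr_to_le H); apply: nearW => k; exact: Wu.
have [f1 [G1 [ap1 c1 ae1]]] := conv U u1 TU (fun k x i => (HB k x i).1) (fun k x => (Hclose k x).1) t1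
  (fun k x => (Hinc k x).1) (grad_increment_bound C0 TU TV HA dU).
have [f2 [G2 [ap2 c2 ae2]]] := conv V u2 TV (fun k x i => (HB k x i).2) (fun k x => (Hclose k x).2) t2
  (fun k x => (Hinc k x).2) (grad_increment_bound C0 TV TU A' dV').
exists f1, f2, G1, G2; split=> //.
have cA k : continuous (A k).
  by apply: continuous_defect; [case: (TU k)|case: (TV k)].
have sA k : supported_in (box lo hi) (A k).
  move=> x bx; rewrite /A !(grad_supported (@closed_box _ _ _) _ bx); last 2 first.
  - by case: (TV k).
  - by case: (TU k).
  by rewrite /defect /confX /confY /dot /= !mul0r !addr0 subr0 mulr0 normr0 addr0.
have nA k : bint lo hi (fun x => `|A k x|) <= C * rate ^+ k.
  apply: le_trans (HA k); rewrite le_eqVlt; apply/orP; left; apply/eqP.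
  by congr bint; apply/funext => x; rewrite ger0_norm// defect_ge0.
(* The defects have summable integrals, so they tend to 0 almost everywhere; by continuity of
   [defect] their limit is also the defect of the limit fields. *)
have aeA := ae_cvg_series C0 r01 cA sA nA.
apply: ae3_imp (ae3_and aeA (ae3_and ae1 ae2)) => x [/cvg_series_cvg_0 Ax [H1 H2]].
have c11 := @cvg_dot (fun k => grad (U k) x) (fun k => grad (U k) x) (vec G1 x) (vec G1 x)
  (H1 _) (H1 _) (H1 _) (H1 _) (H1 _) (H1 _).
have c22 := @cvg_dot (fun k => grad (V k) x) (fun k => grad (V k) x) (vec G2 x) (vec G2 x)
  (H2 _) (H2 _) (H2 _) (H2 _) (H2 _) (H2 _).
have c12 := @cvg_dot (fun k => grad (U k) x) (fun k => grad (V k) x) (vec G1 x) (vec G2 x)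
  (H1 _) (H1 _) (H1 _) (H2 _) (H2 _) (H2 _).
have cE : energy (grad (U k) x) (grad (V k) x) @[k --> \oo] --> energy (vec G1 x) (vec G2 x).
  by apply: cvgD; [exact: c11|exact: c22].
have cAx : A k x @[k --> \oo] --> defect (vec G1 x) (vec G2 x).
  apply: cvgD; apply: cvg_norm.
    by apply: cvgB; [exact: c11|exact: c22].
  by apply: cvgM; [exact: cvg_cst|exact: c12].
split.
- exact: (cvg_unique _ cAx Ax).
- by apply: (cvgr_to_ge cE); apply: nearW => k; have [] := Hen k x.
- apply: (cvgr_to_le cE); apply: nearW => k; have [H _] := Hen k x; apply: le_trans H.
  by rewrite lerDl defect_ge0.
Qed.
End Limit.

(** * Weak derivatives and Sobolev membership *)

Section IntegrationByParts.
Context {R : realType}.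

Lemma integrable_bounded_support d (T : measurableType d) (mu : {measure set T -> \bar R})
  (D : set T) (f : T -> R) (M : R) : measurable D -> (mu D < +oo)%E ->
  measurable_fun setT f -> (forall x, `|f x| <= M) -> (forall x, ~ D x -> f x = 0) ->
  mu.-integrable setT (EFin \o f).
Proof.
move=> mD fD mf fM f0.
have -> : EFin \o f = (EFin \o f) \_ D.
  apply/funext => x; rewrite /patch; case: ifPn => // /negP xD.
  by rewrite /= f0// => Dx; apply: xD; rewrite inE.
apply/(integrable_mkcond _ mD); apply: measurable_bounded_integrable => //.
  exact: measurable_funS mf.
exists M; split; first exact: num_real.
by move=> x Mx y _; apply: le_trans (fM y) (ltW Mx).
Qed.

Lemma integral_derivative_compact_support (h dh : R -> R) (a b : R) :
  (forall t : R, is_derive t (1 : R) h (dh t)) -> continuous dh ->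
  (forall t, ~ (a <= t <= b) -> h t = 0) ->
  (\int[@lebesgue_measure R]_t (dh t)%:E = 0)%E.
Proof.
move=> hd ch h0.
(* The minimum and maximum also handle [b < a], and the margin 1 puts both ends where [h]
   vanishes. *)
pose c := Num.min a b - 1; pose d := Num.max a b + 1.
have [c1 c2] : c < a /\ c < b by split; rewrite ltrBlDr ltr_pwDr// ge_min lexx ?orbT.
have [d1 d2] : a < d /\ b < d by split; rewrite ltr_pwDr// le_max lexx ?orbT.
have D0 t : ~ (a <= t <= b) -> dh t = 0.
  move=> tab; have [_ <-] := hd t.
  transitivity ('D_1 (cst (0 : R)) t); last by rewrite derive_cst.
  apply: near_eq_derive.
  have : open (~` (`[a, b] : set R)) by apply: closed_openC; exact: interval_closed.
  rewrite openE => /(_ t) H; have /H : (~` (`[a, b] : set R)) t by rewrite /= in_itv.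
  by apply: filterS => y; rewrite /= in_itv /= => yab; exact: h0.
have -> : (\int[lebesgue_measure]_t (dh t)%:E = \int[lebesgue_measure]_(t in `[c, d]) (dh t)%:E)%E.
  rewrite [RHS]integral_mkcond; apply: eq_integral => t _.
  rewrite /patch; case: ifPn => // /negP tcd; rewrite D0// => /andP[t1 t2].
  apply: tcd; rewrite inE /= in_itv /=.
  by rewrite (le_trans (ltW c1))//= (le_trans t2)// ltW.
have hc : continuous h.
  move=> t; apply: differentiable_continuous; apply/derivable1_diffP.
  by have [] := hd t.
have cd : c < d by apply: lt_trans d1.
rewrite (@continuous_FTC2 _ dh h) //.
- rewrite !h0 ?subee//.
  + by rewrite leNgt c1.
  + by move=> /andP[_]; rewrite leNgt d2.
- exact: continuous_subspaceT.
- split.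
  + by move=> t _; have [] := hd t.
  + by apply: cvg_at_right_filter; exact: hc.
  + by apply: cvg_at_left_filter; exact: hc.
- by move=> t _; rewrite derive1E; have [_ ->] := hd t.
Qed.

Local Notation lam := (@lebesgue_measure R).
Local Notation mR := (measurableTypeR R).

Lemma e3E : [/\ e3 (inord 0) = (1, 0, 0) :> R3 R, e3 (inord 1) = (0, 1, 0) :> R3 R &
  e3 (inord 2) = (0, 0, 1) :> R3 R].
Proof. by split; rewrite /e3 !inordK. Qed.

Lemma rectangle_lty (a b c d : R) :
  ((lam \x lam)%E ((`[a, b] `*` `[c, d]) : set (mR * mR)) < +oo)%E.
Proof.
have E := product_measure1E lam lam (measurable_itv `[a, b]) (measurable_itv `[c, d]).
apply: (@le_lt_trans _ _ (lam `[a, b] * lam `[c, d])%E); first by rewrite -E.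
have H (r s : R) : exists2 l : R, 0 <= l & lam `[r, s] = l%:E.
  rewrite lebesgue_measure_itv/=; case: ifP => [rs|_]; last by exists 0.
  by exists (s - r); rewrite ?EFinB// subr_ge0; move: rs; rewrite lte_fin => /ltW.
by have [l1 _ ->] := H a b; have [l2 _ ->] := H c d; rewrite -EFinM ltry.
Qed.

Lemma sigma_finite_lebesgue2 : sigma_finite setT ((lam \x lam)%E : set (mR * mR) -> \bar R).
Proof.
exists (fun n : nat => (`[- n%:R, n%:R] `*` `[- n%:R, n%:R]) : set (mR * mR)).
  apply/esym/seteqP; split=> // -[x y] _.
  have [m xm] : exists m : nat, `|x| <= m%:R by exists (Num.trunc `|x|).+1; exact/ltW/truncnS_gt.
  have [n yn] : exists n : nat, `|y| <= n%:R by exists (Num.trunc `|y|).+1; exact/ltW/truncnS_gt.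
  exists (maxn m n) => //; split; rewrite /= in_itv /= -ler_norml.
    by apply: le_trans xm _; rewrite ler_nat leq_maxl.
  by apply: le_trans yn _; rewrite ler_nat leq_maxr.
move=> n; split; last exact: rectangle_lty.
by apply: measurableX; exact: measurable_itv.
Qed.

(* A separate constant, because the library registers no sigma-finite structure on the
   product of two sigma-finite measures. *)
Definition leb2 : set (mR * mR) -> \bar R := (lam \x lam)%E.
HB.instance Definition _ := Measure.copy leb2 (lam \x lam)%E.
HB.instance Definition _ := Measure_isSigmaFinite.Build _ _ _ leb2 sigma_finite_lebesgue2.

(* The slices of [g] along the [i]-th axis have integral zero; Fubini does the rest. *)
Lemma integral_partial_eq0 lo hi (g : R3 R -> R) (i : 'I_3) :
  continuous g -> (forall x, derivable g x (e3 i)) -> continuous ('D_(e3 i) g) ->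
  supported_in (box lo hi) g ->
  (\int[@leb3 R]_x ('D_(e3 i) g x)%:E = 0)%E.
Proof.
move=> cg gd cD sg.
pose F := 'D_(e3 i) g.
have sF : supported_in (box lo hi) F by exact: supported_derive (@closed_box _ _ _) sg.
have [M M0 HM] := continuous_supported_bounded (@compact_box _ lo hi) cD sF.
have mF : measurable_fun setT (F : mR3 R -> R) := continuous_measurable_fun3 cD.
have line (x : R3 R) (a b : R) : (forall t : R, ~ (a <= t <= b) -> g (t *: e3 i + x) = 0) ->
    (\int[lam]_t (F (t *: e3 i + x))%:E = 0)%E.
  apply: integral_derivative_compact_support => [t|t].
    exact: is_derive_line (gd _).
  apply: (@continuous_comp _ _ _ (fun t : R => t *: e3 i + x) F); last exact: cD.
  by apply: cvgD; [apply: cvgZr_tmp; exact: cvg_id|exact: cvg_cst].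
have iF : (@leb3 R).-integrable setT (EFin \o F).
  apply: (integrable_bounded_support (measurable_box lo hi) (leb3_box_lty lo hi) mF HM sF).
have m2 : measurable ((`[lo.1.1, hi.1.1] `*` `[lo.1.2, hi.1.2]) : set (mR * mR)).
  by apply: measurableX; exact: measurable_itv.
have fin2 : ((lam \x lam)%E ((`[lo.1.1, hi.1.1] `*` `[lo.1.2, hi.1.2]) : set (mR * mR)) < +oo)%E.
  exact: rectangle_lty.
have iF2 (z : R) : ((lam \x lam)%E).-integrable setT (EFin \o (fun p : mR * mR => F (p, z))).
  apply: (integrable_bounded_support m2 fin2 (M := M)).
  - by apply: measurableT_comp; [exact: mF|exact: pair2_measurable].
  - by move=> p; exact: HM.
  - by move=> p np; apply: sF => -[].
have [E0 E1 E2] := e3E.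
(* [leb3] is a planar measure times a line, so the third axis takes one application of Fubini and
   the others a second one inside the plane. *)
have [ii|[ii|ii]] := ord3_cases i.
- etransitivity; first exact: esym (@integral21_prod_meas1 _ _ _ _ R leb2 lam _ iF).
  apply: integral0_eq => z _; rewrite /fubini_G.
  etransitivity; first exact: esym (integral21_prod_meas1 (m1 := lam) (m2 := lam) (iF2 z)).
  apply: integral0_eq => y _; rewrite /fubini_G.
  have axis (t : R) : t *: e3 i + ((0, y, z) : R3 R) = (t, y, z).
    by rewrite ii E0; congr (_, _, _); rewrite /= /GRing.scale /=; ring.
  transitivity (\int[lam]_t (F (t *: e3 i + ((0, y, z) : R3 R)))%:E)%E.
    by apply: eq_integral => t _; rewrite axis.
  apply: (line _ lo.1.1 hi.1.1) => t tab; rewrite axis; apply: sg => -[[/= + _] _].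
  by rewrite in_itv /=.
- etransitivity; first exact: esym (@integral21_prod_meas1 _ _ _ _ R leb2 lam _ iF).
  apply: integral0_eq => z _; rewrite /fubini_G.
  etransitivity; first exact: esym (integral12_prod_meas1 (m1 := lam) (m2 := lam) (iF2 z)).
  apply: integral0_eq => y _; rewrite /fubini_F.
  have axis (t : R) : t *: e3 i + ((y, 0, z) : R3 R) = (y, t, z).
    by rewrite ii E1; congr (_, _, _); rewrite /= /GRing.scale /=; ring.
  transitivity (\int[lam]_t (F (t *: e3 i + ((y, 0, z) : R3 R)))%:E)%E.
    by apply: eq_integral => t _; rewrite axis.
  apply: (line _ lo.1.2 hi.1.2) => t tab; rewrite axis; apply: sg => -[[/= _ +] _].
  by rewrite in_itv /=.
- etransitivity; first exact: esym (@integral12_prod_meas1 _ _ _ _ R leb2 lam _ iF).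
  apply: integral0_eq => -[x y] _; rewrite /fubini_F.
  have axis (t : R) : t *: e3 i + ((x, y, 0) : R3 R) = (x, y, t).
    by rewrite ii E2; congr (_, _, _); rewrite /= /GRing.scale /=; ring.
  transitivity (\int[lam]_t (F (t *: e3 i + ((x, y, 0) : R3 R)))%:E)%E.
    by apply: eq_integral => t _; rewrite axis.
  apply: (line _ lo.2 hi.2) => t tab; rewrite axis; apply: sg => -[_ /= +].
  by rewrite in_itv /=.
Qed.

End IntegrationByParts.

(** * Bounded functions on a box and dominated convergence *)

Section Tame.
Context {R : realType}.
Variables lo hi : R3 R.
Implicit Types (f g u phi : R3 R -> R) (F : nat -> R3 R -> R) (Omega : set (R3 R)).

(** Such a function is dominated by a constant on a set of finite measure. All its powers are
    integrable, and uniformly bounded almost everywhere convergence passes to the integrals. *)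
Definition tame f := [/\ measurable_fun setT (f : mR3 R -> R),
  supported_in (box lo hi) f & exists M : R, forall x, `|f x| <= M].

Lemma powR_cvg_at0 (a : nat -> R) (p : R) : 0 < p -> (forall n, 0 <= a n) ->
  a n @[n --> \oo] --> 0 -> a n `^ p @[n --> \oo] --> 0.
Proof.
move=> p0 a0 ca; apply/cvgr0Pnorm_lt => e e0.
have d0 : 0 < e `^ p^-1 by rewrite powR_gt0.
near=> n; rewrite ger0_norm ?powR_ge0//.
have an : a n < e `^ p^-1.
  rewrite -(ger0_norm (a0 n)); near: n.
  by move/cvgr0Pnorm_lt : ca; exact.
have -> : e = (e `^ p^-1) `^ p by rewrite -powRrM mulVf ?gt_eqF// powRr1// ltW.
by rewrite gt0_ltr_powR// ?nnegrE ?powR_ge0.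
Unshelve. all: by end_near. Qed.

Lemma tame_integrable f : tame f -> (@leb3 R).-integrable setT (EFin \o f).
Proof.
move=> [mf sf [M fM]].
exact: integrable_bounded_support (measurable_box _ _) (leb3_box_lty _ _) mf fM sf.
Qed.

Lemma tame_dominated F f (M : R) : (forall n, tame (F n)) -> tame f ->
  (forall n x, `|F n x| <= M) -> {ae @leb3 R, forall x, F n x @[n --> \oo] --> f x} ->
  (\int[leb3]_x (F n x)%:E)%E @[n --> \oo] --> (\int[leb3]_x (f x)%:E)%E.
Proof.
move=> tF [mf sf _] FM cF.
have mB := measurable_box lo hi.
have [//|||||_ _] := @dominated_convergence _ _ _ (@leb3 R) setT measurableT
  (fun n => EFin \o F n) (EFin \o f) ((EFin \o cst M) \_ (box lo hi)).
- by move=> n; case: (tF n) => mF _ _; exact/measurable_EFinP.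
- exact/measurable_EFinP.
- apply: ae3_imp cF => x cx _; apply: cvg_EFin => //; exact: nearW.
- apply/(integrable_mkcond _ mB); apply: (@integrable_bounded _ _ _ _ `|M|).
    exact: measurable_cst.
  by move=> x.
- apply: ae3_of_all => x n _; rewrite /patch; case: ifPn => [_|xB].
    by rewrite lee_fin; exact: FM.
  have [_ sF _] := tF n; rewrite /= sF ?normr0// => Bx.
  by move/negP: xB; apply; rewrite inE.
by [].
Qed.

Lemma tame_continuous f : continuous f -> supported_in (box lo hi) f -> tame f.
Proof.
move=> cf sf; split=> //; first exact: continuous_measurable_fun3.
have [M _ HM] := continuous_supported_bounded (@compact_box _ lo hi) cf sf.
by exists M.
Qed.

Lemma tame_testfun f : testfun lo hi f -> tame f.
Proof. by move=> [sf bf]; apply: tame_continuous bf; exact: sm_continuous. Qed.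

Lemma bounded_on_box g : continuous g -> exists M : R, forall x, box lo hi x -> `|g x| <= M.
Proof.
move=> cg; have : compact (g @` box lo hi).
  by apply: continuous_compact (@compact_box _ lo hi); exact: continuous_subspaceT.
move/compact_bounded => [M [_ HM]]; exists (M + 1) => x bx.
by apply: (HM (M + 1)); [rewrite ltrDl|exists x].
Qed.

(** The factor [g] will be a test function of [Omega] or a derivative of one, whose support may
    leave the box; its bound on the box suffices because [f] vanishes elsewhere. *)
Lemma tameM f g : tame f -> continuous g -> tame (fun x => f x * g x).
Proof.
move=> [mf sf [M fM]] cg; split.
- by apply: measurable_funM => //; exact: continuous_measurable_fun3.
- by move=> x bx; rewrite sf// mul0r.
- have [N gN] := bounded_on_box cg; exists (M * `|N|) => x.
  have M0 : 0 <= M by apply: le_trans (fM x).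
  have [bx|bx] := pselect (box lo hi x); last by rewrite sf// mul0r normr0 mulr_ge0.
  rewrite normrM ler_pM//; apply: le_trans (gN _ bx) (ler_norm _).
Qed.

Lemma tame_sub f g : tame f -> tame g -> tame (f \- g).
Proof.
move=> [mf sf [M fM]] [mg sg [N gN]]; split.
- exact: measurable_funB.
- by move=> x bx; rewrite /= sf// sg// subr0.
- exists (M + N) => x; apply: le_trans (ler_normB _ _) _; exact: lerD.
Qed.

Lemma tame_powR (q : R) f : 0 < q -> tame f -> tame (fun x => `|f x| `^ q).
Proof.
move=> q0 [mf sf [M fM]]; split.
- apply: (measurableT_comp (measurable_powR q)).
  by apply: measurableT_comp mf; exact: normr_measurable.
- by move=> x bx; rewrite sf// normr0 powR0// gt_eqF.
- exists (M `^ q) => x; rewrite ger0_norm ?powR_ge0//; apply: ge0_ler_powR => //.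
  + exact: ltW.
  + by rewrite nnegrE; apply: le_trans (fM x).
Qed.

Section Inclusion.
Variables (Omega : set (R3 R)) (BO : box lo hi `<=` Omega).

Lemma Rintegral_tame f : supported_in (box lo hi) f ->
  Rintegral leb3 Omega f = Rintegral leb3 setT f.
Proof.
move=> sf; rewrite Rintegral_mkcond; apply: eq_Rintegral => x _.
rewrite /patch; case: ifPn => // /negP xO; rewrite sf// => bx.
by apply: xO; rewrite inE; exact: BO.
Qed.

Lemma Lnorm_on_tame (q : R) f : supported_in (box lo hi) f ->
  Lnorm_on q%:E Omega f = ((\int[leb3]_x (`|f x| `^ q)%:E) `^ q^-1)%E.
Proof.
move=> sf; rewrite /Lnorm_on unlock; congr (_ `^ _)%E; apply: eq_integral => x _.
rewrite /patch; case: ifPn => [_|/negP xO]; first by [].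
have -> : f x = 0 by apply: sf => bx; apply: xO; rewrite inE; exact: BO.
by rewrite /= normr0.
Qed.

Lemma tame_Lp (q : R) f : 0 < q -> tame f -> in_Lp q%:E Omega f.
Proof.
move=> q0 tf; have [mf sf _] := tf; split; first exact: measurable_funS mf.
rewrite Lnorm_on_tame//; apply: poweR_lty.
have /integrableP[_] := tame_integrable (tame_powR q0 tf).
apply: le_lt_trans; rewrite le_eqVlt; apply/orP; left; apply/eqP.
by apply: eq_integral => x _; rewrite /= (@ger0_norm _ (_ `^ _)) ?powR_ge0.
Qed.

Lemma tame_locally_integrable f : tame f -> locally_integrable3 Omega f.
Proof.
move=> tf; have [mf sf _] := tf; split; first exact: measurable_funS mf.
move=> K cK _; have mK : measurable (K : set (mR3 R)).
  by apply: closed_measurable3; exact: compact_closed (@hausdorff_R3 R) cK.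
have /integrableP[_ H] := integrableS measurableT mK (@subsetT _ _) (tame_integrable tf).
exact: H.
Qed.

(** Dominated convergence for [|F n - f|^q], with the bound [(2 M)^q] on the box. *)
Lemma Lnorm_on_cvg0 (q M : R) F f : 0 < q -> (forall n, tame (F n)) -> tame f ->
  (forall n x, `|F n x| <= M) -> (forall x, `|f x| <= M) ->
  {ae @leb3 R, forall x, F n x @[n --> \oo] --> f x} ->
  Lnorm_on q%:E Omega (F n \- f) @[n --> \oo] --> 0%E.
Proof.
move=> q0 tF tf FM fM cF.
pose H n x := `|F n x - f x| `^ q.
have tH n : tame (H n) by apply: tame_powR => //; exact: tame_sub.
have t0 : tame (cst 0) by apply: tame_continuous => // x; exact: cvg_cst.
have cH : (\int[leb3]_x (H n x)%:E)%E @[n --> \oo] --> (\int[leb3]_x (cst 0 x)%:E)%E.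
  apply: (tame_dominated (M := (2 * M) `^ q) tH t0).
    move=> n x; rewrite ger0_norm ?powR_ge0//; apply: ge0_ler_powR => //.
    - exact: ltW.
    - by rewrite nnegrE mulr_ge0//; apply: le_trans (fM x).
    - by apply: le_trans (ler_normB _ _) _; rewrite mulrDl mul1r lerD.
  apply: ae3_imp cF => x cx; apply: powR_cvg_at0 => //.
  have : `|F n x - f x| @[n --> \oo] --> `|f x - f x|.
    by apply: cvg_norm; apply: cvgB => //; exact: cvg_cst.
  by rewrite subrr normr0.
have E n : Lnorm_on q%:E Omega (F n \- f) =
    ((fine (\int[leb3]_x (H n x)%:E)%E) `^ q^-1)%:E.
  rewrite Lnorm_on_tame; last by case: (tame_sub (tF n) tf).
  by rewrite -poweR_EFin fineK// integrable_fin_num//; exact: tame_integrable.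
under eq_fun do rewrite E.
apply: cvg_EFin; first exact: nearW.
apply: powR_cvg_at0; first by rewrite invr_gt0.
  by move=> n; rewrite fine_ge0// integral_ge0// => x _; rewrite lee_fin powR_ge0.
rewrite integral0 in cH.
exact: fine_cvg cH.
Qed.

End Inclusion.
End Tame.

Section Membership.
Context {R : realType}.
Variables lo hi : R3 R.
Implicit Types (f g u phi : R3 R -> R) (G : 'I_3 -> R3 R -> R) (Omega : set (R3 R)).

(** The product [u * phi] inherits the support of [u], so its partial derivative integrates to
    zero. *)
Lemma testfun_by_parts u phi (i : 'I_3) : testfun lo hi u -> smooth phi ->
  (\int[@leb3 R]_x (u x * 'D_(e3 i) phi x)%:E =
   - \int[@leb3 R]_x ('D_(e3 i) u x * phi x)%:E)%E.
Proof.
move=> tu sphi; have [su bu] := tu; have [sdu bdu] := testfun_derive (e3 i) tu.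
have cu := sm_continuous su; have cdu := sm_continuous sdu.
have cp := smooth_continuous sphi; have cdp := smooth_continuous (smooth_derive i sphi).
pose g x := u x * phi x.
have Dg x : 'D_(e3 i) g x = 'D_(e3 i) u x * phi x + u x * 'D_(e3 i) phi x.
  rewrite (_ : g = u * phi)// deriveM; first by rewrite addrC mulrC.
  - exact: sm_derivable.
  - exact: smooth_derivable.
have E := @integral_partial_eq0 R lo hi g i.
have {E} : (\int[@leb3 R]_x ('D_(e3 i) g x)%:E = 0)%E.
  apply: E.
  - by move=> x; apply: cvgM; [exact: cu|exact: cp].
  - by move=> x; apply: derivableM; [exact: sm_derivable|exact: smooth_derivable].
  - rewrite (_ : 'D_(e3 i) g = fun x => 'D_(e3 i) u x * phi x + u x * 'D_(e3 i) phi x); last first.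
      exact/funext.
    by move=> x; apply: cvgD; apply: cvgM; [exact: cdu|exact: cp|exact: cu|exact: cdp].
  - by move=> x bx; rewrite /g bu// mul0r.
under eq_integral do rewrite Dg EFinD.
have i1 : (@leb3 R).-integrable setT (EFin \o (fun x => 'D_(e3 i) u x * phi x)).
  by apply: (@tame_integrable _ lo hi); apply: tameM cp; apply: tame_testfun; exact: testfun_derive.
have i2 : (@leb3 R).-integrable setT (EFin \o (fun x => u x * 'D_(e3 i) phi x)).
  by apply: (@tame_integrable _ lo hi); apply: tameM cdp; exact: tame_testfun.
rewrite integralD//; move: (integrable_fin_num measurableT i1) (integrable_fin_num measurableT i2).
rewrite /=; case: (integral _ _ _) => [a| |]//; case: (integral _ _ _) => [b| |]// _ _.
rewrite -EFinD -EFinN => -[ab]; congr EFin.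
by apply/eqP; rewrite -addr_eq0 addrC ab.
Qed.

Lemma approximable_tame f G : approximable lo hi f G -> tame lo hi f /\ forall i, tame lo hi (G i).
Proof.
move=> [u [tu [M HM] uf _ mG]]; split; last first.
  by move=> i; have [mGi sGi] := mG i; split=> //; exists M => x; case: (HM x i).
split.
- apply: (@measurable_fun_cvg _ _ _ setT (fun k => u k : mR3 R -> R) f) => [k|x _].
    by apply: continuous_measurable_fun3; apply: sm_continuous; case: (tu k).
  exact: (uf x).
- move=> x bx; apply: (cvg_unique _ (uf x)) => //.
  rewrite (_ : (fun k => u k x) = cst 0); first exact: cvg_cst.
  by apply/funext => k; have [_ ->] := tu k.
- exists M => x; have H : `|u k x| @[k --> \oo] --> `|f x| by apply: cvg_norm; exact: uf.
  apply: (cvgr_to_le H); apply: nearW => k.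
  by have [_ /(_ k)[]] := HM x (inord 0).
Qed.

Section Inclusion.
Variables (Omega : set (R3 R)) (BO : box lo hi `<=` Omega).

(** Integration by parts for the approximating test functions, passed to the limit on both sides. *)
Lemma approximable_weak_partial f G i : approximable lo hi f G -> weak_partial Omega i f (G i).
Proof.
move=> ap; have [tf tG] := approximable_tame ap.
split; [exact: tame_locally_integrable tf|exact: tame_locally_integrable (tG i)|].
move=> phi [sphi _ _].
have cp := smooth_continuous sphi; have cdp := smooth_continuous (smooth_derive i sphi).
have t1 := tameM tf cdp; have t2 := tameM (tG i) cp.
rewrite !(Rintegral_tame BO); [|by case: t2|by case: t1].
have [u [tu [M HM] uf uG _]] := ap.
have [N gN] := bounded_on_box lo hi cp; have [N' gN'] := bounded_on_box lo hi cdp.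
have tu1 k : tame lo hi (fun x => u k x * 'D_(e3 i) phi x).
  by apply: tameM cdp; exact: tame_testfun.
have tu2 k : tame lo hi (fun x => 'D_(e3 i) (u k) x * phi x).
  by apply: tameM cp; apply: tame_testfun; exact: testfun_derive.
have bound (a b : R3 R -> R) (c : R) : tame lo hi (fun x => a x * b x) ->
    (forall x, `|a x| <= M) -> (forall x, box lo hi x -> `|b x| <= c) ->
    forall x, `|a x * b x| <= M * `|c|.
  move=> [_ sab _] aM bc x; have [bx|bx] := pselect (box lo hi x).
    by rewrite normrM ler_pM//; apply: le_trans (bc _ bx) (ler_norm _).
  by rewrite sab// normr0 mulr_ge0//; apply: le_trans (aM x).
have B1 k := bound _ _ _ (tu1 k) (fun x => ((HM x i).2 k).1) gN'.
have B2 k := bound _ _ _ (tu2 k) (fun x => ((HM x i).2 k).2) gN.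
have C1 : (\int[leb3]_x (u k x * 'D_(e3 i) phi x)%:E)%E @[k --> \oo] -->
    (\int[leb3]_x (f x * 'D_(e3 i) phi x)%:E)%E.
  apply: (tame_dominated tu1 t1 B1); apply: ae3_of_all => x.
  by apply: cvgM; [exact: uf|exact: cvg_cst].
have C2 : (\int[leb3]_x ('D_(e3 i) (u k) x * phi x)%:E)%E @[k --> \oo] -->
    (\int[leb3]_x (G i x * phi x)%:E)%E.
  apply: (tame_dominated tu2 t2 B2); apply: ae3_imp (uG i) => x cx.
  by apply: cvgM => //; exact: cvg_cst.
have E : (\int[leb3]_x (f x * 'D_(e3 i) phi x)%:E = - \int[leb3]_x (G i x * phi x)%:E)%E.
  have EE : (fun k => (\int[leb3]_x (u k x * 'D_(e3 i) phi x)%:E)%E) =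
      (fun k => (- \int[leb3]_x ('D_(e3 i) (u k) x * phi x)%:E)%E).
    by apply/funext => k; exact: testfun_by_parts.
  rewrite EE in C1; exact: (cvg_unique _ C1 (cvgeN C2)).
by rewrite /Rintegral E fineN.
Qed.

Lemma approximable_W10 (q : R) f G : 0 < q -> approximable lo hi f G -> W10 q Omega f.
Proof.
move=> q0 ap; have [tf tG] := approximable_tame ap.
split.
  split; first exact: (tame_Lp BO q0 tf).
  move=> i; exists (G i); first exact: approximable_weak_partial.
  exact: (tame_Lp BO q0 (tG i)).
have [u [tu [M HM] uf uG _]] := ap.
exists G, u; split.
- by move=> i; exact: approximable_weak_partial.
- by move=> k; exact: test_function_testfun BO (tu k).
- apply: (Lnorm_on_cvg0 BO (M := M) q0) => //.
  + by move=> k; exact: tame_testfun.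
  + by move=> k x; have [_ /(_ k)[]] := HM x (inord 0).
  + move=> x; have H : `|u k x| @[k --> \oo] --> `|f x| by apply: cvg_norm; exact: uf.
    apply: (cvgr_to_le H); apply: nearW => k.
    by have [_ /(_ k)[]] := HM x (inord 0).
  + exact: ae3_of_all.
- move=> i; apply: (Lnorm_on_cvg0 BO (M := M) q0) => //.
  + by move=> k; apply: tame_testfun; exact: testfun_derive.
  + by move=> k x; have [_ /(_ k)[]] := HM x i.
  + by move=> x; have [] := HM x i.
Qed.

End Inclusion.

Lemma approximable_scale (c : R) f G : approximable lo hi f G ->
  approximable lo hi (fun x => c * f x) (fun i x => c * G i x).
Proof.
move=> [u [tu [M HM] uf uG mG]]; exists (fun k x => c * u k x).
have D k i x : 'D_(e3 i) (fun x => c * u k x) x = c * 'D_(e3 i) (u k) x.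
  rewrite (_ : (fun x => c * u k x) = c *: u k)// deriveZ//.
  by apply: sm_derivable; case: (tu k).
split.
- move=> k; have [su bu] := tu k; split; first exact: sm_scale.
  by move=> x bx; rewrite bu// mulr0.
- exists (`|c| * M) => x i; have [gM uM] := HM x i; split; first by rewrite normrM ler_wpM2l.
  by move=> k; have [? ?] := uM k; rewrite D !normrM !ler_wpM2l.
- by move=> x; apply: cvgM => //; exact: cvg_cst.
- move=> i; apply: ae3_imp (uG i) => x cx; under eq_fun do rewrite D.
  by apply: cvgM => //; exact: cvg_cst.
- move=> i; have [mGi sGi] := mG i; split.
    by apply: measurable_funM => //; exact: measurable_cst.
  by move=> x bx; rewrite sGi// mulr0.
Qed.

Lemma approximable0 : approximable lo hi (cst 0) (fun=> cst 0).
Proof.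
have D i x : 'D_(e3 i) (cst 0 : R3 R -> R) x = 0 by rewrite derive_cst.
exists (fun=> cst 0); split.
- by move=> k; split=> //; exact: sm_cst.
- by exists 0 => x i; rewrite D normr0; split.
- by move=> x; exact: cvg_cst.
- by move=> i; apply: ae3_of_all => x; under eq_fun do rewrite D; exact: cvg_cst.
- by move=> i; split.
Qed.

End Membership.

(** * Fields on cubes *)

Section Start.
Context {R : realType}.
Variables (o : R3 R) (N : R).
Hypothesis N_gt0 : 0 < N.
Implicit Types (x : R3 R).

Definition corner (t : R) : R3 R := (o.1.1 + t / N, o.1.2 + t / N, o.2 + t / N).

Definition cutoff x : R := eta o N (false, false, false) (0, 0, 0)%N x.

Lemma cutoff_rel (t c : R) : rescale N false 0 c t = N * (t - c).
Proof. by rewrite /rescale /= mul0r addr0 subr0. Qed.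

Lemma cutoff_testfun : testfun o (corner 1) cutoff.
Proof.
split; first exact: sm_eta.
move=> x; apply: contra_notP => /eqP /eta_cell[H1 H2 H3].
have K c t : 0 <= rescale N false 0 c t <= 1 -> c <= t <= c + 1 / N.
  rewrite cutoff_rel => /andP[h1 h2]; apply/andP; split.
    by rewrite -subr_ge0 -(pmulr_rge0 _ N_gt0).
  by rewrite -lerBlDl ler_pdivlMr// mulrC.
by split; [split|]; rewrite /= in_itv /=; apply: K.
Qed.

Lemma cutoff_ge x : box (corner 4^-1) (corner (3 / 4)) x -> rho 4^-1 ^+ 6 <= cutoff x.
Proof.
have K c t : c + 4^-1 / N <= t <= c + (3 / 4) / N -> rho 4^-1 ^+ 2 <= bump N false 0 c t.
  move=> /andP[]; rewrite -lerBrDl ler_pdivrMr// => h1; rewrite -lerBlDl ler_pdivlMr// => h2.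
  rewrite /bump cutoff_rel (mulrC N) expr2; apply: ler_pM; rewrite ?rho_ge0// rho_le//; lra.
have q0 : 0 <= (rho (4^-1 : R)) ^+ 2 by rewrite sqr_ge0.
move=> [[/=]]; rewrite !in_itv /= => /K H1 /K H2 /K H3.
have -> : rho (4^-1 : R) ^+ 6 = rho 4^-1 ^+ 2 * rho 4^-1 ^+ 2 * rho 4^-1 ^+ 2 by rewrite -!exprD.
by rewrite /cutoff /eta; apply: ler_pM => //; [rewrite mulr_ge0|apply: ler_pM].
Qed.

Lemma leb3_core : exists2 v : R, 0 < v & leb3 (box (corner 4^-1) (corner (3 / 4))) = v%:E.
Proof.
have H (c : R) : exists2 l : R, 0 < l & lebesgue_measure `[c + 4^-1 / N, c + (3 / 4) / N] = l%:E.
  have lt : 4^-1 / N < (3 / 4) / N by rewrite ltr_pM2r ?invr_gt0//; lra.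
  exists ((c + (3 / 4) / N) - (c + 4^-1 / N)); first by rewrite subr_gt0 ltrD2l.
  by rewrite lebesgue_measure_itv /= lte_fin ltrD2l lt EFinB.
have [l1 p1 E1] := H o.1.1; have [l2 p2 E2] := H o.1.2; have [l3 p3 E3] := H o.2.
by exists (l1 * l2 * l3); [rewrite !mulr_gt0|rewrite leb3_boxE /= E1 E2 E3 !EFinM].
Qed.

(** Sine and cosine waves with a common cut-off: one gradient is large where the other is small, so
    the lower bound on the energy is free of [l]. *)
Lemma starting_pair (l : R) : 0 < l -> exists u1 u2,
  [/\ testfun o (corner 1) u1, testfun o (corner 1) u2,
      forall x, `|u1 x| <= 1 / l /\ `|u2 x| <= 1 / l &
      forall x, cutoff x ^+ 2 <= energy (grad u1 x) (grad u2 x)].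
Proof.
move=> l0; pose i0 : 'I_1 := ord0.
pose w (_ : 'I_1 * 'I_1 * 'I_1) : R3 R := (1, 0, 0).
pose u c := @wave R o N l 1 (false, false, false) c (fun=> 1) w (i0, i0, i0).
have tu c : testfun o (corner 1) (u c).
  split; first exact: sm_wave.
  have [_ H] := cutoff_testfun; move=> x /H E.
  by rewrite /u /wave; move: E; rewrite /cutoff /pos /= => ->; rewrite mul0r mulr0.
have le_u c x : `|u c x| <= 1 / l by apply: wave_le => //; rewrite normr1.
exists (u 0), (u (pi / 2)); split=> // x.
have D c v : 'D_v (u c) x = cutoff x * cos (l * x.1.1 + c) * v.1.1 +
    l^-1 * ('D_v cutoff x * sin (l * x.1.1 + c)).
  rewrite /u wave_derive// !mul1r.
  have -> : pos (i0, i0, i0) = (0, 0, 0)%N by [].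
  have -> : dot (w (i0, i0, i0)) x = x.1.1 by rewrite /dot /w /= !mul0r mul1r !addr0.
  by have -> : dot (w (i0, i0, i0)) v = v.1.1 by rewrite /dot /w /= !mul0r mul1r !addr0.
have [e0 e1 e2] := @e3E R.
rewrite /energy /grad /dot /= !D e0 e1 e2 /= !addr0 sinDpihalf cosDpihalf.
have S := cos2Dsin2 (l * x.1.1).
move: (cutoff x) (cos (l * x.1.1)) (sin (l * x.1.1)) ('D_(1, 0, 0) cutoff x)
  ('D_(0, 1, 0) cutoff x) ('D_(0, 0, 1) cutoff x) S => E C S d0 d1 d2 CS.
(* The mixed terms of the two phases cancel. *)
rewrite [leRHS](_ : _ = E ^+ 2 * (C ^+ 2 + S ^+ 2) +
    (C ^+ 2 + S ^+ 2) * (l^-1 ^+ 2 * (d0 ^+ 2 + d1 ^+ 2 + d2 ^+ 2))); last by ring.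
by rewrite CS mulr1 mul1r lerDl mulr_ge0 ?sqr_ge0// !addr_ge0 ?sqr_ge0.
Qed.

End Start.

(** * Normalization of the gradients *)

Section Normalization.
Context {R : realType}.
Implicit Types (lo hi x : R3 R) (f g : R3 R -> R) (G : 'I_3 -> R3 R -> R).

Lemma tame_mul lo hi f g : tame lo hi f -> tame lo hi g -> tame lo hi (fun x => f x * g x).
Proof.
move=> [mf sf [M fM]] [mg sg [N gN]]; split.
- exact: measurable_funM.
- by move=> x bx; rewrite sf// mul0r.
- by exists (M * N) => x; rewrite normrM ler_pM.
Qed.

Lemma tame_add lo hi f g : tame lo hi f -> tame lo hi g -> tame lo hi (fun x => f x + g x).
Proof.
move=> [mf sf [M fM]] [mg sg [N gN]]; split.
- exact: measurable_funD.
- by move=> x bx; rewrite sf// sg// addr0.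
- by exists (M + N) => x; apply: le_trans (ler_normD _ _) _; exact: lerD.
Qed.

(** The [q]-th power of the Euclidean norm of one row of the Jacobian. *)
Definition density (q : R) G x : R := dot (vec G x) (vec G x) `^ (q / 2).

Lemma tame_density lo hi (q : R) G : 0 < q -> (forall i, tame lo hi (G i)) ->
  tame lo hi (density q G).
Proof.
move=> q0 tG; have q2 : 0 < q / 2 by rewrite divr_gt0.
have := tame_powR q2 (tame_add (tame_add (tame_mul (tG (inord 0)) (tG (inord 0)))
  (tame_mul (tG (inord 1)) (tG (inord 1)))) (tame_mul (tG (inord 2)) (tG (inord 2)))).
congr (tame lo hi _); apply/funext => x; rewrite ger0_norm//.
by rewrite !addr_ge0// -expr2 sqr_ge0.
Qed.

Lemma density_scale (q c : R) G x : 0 <= c ->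
  density q (fun i x => c * G i x) x = c `^ q * density q G x.
Proof.
move=> c0; rewrite /density.
have -> : dot (vec (fun i x => c * G i x) x) (vec (fun i x => c * G i x) x) =
    c ^+ 2 * dot (vec G x) (vec G x) by rewrite /dot /vec /=; ring.
rewrite powRM ?sqr_ge0 ?dot_ge0//; congr (_ * _).
by rewrite -powR_mulrn// -powRrM mulrCA mulfV ?mulr1.
Qed.

Lemma defect_scale (c : R) (G1 G2 : 'I_3 -> R3 R -> R) x :
  defect (vec G1 x) (vec G2 x) = 0 ->
  defect (vec (fun i x => c * G1 i x) x) (vec (fun i x => c * G2 i x) x) = 0.
Proof.
move=> d0; have -> : defect (vec (fun i x => c * G1 i x) x) (vec (fun i x => c * G2 i x) x) =
    c ^+ 2 * defect (vec G1 x) (vec G2 x).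
  rewrite /defect -[c ^+ 2]ger0_norm ?sqr_ge0// mulrDr -!normrM.
  by congr (_ + _); congr `|_|; rewrite /confX /confY /dot /vec /=; ring.
by rewrite d0 mulr0.
Qed.

Lemma defect0 (a b : R3 R) : defect a b = 0 -> dot a a = dot b b /\ dot a b = 0.
Proof.
move=> /eqP; rewrite paddr_eq0// !normr_eq0 subr_eq0 => /andP[/eqP-> +]; split=> //.
by move: b0; rewrite mulf_eq0 pnatr_eq0 /= => /eqP.
Qed.

(* The energy of the starting pair is bounded below on the core of the cube independently of its
   frequency, so rescaling to unit size does not destroy the smallness of the functions. *)
Lemma cube_field (o : R3 R) (N q delta : R) : 0 < N -> 0 < q -> 0 < delta ->
  let hi := corner o N 1 in
  exists f1 f2 G1 G2, [/\ approximable o hi f1 G1, approximable o hi f2 G2,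
    forall x, `|f1 x| <= delta /\ `|f2 x| <= delta,
    {ae @leb3 R, forall x, defect (vec G1 x) (vec G2 x) = 0} &
    (\int[@leb3 R]_x (density q G1 x + density q G2 x)%:E = 2%:E)%E].
Proof.
move=> N0 q0 d0 hi.
pose c : R := rho 4^-1 ^+ 6; have c0 : 0 < c by rewrite exprn_gt0// rho_gt0// invr_gt0.
have [v v0 Ev] := leb3_core o N0.
(* Lower bound for the integral to be normalized: on the core the limit keeps energy at least
   [c^2 / 2], and conformality splits it equally between the two gradients. *)
pose k : R := (c ^+ 2 / 4) `^ (q / 2) * v.
have k0 : 0 < k by rewrite mulr_gt0// powR_gt0// divr_gt0// exprn_gt0.
(* An upper bound, known before [e] and the frequency are chosen, for the scaling factor [s]
   below. *)
pose S : R := (2 / k) `^ q^-1.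
have S0 : 0 < S by rewrite powR_gt0// divr_gt0.
(* The bound [c^2 / 2] costs at most half the energy on the core. The error and the size of the
   starting pair are each at most [delta / (2 S)], so scaling by at most [S] leaves at most
   [delta]. *)
pose e : R := Num.min 1 (Num.min (c ^+ 2 / 2) (delta / (2 * S))).
have e01 : 0 < e <= 1.
  rewrite /e ge_min lexx !lt_min ltr01 /=; apply/andP; split=> //; apply/andP; split.
    by rewrite divr_gt0// exprn_gt0.
  by rewrite divr_gt0// mulr_gt0.
have ec : e <= c ^+ 2 / 2 by rewrite /e !ge_min lexx !orbT.
have ed : e <= delta / (2 * S) by rewrite /e !ge_min lexx !orbT.
have l0 : 0 < 2 * S / delta by rewrite divr_gt0// mulr_gt0.
have [u1 [u2 [tu1 tu2 su Hu]]] := starting_pair o N0 l0.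
have [f1 [f2 [G1 [G2 [ap1 ap2 fu H]]]]] := convex_integration tu1 tu2 e01.
pose F x := density q G1 x + density q G2 x.
have [_ tG1] := approximable_tame ap1; have [_ tG2] := approximable_tame ap2.
have tF : tame o hi F by apply: tame_add; exact: tame_density.
have F0 x : 0 <= F x by rewrite addr_ge0// powR_ge0.
pose I := fine (\int[@leb3 R]_x (F x)%:E).
have IE : (\int[@leb3 R]_x (F x)%:E)%E = I%:E.
  by rewrite fineK// integrable_fin_num//; exact: tame_integrable tF.
pose B := box (corner o N 4^-1) (corner o N (3 / 4)).
have kI : k <= I.
  rewrite -lee_fin -IE /k EFinM -Ev -integral_cst; last exact: measurable_box.
  rewrite integral_mkcond; apply: ae_ge0_le_integral => //.
  - by move=> x _; rewrite /patch; case: ifP => // _; rewrite lee_fin powR_ge0.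
  - apply/(measurable_restrictT _ _).1; first exact: measurable_box.
    exact: measurable_cst.
  - by move=> x _; rewrite lee_fin.
  - by apply/measurable_EFinP; case: tF.
  apply: ae3_imp H => x [/defect0[E12 _] Hl _] _; rewrite /patch; case: ifPn => [xB|_]; last first.
    by have : (0 <= (F x)%:E)%E by rewrite lee_fin.
  rewrite lee_fin; apply: le_trans (_ : density q G1 x <= _); last by rewrite lerDl powR_ge0.
  apply: ge0_ler_powR; rewrite ?nnegrE ?dot_ge0 ?divr_ge0 ?sqr_ge0 ?(ltW q0)//.
  have : c ^+ 2 <= cutoff o N x ^+ 2.
    by rewrite lerXn2r ?nnegrE ?(ltW c0) ?eta_ge0//; apply: cutoff_ge => //; rewrite inE in xB.
  have := Hu x; move: Hl ec; rewrite /(energy (vec _ _)) -E12.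
  by move: (dot _ _) (energy _ _) (_ ^+ 2) (_ ^+ 2); clear; move=> *; lra.
have I0 : 0 < I by apply: lt_le_trans kI.
pose s := (2 / I) `^ q^-1.
have s0 : 0 <= s by rewrite powR_ge0.
have sS : s <= S.
  apply: ge0_ler_powR; rewrite ?nnegrE ?invr_ge0 ?divr_ge0 ?(ltW q0) ?(ltW I0) ?(ltW k0)//.
  by rewrite ler_pM2l// lef_pV2.
exists (fun x => s * f1 x), (fun x => s * f2 x), (fun i x => s * G1 i x), (fun i x => s * G2 i x).
split.
- exact: approximable_scale.
- exact: approximable_scale.
- move=> x; have small (f u : R3 R -> R) : `|f x - u x| <= e -> `|u x| <= 1 / (2 * S / delta) ->
      `|s * f x| <= delta.
    move=> h1 h2; rewrite normrM (ger0_norm s0).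
    have fS : `|f x| <= delta / S.
      rewrite -(subrK (u x) (f x)); apply: le_trans (ler_normD _ _) _.
      apply: le_trans (lerD (le_trans h1 ed) h2) _.
      rewrite le_eqVlt; apply/orP; left; apply/eqP.
      by field; rewrite !gt_eqF.
    apply: le_trans (ler_pM s0 (normr_ge0 _) sS fS) _.
    by rewrite mulrCA mulfV ?mulr1// gt_eqF.
  have [? ?] := fu x; have [? ?] := su x.
  by split; [apply: (small f1 u1)|apply: (small f2 u2)].
- by apply: ae3_imp H => x [d _ _]; exact: defect_scale.
- under eq_integral do rewrite !density_scale// -mulrDr EFinM.
  have mF : measurable_fun setT (EFin \o F : mR3 R -> \bar R).
    by apply/measurable_EFinP; case: tF.
  have F0' (x : mR3 R) : setT x -> (0 <= (EFin \o F) x)%E by move=> _; rewrite lee_fin.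
  have sq0 : (0 <= (s `^ q)%:E)%E by rewrite lee_fin powR_ge0.
  etransitivity; first exact: (ge0_integralZl (@leb3 R) measurableT mF F0' sq0).
  rewrite IE -EFinM /s -powRrM mulVf ?gt_eqF// powRr1 ?divr_ge0 ?(ltW I0)//.
  by rewrite mulrAC mulfK ?gt_eqF.
Qed.

End Normalization.

(** * The rotation field *)

Section Rotation.
Context {R : realType}.
Implicit Types (a b v : R3 R).

Definition coord v (i : 'I_3) : R := [:: v.1.1; v.1.2; v.2]`_i.

Definition cross a b : R3 R := (a.1.2 * b.2 - a.2 * b.1.2, a.2 * b.1.1 - a.1.1 * b.2,
  a.1.1 * b.1.2 - a.1.2 * b.1.1).

Definition conformal a b := [&& 0 < dot a a, dot a a == dot b b & dot a b == 0].

Definition frame a b : 'M[R]_3 := let r := dot a a `^ (- 2^-1) in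
  \matrix_(i, j) [:: r * coord b i; - (r * coord a i); r ^+ 2 * coord (cross a b) i]`_j.

(** The default value keeps the field in SO(3) at every point, including those where the gradients
    vanish. *)
Definition rotation a b : 'M[R]_3 := if conformal a b then frame a b else 1%:M.

Definition jacobian a b : 'M[R]_3 := \matrix_(i, j) [:: coord a j; coord b j; 0]`_i.

Lemma sum_ord3 (F : 'I_3 -> R) : \sum_i F i = F (inord 0) + F (inord 1) + F (inord 2).
Proof.
rewrite !big_ord_recr big_ord0 /= add0r.
by congr (F _ + F _ + F _); apply: val_inj; rewrite /= inordK.
Qed.

Lemma matrix3P (A B : 'M[R]_3) : (forall i j : nat, (i < 3)%N -> (j < 3)%N ->
  A (inord i) (inord j) = B (inord i) (inord j)) -> A = B.
Proof. by move=> AB; apply/matrixP => i j; rewrite -[i]inord_val -[j]inord_val AB. Qed.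

Lemma frame_SO3 a b : conformal a b -> SO3 (frame a b).
Proof.
move=> /and3P[a0 /eqP ab /eqP o]; set r := dot a a `^ (- 2^-1).
have r2 : r ^+ 2 * dot a a = 1.
  rewrite /r -powR_mulrn ?powR_ge0// -powRrM mulNr mulVf// powRN powRr1 ?ltW//.
  by rewrite mulVf ?gt_eqF.
have r2' : r ^+ 2 * dot b b = 1 by rewrite -ab.
have n2 : r ^+ 4 * dot (cross a b) (cross a b) = 1.
  (* Lagrange's identity for the cross product. *)
  transitivity ((r ^+ 2 * dot a a) * (r ^+ 2 * dot b b) - (r ^+ 2 * dot a b) ^+ 2).
    by rewrite /dot /=; ring.
  by rewrite r2 r2' o mulr0 expr0n subr0 mulr1.
have o2 : r ^+ 2 * dot a b = 0 by rewrite o mulr0.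
have orth : (frame a b)^T *m frame a b = 1%:M.
  apply: matrix3P => i j i3 j3; rewrite !mxE sum_ord3 !mxE -/r !inordK// -val_eqE /= !inordK//.
  move: r2 r2' n2 o2; rewrite /dot /=.
  case: i i3 => [|[|[|//]]] _; case: j j3 => [|[|[|//]]] _; rewrite /coord ?inordK//=;
  move: r a.1.1 a.1.2 a.2 b.1.1 b.1.2 b.2 => r a1 a2 a3 b1 b2 b3 r2 r2' n2 o2.
  - by rewrite -[RHS]r2'; ring.
  - by apply: oppr_inj; rewrite [RHS]oppr0 -[RHS]o2; ring.
  - by ring.
  - by apply: oppr_inj; rewrite [RHS]oppr0 -[RHS]o2; ring.
  - by rewrite -[RHS]r2; ring.
  - by ring.
  - by ring.
  - by ring.
  - by rewrite -[RHS]n2; ring.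
split; first exact: mulmx1C.
(* The determinant of the frame is [r^4] times the squared norm of the cross product. *)
rewrite -n2 (expand_det_row _ (inord 0)) sum_ord3 /cofactor !(expand_det_row _ ord0) !big_ord_recr !big_ord0 /cofactor !det_mx11 !mxE /=.
rewrite /coord !inordK//= /bump /= !inordK//= !add0n !expr0 !expr1 sqrrN expr1n -/r.
by move: (r) => t; rewrite /dot /cross /=; ring.
Qed.

Lemma rotation_SO3 a b : SO3 (rotation a b).
Proof.
rewrite /rotation; case: ifP => [/frame_SO3//|_].
by split; [rewrite trmx1 mulmx1|rewrite det1].
Qed.

Lemma jacobian_rotation_skew a b : defect a b = 0 ->
  jacobian a b *m rotation a b + (jacobian a b *m rotation a b)^T = 0.
Proof.
move=> /defect0[ab o]; rewrite /rotation /conformal -ab o !eqxx !andbT.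
case: ltP => [a0|a0].
  set r := dot a a `^ (- 2^-1).
  apply: matrix3P => i j i3 j3; rewrite !mxE !sum_ord3 !mxE !inordK// -/r.
  have o2 : r * dot a b = 0 by rewrite o mulr0.
  have ab2 : r * dot b b - r * dot a a = 0 by rewrite ab subrr.
  move: o2 ab2; rewrite /dot.
  case: i i3 => [|[|[|//]]] _; case: j j3 => [|[|[|//]]] _; rewrite /coord ?inordK//=;
  move: r a.1.1 a.1.2 a.2 b.1.1 b.1.2 b.2 => r a1 a2 a3 b1 b2 b3 o2 ab2.
  - by rewrite -[RHS](mulr0 2) -[in RHS]o2; ring.
  - by rewrite -[RHS]ab2; ring.
  - by ring.
  - by rewrite -[RHS]ab2; ring.
  - by rewrite -[RHS](mulr0 (- 2)) -[in RHS]o2; ring.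
  - by ring.
  - by ring.
  - by ring.
  - by ring.
(* In the remaining case both gradients are zero, and so is the Jacobian. *)
have z (v : R3 R) : dot v v <= 0 -> forall i, coord v i = 0.
  rewrite /dot -!expr2 => v0.
  have [v1 v2 v3] : [/\ v.1.1 = 0, v.1.2 = 0 & v.2 = 0].
    have p1 := sqr_ge0 v.1.1; have p2 := sqr_ge0 v.1.2; have p3 := sqr_ge0 v.2.
    by split; apply/eqP; rewrite -sqrf_eq0 eq_le; apply/andP; split=> //;
      move: v0 p1 p2 p3; clear; lra.
  by move=> i; rewrite /coord v1 v2 v3; case: (ord3_cases i) => [->|[->|->]]; rewrite inordK.
have -> : jacobian a b = 0.
  apply: matrix3P => i j i3 j3; rewrite !mxE !inordK// !z -?ab//.
  by case: i i3 => [|[|[|]]].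
by rewrite !mul0mx trmx0 addr0.
Qed.

End Rotation.

Section Measurability.
Context {R : realType}.
Implicit Types (A B : 'I_3 -> R3 R -> R).

Lemma measurable_rotation A B (i j : 'I_3) :
  (forall k, measurable_fun setT (A k : mR3 R -> R)) ->
  (forall k, measurable_fun setT (B k : mR3 R -> R)) ->
  measurable_fun setT ((fun x => rotation (vec A x) (vec B x) i j) : mR3 R -> R).
Proof.
move=> mA mB.
have mM (f g : R3 R -> R) : measurable_fun setT (f : mR3 R -> R) -> measurable_fun setT (g : mR3 R -> R) ->
    measurable_fun setT ((fun x => f x * g x) : mR3 R -> R) by move=> mf mg; exact: measurable_funM.
have mdot (C D : 'I_3 -> R3 R -> R) : (forall k, measurable_fun setT (C k : mR3 R -> R)) ->
    (forall k, measurable_fun setT (D k : mR3 R -> R)) ->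
    measurable_fun setT ((fun x => dot (vec C x) (vec D x)) : mR3 R -> R).
  move=> mC mD; rewrite /dot /=; apply: measurable_funD; last exact: mM.
  by apply: measurable_funD; exact: mM.
have mr : measurable_fun setT ((fun x => dot (vec A x) (vec A x) `^ (- 2^-1)) : mR3 R -> R).
  by apply: (measurableT_comp (measurable_powR _)); exact: mdot.
have mr2 : measurable_fun setT ((fun x => (dot (vec A x) (vec A x) `^ (- 2^-1)) ^+ 2) : mR3 R -> R).
  by apply: mM.
rewrite (_ : (fun x => _) = fun x => if conformal (vec A x) (vec B x)
    then frame (vec A x) (vec B x) i j else 1%:M i j); last first.
  by apply/funext => x; rewrite /rotation; case: ifP.
apply: measurable_fun_ifT; last exact: measurable_cst.
  apply: measurable_and; [|apply: measurable_and].
  - by apply: measurable_fun_ltr; [exact: measurable_cst|exact: mdot].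
  - by apply: measurable_fun_eqr; exact: mdot.
  - by apply: measurable_fun_eqr; [exact: mdot|exact: measurable_cst].
have m2 (k l k' l' : 'I_3) : measurable_fun setT ((fun x => A k x * B l x - A k' x * B l' x) : mR3 R -> R).
  by apply: measurable_funB; exact: mM.
rewrite (_ : (fun x => _) = fun x => [:: dot (vec A x) (vec A x) `^ (- 2^-1) * coord (vec B x) i;
    - (dot (vec A x) (vec A x) `^ (- 2^-1) * coord (vec A x) i);
    (dot (vec A x) (vec A x) `^ (- 2^-1)) ^+ 2 * coord (cross (vec A x) (vec B x)) i]`_j); last first.
  by apply/funext => x; rewrite mxE.
have mco (C : 'I_3 -> R3 R -> R) : (forall k, measurable_fun setT (C k : mR3 R -> R)) ->
    measurable_fun setT ((fun x => coord (vec C x) i) : mR3 R -> R).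
  move=> mC; rewrite /coord; case: (ord3_cases i) => [->|[->|->]];
    rewrite inordK//=; exact: mC.
have [->|[->|->]] := ord3_cases j; rewrite inordK//=.
- by apply: mM => //; exact: mco.
- by apply: measurableT_comp => //; apply: mM => //; exact: mco.
- apply: mM => //; rewrite /coord; have [->|[->|->]] := ord3_cases i; rewrite inordK//=; exact: m2.
Qed.

End Measurability.

(** * Gluing over disjoint cubes *)

Section Gluing.
Context {R : realType}.
Variables lo hi : nat -> R3 R.
Hypothesis disjoint_boxes : forall m n x, box (lo m) (hi m) x -> box (lo n) (hi n) x -> m = n.
Variable g : nat -> R3 R -> R.
Hypothesis g_supported : forall n, supported_in (box (lo n) (hi n)) (g n).

(** At each point at most one term is nonzero and the partial sums are eventually constant; as a
    limit of finite sums the result is measurable. *)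
Definition glue x : R := limn (fun n => \sum_(k < n) g k x).

Lemma glue_sum_on m n x : box (lo m) (hi m) x -> (m < n)%N -> \sum_(k < n) g k x = g m x.
Proof.
move=> bx mn; rewrite (bigD1 (Ordinal mn))//= big1 ?addr0// => k km.
apply: g_supported => bk; move/eqP: km; apply; apply: val_inj => /=.
exact: disjoint_boxes bk bx.
Qed.

Lemma cvg_glue x : \sum_(k < n) g k x @[n --> \oo] --> glue x.
Proof.
have [[m bx]|nb] := pselect (exists m, box (lo m) (hi m) x).
  apply/cvg_ex; exists (g m x); apply: cvg_near_cst.
  by exists m.+1 => // n /= mn; exact: glue_sum_on.
apply/cvg_ex; exists 0; apply: cvg_near_cst; apply: nearW => n.
by rewrite big1// => k _; apply: g_supported => bk; apply: nb; exists k.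
Qed.

Lemma glue_on m x : box (lo m) (hi m) x -> glue x = g m x.
Proof.
move=> bx; apply: (cvg_unique _ (@cvg_glue x)) => //; apply: cvg_near_cst.
by exists m.+1 => // n /= mn; exact: glue_sum_on.
Qed.

Lemma measurable_glue : (forall n, measurable_fun setT (g n : mR3 R -> R)) ->
  measurable_fun setT (glue : mR3 R -> R).
Proof.
move=> mg; apply: (@measurable_fun_cvg _ _ _ setT
  (fun n => (fun x => \sum_(k < n) g k x) : mR3 R -> R) glue) => [n|x _].
  by apply: measurable_sum => k; exact: mg.
exact: (@cvg_glue x).
Qed.

End Gluing.

Section Cubes.
Context {R : realType}.

(** The cubes accumulate at [x0] along the first axis: cube [n] starts at distance
    [a n = e / 2^(n+1)] and has side [a n / 2], while cube [n + 1] already ends at distance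
    [3 (a n) / 4]. *)
Lemma open_disjoint_cubes (Omega : set (R3 R)) : open Omega -> Omega !=set0 ->
  exists (o : nat -> R3 R) (N : nat -> R), [/\ forall n, 0 < N n,
    forall n, box (o n) (corner (o n) (N n) 1) `<=` Omega &
    forall m n x, box (o m) (corner (o m) (N m) 1) x ->
      box (o n) (corner (o n) (N n) 1) x -> m = n].
Proof.
move=> oO [x0 Ox0]; move: oO; rewrite openE => /(_ x0 Ox0) /nbhs_ballP[e /= e0 eO].
pose a n : R := e * 2^-1 ^+ n.+1.
have a0 n : 0 < a n by rewrite mulr_gt0// exprn_gt0// invr_gt0.
have aS n : a n.+1 = a n / 2 by rewrite /a exprSr mulrA.
have a_le m n : (m < n)%N -> a n <= a m / 2.
  move=> mn; rewrite -aS; rewrite /a ler_pM2l//.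
  by apply: ler_wiXn2l => //; rewrite ?invr_ge0// invf_le1//; lra.
have ae n : a n <= e / 2.
  rewrite /a ler_pM2l// exprS -[leRHS]mulr1 ler_pM2l ?invr_gt0//.
  by apply: exprn_ile1; rewrite ?invr_ge0// invf_le1//; lra.
exists (fun n => (x0.1.1 + a n, x0.1.2, x0.2)), (fun n => 2 / a n).
have side n : 1 / (2 / a n) = a n / 2 by rewrite mul1r invf_div.
split.
- by move=> n; rewrite divr_gt0.
- move=> n y [[/=]]; rewrite !in_itv /= side => /andP[h1 h2] /andP[h3 h4] /andP[h5 h6].
  have := ae n; have := a0 n => p1 p2.
  by apply: eO; split; [split|]; rewrite /= /ball /= ltr_norml; apply/andP; split;
    move: h1 h2 h3 h4 h5 h6 e0 p1 p2; clear; lra.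
- have lt m n x : (m < n)%N -> box (x0.1.1 + a m, x0.1.2, x0.2)
      (corner (x0.1.1 + a m, x0.1.2, x0.2) (2 / a m) 1) x ->
      box (x0.1.1 + a n, x0.1.2, x0.2) (corner (x0.1.1 + a n, x0.1.2, x0.2) (2 / a n) 1) x -> False.
    move=> /a_le mn [[/= + _] _] [[/= + _] _]; rewrite !in_itv /= !side => /andP[h1 h2] /andP[h3 h4].
    by have := a0 m; move: h1 h2 h3 h4 mn; clear; lra.
  move=> m n x bm bn; have [mn|nm|//] := ltngtP m n.
    by case: (lt _ _ _ mn bm bn).
  by case: (lt _ _ _ nm bn bm).
Qed.

End Cubes.

Section Fields.
Context {R : realType}.
Variables (lo hi : R3 R) (f1 f2 : R3 R -> R) (G1 G2 : 'I_3 -> R3 R -> R).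
Hypotheses (ap1 : approximable lo hi f1 G1) (ap2 : approximable lo hi f2 G2).
Implicit Types x : R3 R.

Definition planar_map x : 'rV[R]_3 := \row_i [:: f1 x; f2 x; 0]`_i.

Definition planar_jac x : 'M[R]_3 := \matrix_(i, j) [:: G1 j x; G2 j x; 0]`_i.

Lemma planar_map_approximable (i : 'I_3) : exists2 G,
  approximable lo hi (fun x => planar_map x 0 i) G & forall j x, planar_jac x i j = G j x.
Proof.
have E (k : 'I_3) f G : approximable lo hi f G -> (forall x, planar_map x 0 k = f x) ->
    (forall j x, planar_jac x k j = G j x) -> exists2 G,
    approximable lo hi (fun x => planar_map x 0 k) G & forall j x, planar_jac x k j = G j x.
  by move=> ap fE GE; exists G => //; have -> : (fun x => planar_map x 0 k) = f by exact/funext.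
have [->|[->|->]] := ord3_cases i.
- by apply: (E _ _ _ ap1) => [x|j x]; rewrite mxE inordK.
- by apply: (E _ _ _ ap2) => [x|j x]; rewrite mxE inordK.
- by apply: (E _ _ _ (approximable0 lo hi)) => [x|j x]; rewrite mxE inordK.
Qed.

Lemma planar_jacE x : planar_jac x = jacobian (vec G1 x) (vec G2 x).
Proof.
have E G (j : 'I_3) : coord (vec G x) j = G j x.
  by rewrite /coord /vec; have [->|[->|->]] := ord3_cases j; rewrite inordK.
by apply/matrixP => i j; rewrite !mxE !E.
Qed.

Lemma planar_jac_supported x : ~ box lo hi x -> planar_jac x = 0.
Proof.
move=> bx; have [_ t1] := approximable_tame ap1; have [_ t2] := approximable_tame ap2.
apply/matrixP => i j; rewrite !mxE; have [_ -> // _] := t1 j; have [_ -> // _] := t2 j.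
by case: i => [[|[|[|]]]].
Qed.

Lemma sum_row_norms (q : R) x : 0 < q ->
  \sum_i enorm (row i (planar_jac x)) `^ q = density q G1 x + density q G2 x.
Proof.
move=> q0; have E i (v : R3 R) : (forall j, planar_jac x i j = coord v j) ->
    enorm (row i (planar_jac x)) `^ q = dot v v `^ (q / 2).
  move=> iv; rewrite /enorm -powR12_sqrt; last by apply: sumr_ge0 => j _; exact: sqr_ge0.
  rewrite -powRrM mulrC; congr (_ `^ _).
  under eq_bigr do rewrite mxE iv.
  by rewrite sum_ord3 /coord !inordK.
have C i j : planar_jac x i j = [:: coord (vec G1 x) j; coord (vec G2 x) j; coord 0 j]`_i.
  rewrite planar_jacE mxE; congr nth; congr [:: _, _ & _]; congr cons.
  by rewrite /coord; have [->|[->|->]] := ord3_cases j; rewrite inordK.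
rewrite sum_ord3 (E (inord 0) (vec G1 x)) ?(E (inord 1) (vec G2 x)) ?(E (inord 2) 0); try by move=> j; rewrite C inordK.
by rewrite /(dot 0) /= !mul0r !addr0 powR0 ?addr0// gt_eqF// divr_gt0.
Qed.

Section Inclusion.
Variables (Omega : set (R3 R)) (BO : box lo hi `<=` Omega) (q : R) (q0 : 0 < q).

Lemma planar_map_W10 : W10_vec q Omega planar_map.
Proof. by move=> i; have [G apG _] := planar_map_approximable i; exact: (approximable_W10 BO q0 apG). Qed.

Lemma planar_map_jacobian : weak_jacobian Omega planar_map planar_jac.
Proof.
move=> i j; have [G apG E] := planar_map_approximable i.
rewrite (_ : (fun x => planar_jac x i j) = G j); last exact/funext.
exact: (approximable_weak_partial BO j apG).
Qed.

Lemma planar_jac_norm : (\int[@leb3 R]_x (density q G1 x + density q G2 x)%:E = 2%:E)%E ->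
  Lq_mxnorm q Omega planar_jac = (2 `^ q^-1)%:E.
Proof.
move=> E; rewrite /Lq_mxnorm -poweR_EFin -E; congr (_ `^ _)%E.
rewrite integral_mkcond; apply: eq_integral => x _; rewrite -sum_row_norms// /patch.
case: ifPn => // /negP xO; rewrite planar_jac_supported => [|bx]; last by apply: xO; rewrite inE; exact: BO.
rewrite big1// => i _; rewrite /enorm big1 => [|j _]; last by rewrite !mxE expr0n.
by rewrite sqrtr0 powR0// gt_eqF.
Qed.

Lemma planar_map_Linfty (d : R) : 0 <= d -> (forall x, `|f1 x| <= d /\ `|f2 x| <= d) ->
  (forall i, measurable_on Omega (fun x => planar_map x 0 i)) /\
  (Linfty_norm Omega planar_map <= (2 * d)%:E)%E.
Proof.
move=> d0 fd; split.
  move=> i; have [G apG _] := planar_map_approximable i.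
  by have [[mf _ _] _] := approximable_tame apG; exact: measurable_funS mf.
have en x : enorm (planar_map x) <= 2 * d.
  rewrite /enorm sum_ord3 !mxE !inordK//= expr0n addr0 -[leRHS]ger0_norm ?mulr_ge0//.
  rewrite -sqrtr_sqr ler_sqrt ?sqr_ge0//.
  have [h1 h2] := fd x; have s1 : f1 x ^+ 2 <= d ^+ 2.
    by rewrite -[f1 x ^+ 2]real_normK ?num_real// lerXn2r ?nnegrE.
  have s2 : f2 x ^+ 2 <= d ^+ 2.
    by rewrite -[f2 x ^+ 2]real_normK ?num_real// lerXn2r ?nnegrE.
  by apply: le_trans (lerD s1 s2) _; have := sqr_ge0 d; rewrite exprMn; move: (d ^+ 2) => t; lra.
rewrite /Linfty_norm /Lnorm_on unlock /=; case: ifP => _; last by rewrite lee_fin mulr_ge0.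
apply/ess_sup_inf.ess_supP; apply: ae3_of_all => x; rewrite /patch /=; case: ifP => _.
  by rewrite lee_fin ger0_norm ?en// sqrtr_ge0.
by rewrite abse0 lee_fin mulr_ge0.
Qed.

End Inclusion.
End Fields.

Theorem theorem2 (R : realType) (q : R) (hq : 1 < q) (Omega : set (R3 R))
    (Omega_neq0 : Omega !=set0) (Omega_open : open Omega)
    (Omega_bounded : bounded_set Omega) :
  exists P : R3 R -> 'M[R]_3,
    [/\ forall i j, measurable_on Omega (fun x => P x i j),
        ae_on Omega (fun x => SO3 (P x)) &
        exists (u : nat -> R3 R -> 'rV[R]_3) (Du : nat -> R3 R -> 'M[R]_3),
          [/\ forall n, W10_vec q Omega (u n) /\ in_Linfty Omega (u n),
              forall n, weak_jacobian Omega (u n) (Du n),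
              forall n, ae_on Omega
                (fun x => Du n x *m P x + (Du n x *m P x)^T = 0),
              forall n, Lq_mxnorm q Omega (Du n) = (2 `^ q^-1)%:E &
              Linfty_norm Omega (u n) @[n --> \oo] --> 0%E]].
Proof.
have q0 : 0 < q by apply: lt_trans hq.
have [c [N [N0 BO disj]]] := open_disjoint_cubes Omega_open Omega_neq0.
pose hi n := corner (c n) (N n) 1.
have d0 n : 0 < n.+1%:R^-1 :> R by rewrite invr_gt0.
have /choice[D HD] n : exists D : (R3 R -> R) * (R3 R -> R) * ('I_3 -> R3 R -> R) * ('I_3 -> R3 R -> R),
    [/\ approximable (c n) (hi n) D.1.1.1 D.1.2, approximable (c n) (hi n) D.1.1.2 D.2,
      forall x, `|D.1.1.1 x| <= n.+1%:R^-1 /\ `|D.1.1.2 x| <= n.+1%:R^-1,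
      {ae @leb3 R, forall x, defect (vec D.1.2 x) (vec D.2 x) = 0} &
      (\int[@leb3 R]_x (density q D.1.2 x + density q D.2 x)%:E = 2%:E)%E].
  have [f1 [f2 [G1 [G2 H]]]] := cube_field (c n) (N0 n) q0 (d0 n).
  by exists (f1, f2, G1, G2).
pose G1 n := (D n).1.2; pose G2 n := (D n).2.
pose u n := planar_map (D n).1.1.1 (D n).1.1.2; pose Du n := planar_jac (G1 n) (G2 n).
pose A i := glue (fun n => G1 n i); pose B i := glue (fun n => G2 n i).
have t1 n i : tame (c n) (hi n) (G1 n i).
  by have [/approximable_tame[_ H] _ _ _ _] := HD n; exact: H.
have t2 n i : tame (c n) (hi n) (G2 n i).
  by have [_ /approximable_tame[_ H] _ _ _] := HD n; exact: H.
have s1 i n : supported_in (box (c n) (hi n)) (G1 n i) by case: (t1 n i).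
have s2 i n : supported_in (box (c n) (hi n)) (G2 n i) by case: (t2 n i).
have Linf n := planar_map_Linfty (let: And5 H _ _ _ _ := HD n in H) (let: And5 _ H _ _ _ := HD n in H)
  Omega (ltW (d0 n)) (let: And5 _ _ H _ _ := HD n in H).
exists (fun x => rotation (vec A x) (vec B x)); split.
- move=> i j; apply: measurable_funS (measurable_rotation _ _ _ _) => //= k.
    by apply: (measurable_glue disj (s1 k)) => n; case: (t1 n k).
  by apply: (measurable_glue disj (s2 k)) => n; case: (t2 n k).
- by apply: ae3_of_all => x _; exact: rotation_SO3.
exists u, Du; split.
- move=> n; have [ap1 ap2 _ _ _] := HD n; split; first exact: (planar_map_W10 ap1 ap2 (BO n) q0).
  by have [m L] := Linf n; split=> //; apply: le_lt_trans L _; rewrite ltry.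
- by move=> n; have [ap1 ap2 _ _ _] := HD n; exact: (planar_map_jacobian ap1 ap2 (BO n)).
- move=> n; have [ap1 ap2 _ ae _] := HD n.
  (* On cube [n] the glued gradients are those of [u n]; elsewhere [Du n] is zero, and the condition
     holds whatever the rotation is. *)
  apply: ae3_imp ae => x dx _; have [bx|bx] := pselect (box (c n) (hi n) x).
    have -> : vec A x = vec (G1 n) x.
      by rewrite /vec /A !(glue_on disj (s1 _) bx).
    have -> : vec B x = vec (G2 n) x.
      by rewrite /vec /B !(glue_on disj (s2 _) bx).
    by rewrite /Du planar_jacE; exact: jacobian_rotation_skew.
  by rewrite /Du (planar_jac_supported ap1 ap2 bx) mul0mx trmx0 addr0.
- by move=> n; have [ap1 ap2 _ _ E] := HD n; exact: (planar_jac_norm ap1 ap2 (BO n) q0 E).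
have dc0 : (2 * n.+1%:R^-1)%:E @[n --> \oo] --> (0 : \bar R).
  apply: cvg_EFin; first exact: nearW.
  rewrite -[X in _ --> X](mulr0 2); apply: cvgM; first exact: cvg_cst.
  exact: cvg_harmonic.
apply: (squeeze_cvge _ (cvg_cst 0%E) dc0); apply: nearW => n.
by have [_ ->] := Linf n; rewrite andbT; exact: Lnorm_ge0.
Qed.
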